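(* Let $(E,\iota,\pi)$ be a twist over a locally compact, Hausdorff and étale groupoid $G$ with non-compact unit space, and let $(\widetilde E,\widetilde\iota,\widetilde\pi)$ be the Alexandrov twist over the Alexandrov groupoid $\widetilde G$. Then $C^*(\widetilde E;\widetilde G)$ is isomorphic to the minimal unitization of $C^*(E;G)$, and $C^*_{\mathrm r}(\widetilde E;\widetilde G)$ is isomorphic to the minimal unitization of $C^*_{\mathrm r}(E;G)$.
   Context: For a topological groupoid $G$ with unit space $G^{(0)}$ and composable pairs $G^{(2)}$, $r(g)=gg^{-1}$, $s(g)=g^{-1}g$; $G$ is étale if $r$ is a local homeomorphism. $xG=\{g:r(g)=x\}$, $Gx=\{g:s(g)=x\}$. $\mathbf T$ is the circle group. Twists. A twist $(E,\iota,\pi)$ over a locally compact Hausdorff groupoid $G$ consists of a locally compact Hausdorff groupoid $E$ and groupoid homomorphisms $G^{(0)}\times\mathbf T\xrightarrow{\iota}E\xrightarrow{\pi}G$ (with $G^{(0)}\times\mathbf T$ the trivial group bundle) such that: (i) $\iota$ is a homeomorphism onto $\pi^{-1}(G^{(0)})$ (subspace topology) with $\iota(\pi(u),1)=u$ for all $u\in E^{(0)}$; (ii) $\pi$ is a continuous open surjection; (iii) $\iota(\pi(r(e)),z)e=e\,\iota(\pi(s(e)),z)$ for all $e\in E$, $z\in\mathbf T$. One identifies $E^{(0)}$ with $G^{(0)}$ via $\pi$. $\mathbf T$ acts on $E$ by $z\cdot e=\iota(r(e),z)e$. Alexandrov groupoid. Let $G^{(0)}_+=G^{(0)}\cup\{\infty\}$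 be the one-point compactification of $G^{(0)}$. Put $\widetilde G=G\cup\{\infty\}$, $\widetilde G^{(2)}=G^{(2)}\cup\{(\infty,\infty)\}$, $\widetilde G^{(0)}=G^{(0)}_+$; multiplication and inversion extend those of $G$ with $\infty\infty=\infty=\infty^{-1}$, and $r^{-1}(\infty)=s^{-1}(\infty)=\{\infty\}$. The topology has as basis the collection consisting of $\widetilde G$, all open subsets of $G^{(0)}_+$ and all open subsets of $G$. It is a locally compact Hausdorff étale groupoid. Alexandrov twist. $\widetilde E=E\cup\{\infty_z:z\in\mathbf T\}$, $\widetilde E^{(2)}=E^{(2)}\cup\{(\infty_w,\infty_z):w,z\in\mathbf T\}$, with composition as in $E$ and $\infty_w\infty_z=\infty_{wz}$, and range and source of $\infty_w$ equal to $\infty$; $\widetilde\iota$ extends $\iota$ by $\widetilde\iota(\infty,z)=\infty_z$; $\widetilde\pi$ extends $\pi$ by $\widetilde\pi(\infty_z)=\infty$. The topology on $\widetilde E$ has as basis the collection consisting of $\widetilde E$, the open sets of $E$, and the sets $\widetilde\iota(V)$ with $V$ open in $\widetilde G^{(0)}\times\mathbf T$. Then $(\widetilde E,\widetilde\iota,\widetilde\pi)$ is a twist over $\widetilde G$. Twisted $C^*$-algebras of a twist over an étale groupoid. Let $\lambda$ be normalized Haar measure on $\mathbf T$ and $\mathfrak s:G\to E$ any (not necessarily continuous) section of $\pi$. $E$ carries the left Haar system $\{\sigma^x\}_{x\in G^{(0)}}$ with $\int f\,d\sigma^x=\sum_{\gamma\in xG}\int_{\mathbf T}f(z\cdot\mathfrak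 s(\gamma))\,d\lambda(z)$; $\sigma_x(U)=\sigma^x(U^{-1})$. $C_c(E)$ is a $*$-algebra under $(f*g)(e)=\int f(d)g(d^{-1}e)\,d\sigma^{r(e)}(d)$ and $f^*(e)=\overline{f(e^{-1})}$. $C^*(E)$ is the completion of $C_c(E)$ in the norm $\sup_L\|L(f)\|$ over all $*$-homomorphisms $L:C_c(E)\to B(H_L)$ bounded for the $I$-norm $\|f\|_I=\max\{\sup_x\int|f|d\sigma^x,\sup_x\int|f|d\sigma_x\}$. Put $C_c(E;G)=\{f\in C_c(E): f(z\cdot e)=zf(e)\ \forall z\in\mathbf T, e\in E\}$. $C^*(E;G)$ is the closure of $C_c(E;G)$ in $C^*(E)$. $C^*_{\mathrm r}(E;G)$ is the completion of $C_c(E;G)$ in the norm $\sup_{x\in G^{(0)}}\|\pi^x(f)\|$, where $\pi^x(f)\xi=f*\xi$ on $L^2(Ex;Gx)=\{\xi\in L^2(Ex,\sigma_x):\xi(z\cdot e)=z\xi(e)\}$. Minimal unitization of a $C^*$-algebra $A$: the unique unital $C^*$-algebra $\widetilde A$ containing $A$ as an ideal with $\widetilde A/A\cong\mathbf C$ via $1+A\mapsto1$. *)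

(* Defs.v *)
From HB Require Import structures.
From mathcomp Require Import all_boot all_order all_algebra complex.
From mathcomp Require Import all_classical all_reals all_analysis.

Set Implicit Arguments.
Unset Strict Implicit.
Unset Printing Implicit Defensive.

Import Order.TTheory GRing.Theory Num.Theory.
Import numFieldNormedType.Exports.

Local Open Scope classical_set_scope.
Local Open Scope ring_scope.
Local Open Scope complex_scope.

HB.instance Definition _ (R : realType) := GRing.ComAlgebra.copy R[i] R[i]^o.
HB.instance Definition _ (R : realType) := Vector.copy R[i] R[i]^o.
HB.instance Definition _ (R : realType) := NormedModule.copy R[i] R[i]^o.

(* Norms over R[i] are R[i]-valued in the library; this is the same number
   seen in R. *)
Definition rnorm (R : realType) (V : normedModType R[i]) (v : V) : R :=
  complex.Re `|v|.

Definition circle (R : realType) := {z : R[i] | `|z| == 1}.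

HB.instance Definition _ (R : realType) := Choice.on (circle R).
HB.instance Definition _ (R : realType) :=
  Topological.copy (circle R) (initial_topology (val : circle R -> R[i])).

Section Circle.
Variable R : realType.
Local Notation circle := (circle R).

Lemma circle_one_subproof : `|1 : R[i]| == 1.
Proof. by rewrite normr1. Qed.
Definition circle_one : circle := exist _ 1 circle_one_subproof.

Lemma circle_mul_subproof (w z : circle) : `|val w * val z| == 1.
Proof. by rewrite normrM (eqP (valP w)) (eqP (valP z)) mulr1. Qed.
Definition circle_mul (w z : circle) : circle :=
  exist _ (val w * val z) (circle_mul_subproof w z).

Lemma circle_inv_subproof (z : circle) : `|(val z)^-1| == 1.
Proof. by rewrite normfV (eqP (valP z)) invr1. Qed.
Definition circle_inv (z : circle) : circle :=
  exist _ (val z)^-1 (circle_inv_subproof z).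

Lemma cis_subproof (t : R) : `|cos t +i* sin t| == 1.
Proof. by rewrite normc_def /= cos2Dsin2 sqrtr1. Qed.
Definition cis (t : R) : circle := exist _ (cos t +i* sin t) (cis_subproof t).

(* Normalized Haar measure on the circle is the image of Lebesgue measure on
   [0, 1] under t |-> exp (2 pi i t). *)
Definition circle_int (f : circle -> R[i]) : R[i] :=
  (\int[lebesgue_measure]_(t in `[0, 1]) complex.Re (f (cis (2 * pi * t))))
  +i* (\int[lebesgue_measure]_(t in `[0, 1]) complex.Im (f (cis (2 * pi * t)))).

Definition circle_eint (f : circle -> \bar R) : \bar R :=
  (\int[lebesgue_measure]_(t in `[0%R, 1%R]) f (cis (2 * pi * t)))%E.

End Circle.

Definition homeo_between (X Y : topologicalType) (A : set X) (B : set Y)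
    (f : X -> Y) : Prop :=
  [/\ set_bij A B f, {within A, continuous f} &
    forall U, open U -> exists2 V, open V & f @` (A `&` U) = B `&` V].

(* Operations only: the groupoid laws and the compatibility with the topology
   are the predicates below.  [gmul g h] is meaningful when [composable (g, h)]. *)
Record groupoid := Groupoid {
  arrow :> topologicalType;
  composable : set (arrow * arrow);
  gmul : arrow -> arrow -> arrow;
  ginv : arrow -> arrow }.

Section GroupoidTheory.
Variable G : groupoid.
Implicit Types g h k : G.

Definition rng g : G := gmul g (ginv g).
Definition src g : G := gmul (ginv g) g.
Definition units : set G := range rng.

Record groupoid_laws : Prop := {
  ginvK : forall g, ginv (ginv g) = g;
  composable_invl : forall g, composable (ginv g, g);
  composable_mul : forall g h k, composable (g, h) -> composable (h, k) ->
    composable (gmul g h, k) /\ composable (g, gmul h k);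
  gmulA : forall g h k, composable (g, h) -> composable (h, k) ->
    gmul (gmul g h) k = gmul g (gmul h k);
  gmulKl : forall g h, composable (g, h) -> gmul (ginv g) (gmul g h) = h;
  gmulKr : forall g h, composable (g, h) -> gmul (gmul g h) (ginv h) = g }.

Record topological_groupoid : Prop := {
  topological_groupoid_laws : groupoid_laws;
  gmul_continuous :
    {within composable (g := G), continuous (fun p => gmul p.1 p.2)};
  ginv_continuous : continuous (ginv (g := G)) }.

Definition lch_groupoid : Prop :=
  [/\ topological_groupoid, locally_compact [set: G] & hausdorff_space G].

(* The range map is a local homeomorphism from G to its unit space, the latter
   with the subspace topology. *)
Definition etale : Prop := forall g, exists U W : set G,
  [/\ open U, U g, open W & homeo_between U (units `&` W) rng].

End GroupoidTheory.

Definition groupoid_hom (G H : groupoid) (f : G -> H) : Prop :=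
  forall g h, composable (g, h) ->
    composable (f g, f h) /\ f (gmul g h) = gmul (f g) (f h).

(* [twist_iota u z] is meaningful only for [u] in [units G]. *)
Record twist_data (R : realType) (G : groupoid) := TwistData {
  twist_total :> groupoid;
  twist_iota : G -> circle R -> twist_total;
  twist_proj : twist_total -> G }.

Section Twist.
Variables (R : realType) (G : groupoid) (E : twist_data R G).

Record is_twist : Prop := {
  twist_lch : lch_groupoid E;
  iota_hom : forall u, units u -> forall w z : circle R,
    composable (twist_iota E u w, twist_iota E u z) /\
    twist_iota E u (circle_mul w z) = gmul (twist_iota E u w) (twist_iota E u z);
  proj_hom : groupoid_hom (twist_proj (t := E));
  iota_homeo : homeo_between (@units G `*` [set: circle R])
    (twist_proj (t := E) @^-1` @units G) (fun p => twist_iota E p.1 p.2);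
  iota_unit : forall u : E, units u -> twist_iota E (twist_proj u) (circle_one R) = u;
  proj_continuous : continuous (twist_proj (t := E));
  proj_open : forall U : set E, open U -> open (twist_proj (t := E) @` U);
  proj_surj : range (twist_proj (t := E)) = setT;
  iota_central : forall (e : E) z,
    gmul (twist_iota E (twist_proj (rng e)) z) e = gmul e (twist_iota E (twist_proj (src e)) z) }.

Definition circle_act (z : circle R) (e : E) : E :=
  gmul (twist_iota E (twist_proj (rng e)) z) e.

End Twist.

Definition unit_space (G : groupoid) : topologicalType := set_type (@units G).
Definition unit_space_plus (G : groupoid) : topologicalType :=
  one_point_compactification (unit_space G).

(* G u {oo}, with oo = None. *)
Definition alex_arrow (G : groupoid) : Type := option G.

(* The inclusion of the one-point compactification of the unit space. *)
Definition alex_unit (G : groupoid) (u : unit_space_plus G) : alex_arrow G :=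
  omap (fun v : unit_space G => val v) u.

Definition alex_base (G : groupoid) : set (set (alex_arrow G)) :=
  [set setT] `|`
  [set alex_unit (G := G) @` V | V in @open (unit_space_plus G)] `|`
  [set Some @` V | V in @open G].

(* For an etale locally compact Hausdorff G, [alex_base G] is a basis, so that
   the topology it generates as a subbasis is the one having it as a basis. *)
HB.instance Definition _ (G : groupoid) := Choice.on (alex_arrow G).
HB.instance Definition _ (G : groupoid) :=
  isSubBaseTopological.Build (alex_arrow G) (@alex_base G) id.

Definition alex_groupoid (G : groupoid) : groupoid :=
  @Groupoid (alex_arrow G)
    [set p | match p with
             | (Some g, Some h) => composable (g, h)
             | (None, None) => True
             | _ => False
             end]
    (fun g h => match g, h with
                | Some g, Some h => Some (gmul g h)
                | _, _ => None
                end)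
    (omap (ginv (g := G))).

(* E u {oo_z : z in the circle}, with oo_z = inr z. *)
Definition alex_twist_arrow (R : realType) (G : groupoid)
  (E : twist_data R G) : Type := (E + circle R)%type.

Definition alex_iota (R : realType) (G : groupoid) (E : twist_data R G)
    (u : alex_arrow G) (z : circle R) : alex_twist_arrow E :=
  if u is Some v then inl (twist_iota E v z) else inr z.

Definition alex_proj (R : realType) (G : groupoid) (E : twist_data R G)
    (e : alex_twist_arrow E) : alex_arrow G :=
  if e is inl d then Some (twist_proj d) else None.

Definition alex_twist_base (R : realType) (G : groupoid) (E : twist_data R G) :
    set (set (alex_twist_arrow E)) :=
  [set setT] `|`
  [set inl @` V | V in @open E] `|`
  [set [set alex_iota E (alex_unit p.1) p.2 | p in V]
     | V in @open (unit_space_plus G * circle R)%type].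

(* As for [alex_base], this collection is a basis when E is a twist over an
   etale locally compact Hausdorff G. *)
HB.instance Definition _ (R : realType) (G : groupoid) (E : twist_data R G) :=
  Choice.on (alex_twist_arrow E).
HB.instance Definition _ (R : realType) (G : groupoid) (E : twist_data R G) :=
  isSubBaseTopological.Build (alex_twist_arrow E) (@alex_twist_base R G E) id.

(* The value of the product off the composable pairs is irrelevant. *)
Definition alex_twist_groupoid (R : realType) (G : groupoid)
    (E : twist_data R G) : groupoid :=
  @Groupoid (alex_twist_arrow E)
    [set p | match p with
             | (inl d, inl e) => composable (d, e)
             | (inr _, inr _) => True
             | _ => False
             end]
    (fun d e => match d, e with
                | inl d, inl e => inl (gmul d e)
                | inr w, inr z => inr (circle_mul w z)
                | _, _ => d
                end)
    (fun e => match e with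
              | inl d => inl (ginv d)
              | inr z => inr (circle_inv z)
              end).

Definition alex_twist (R : realType) (G : groupoid) (E : twist_data R G) :
    twist_data R (alex_groupoid G) :=
  @TwistData R (alex_groupoid G) (alex_twist_groupoid E)
    (@alex_iota R G E) (@alex_proj R G E).

(* Not necessarily unital. *)
Record cstar_algebra (R : realType) := CstarAlgebra {
  cs_sort :> completeNormedModType R[i];
  cs_mul : cs_sort -> cs_sort -> cs_sort;
  cs_star : cs_sort -> cs_sort;
  cs_mulA : associative cs_mul;
  cs_mul_linl : forall y (a : R[i]) x x',
    cs_mul (a *: x + x') y = a *: cs_mul x y + cs_mul x' y;
  cs_mul_linr : forall x (a : R[i]) y y',
    cs_mul x (a *: y + y') = a *: cs_mul x y + cs_mul x y';
  cs_starK : involutive cs_star;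
  cs_star_antilin : forall (a : R[i]) x y,
    cs_star (a *: x + y) = conjc a *: cs_star x + cs_star y;
  cs_starM : forall x y, cs_star (cs_mul x y) = cs_mul (cs_star y) (cs_star x);
  cs_normM : forall x y, `|cs_mul x y| <= `|x| * `|y|;
  cs_norm_star : forall x, `|cs_mul (cs_star x) x| = `|x| ^+ 2 }.

Section CstarTheory.
Variable R : realType.
Implicit Types A B U : cstar_algebra R.

Definition star_hom A B (f : {linear A -> B}) : Prop :=
  (forall x y, f (cs_mul x y) = cs_mul (f x) (f y)) /\
  (forall x, f (cs_star x) = cs_star (f x)).

Definition star_isomorphic A B : Prop :=
  exists2 f : {linear A -> B}, star_hom f & bijective f.

(* U is unital, contains (a copy k(A) of) A as an ideal, and chi induces an
   isomorphism of U / k(A) onto the complex numbers with one + k(A) |-> 1. *)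
Definition minimal_unitization A U : Prop :=
  exists (k : {linear A -> U}) (one : U) (chi : {scalar U}),
    [/\ star_hom k /\ injective k,
        forall x, cs_mul one x = x /\ cs_mul x one = x,
        forall a x, range k (cs_mul x (k a)) /\ range k (cs_mul (k a) x),
        [/\ forall x y, chi (cs_mul x y) = chi x * chi y,
            forall x, chi (cs_star x) = conjc (chi x) & chi one = 1] &
        [set x | chi x = 0] = range k].

(* [A], with the map [j], is the completion of the *-algebra [S] of functions
   on [X], with operations [mulS] and [starS], for the (semi)norm [nu]; only the
   restriction of [j] to [S] matters. *)
Definition is_completion (X : Type) (S : set (X -> R[i]))
    (mulS : (X -> R[i]) -> (X -> R[i]) -> X -> R[i])
    (starS : (X -> R[i]) -> X -> R[i]) (nu : (X -> R[i]) -> \bar R)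
    A (j : (X -> R[i]) -> A) : Prop :=
  [/\ forall (a : R[i]) f g, S f -> S g ->
        j (fun x => a * f x + g x) = a *: j f + j g,
      forall f g, S f -> S g -> j (mulS f g) = cs_mul (j f) (j g),
      forall f, S f -> j (starS f) = cs_star (j f),
      forall f, S f -> (rnorm (j f))%:E = nu f &
      closure (j @` S) = setT].

Definition op_norm (V : normedModType R[i]) (T : V -> V) : \bar R :=
  ereal_sup [set (rnorm (T v))%:E | v in [set v | rnorm v <= 1]].

End CstarTheory.

Record hilbert (R : realType) := Hilbert {
  hil_sort :> completeNormedModType R[i];
  hil_dot : {dot hil_sort for conjc};
  hil_norm : forall v, `|v| ^+ 2 = hil_dot v v }.

Section TwistedAlgebras.
Variables (R : realType) (G : groupoid) (E : twist_data R G).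
(* A section of the projection, not necessarily continuous. *)
Variable sec : G -> E.

Definition Cc : set (E -> R[i]) :=
  [set f | continuous f /\ compact (closure [set e | f e != 0])].

Definition Cc_equivariant : set (E -> R[i]) :=
  [set f | Cc f /\ forall z e, f (circle_act z e) = val z * f e].

(* The integral against sigma^x: for complex functions with support over
   finitely many elements of xG, and for [0, +oo]-valued functions. *)
Definition haar_int (x : G) (f : E -> R[i]) : R[i] :=
  \sum_(g \in [set g | rng g = x]) circle_int (fun z => f (circle_act z (sec g))).

Definition haar_eint (x : G) (f : E -> \bar R) : \bar R :=
  \esum_(g in [set g | rng g = x]) circle_eint (fun z => f (circle_act z (sec g))).

(* The integral against sigma_x, the image of sigma^x under inversion. *)
Definition haar_eint_src (x : G) (f : E -> \bar R) : \bar R :=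
  haar_eint x (fun e => f (ginv e)).

Definition convolution (f g : E -> R[i]) (e : E) : R[i] :=
  haar_int (twist_proj (rng e)) (fun d => f d * g (gmul (ginv d) e)).

Definition fstar (f : E -> R[i]) (e : E) : R[i] := conjc (f (ginv e)).

Definition I_norm (f : E -> R[i]) : \bar R :=
  Order.max
    (ereal_sup [set haar_eint x (fun e => (rnorm (f e))%:E) | x in @units G])
    (ereal_sup [set haar_eint_src x (fun e => (rnorm (f e))%:E) | x in @units G]).

(* [L] restricts to an I-norm bounded *-homomorphism from C_c(E) to B(H). *)
Definition bounded_rep (H : hilbert R) (L : (E -> R[i]) -> H -> H) : Prop :=
  [/\ forall f, Cc f -> linear (L f) /\ (op_norm (L f) < +oo)%E,
      forall (a : R[i]) f g v, Cc f -> Cc g ->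
        L (fun e => a * f e + g e) v = a *: L f v + L g v,
      forall f g v, Cc f -> Cc g -> L (convolution f g) v = L f (L g v),
      forall f v w, Cc f -> hil_dot H (L f v) w = hil_dot H v (L (fstar f) w) &
      exists M : R, forall f, Cc f -> (op_norm (L f) <= M%:E * I_norm f)%E].

Definition full_norm (f : E -> R[i]) : \bar R :=
  ereal_sup [set r | exists (H : hilbert R) (L : (E -> R[i]) -> H -> H),
    bounded_rep L /\ r = op_norm (L f)].

(* Elements of L^2(Ex; Gx) are represented by functions on E of which only the
   values on Ex matter.  An equivariant function is continuous on each circle
   orbit of Ex, hence measurable for sigma_x, and it vanishes on Ex as soon as it
   vanishes almost everywhere, so no quotient is needed. *)
Definition L2_norm (x : G) (xi : E -> R[i]) : \bar R :=
  poweR (haar_eint_src x (fun e => (rnorm (xi e) ^+ 2)%:E)) 2^-1.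

Definition L2 (x : G) : set (E -> R[i]) :=
  [set xi | (forall z e, twist_proj (src e) = x ->
               xi (circle_act z e) = val z * xi e) /\
            (L2_norm x xi < +oo)%E].

Definition regular_rep_norm (x : G) (f : E -> R[i]) : \bar R :=
  ereal_sup [set L2_norm x (convolution f xi) |
    xi in [set xi | L2 x xi /\ (L2_norm x xi <= 1)%E]].

Definition reduced_norm (f : E -> R[i]) : \bar R :=
  ereal_sup [set regular_rep_norm x f | x in @units G].

(* [A] is (a copy of) C^*(E;G): the closure of C_c(E;G) in the completion B of
   C_c(E). *)
Definition is_full_cstar (A : cstar_algebra R) : Prop :=
  exists (B : cstar_algebra R) (j : (E -> R[i]) -> B) (k : {linear A -> B}),
    [/\ is_completion Cc convolution fstar full_norm j,
        star_hom k, forall a, `|k a| = `|a| &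
        range k = closure (j @` Cc_equivariant)].

(* [A] is (a copy of) C^*_r(E;G). *)
Definition is_reduced_cstar (A : cstar_algebra R) : Prop :=
  exists j : (E -> R[i]) -> A,
    is_completion Cc_equivariant convolution fstar reduced_norm j.

End TwistedAlgebras.

(* Main.v *)
(* Let u be the function iota(x, z) |-> z, supported over the units, on the
   Alexandrov twist E~; it is a unit for convolution of equivariant functions.
   Extension by zero embeds C_c(E;G) in C_c(E~;G~), and F |-> F(oo_1) is a
   *-character there. When F(oo_1) = 0, the restriction of F to E is uniformly
   close to elements of C_c(E;G), with errors supported over the units; on such
   functions convolution is pointwise and both norms are at most the supremum
   norm. So each completion of C_c(E~;G~) is the sum of C u and of the closure of
   C_c(E;G), as soon as extension by zero is isometric and F |-> F(oo_1) is
   contractive.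

   For the reduced norm this is read off the fibres of E~, which are those of E
   and the circle at infinity. For the full norm, a representation L of C_c(E;G)
   extends to E~ by F |-> L(F - F(oo_1) u) + F(oo_1), where L is first extended by
   continuity to functions vanishing at infinity, and averaging against the
   conjugate of z turns representations of C_c(E;G) into representations of
   C_c(E). *)

(* A small uniform norm alone does not control the I-norm, because fibres may carry many arrows. A
   range fibre contains at most one unit, though, so over the units the I-norm reduces to the
   supremum norm. This is why [near_Cc] asks for an error that is small and also vanishes off the
   units. Such approximants exist because the units of an étale Hausdorff groupoid are clopen, so a
   function can be truncated over them alone.

   A bounded representation comes with an arbitrary constant [M], so the I-norm gives only [M e] for
   errors of size [e]. The contractive bound in the full norm needs a positivity argument instead.
   Crude constants in I-norm estimates, such as the factor 2 for integrals of complex functions, are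
   then harmless.

   About the Alexandrov twist only the algebra in [algebraic_twist] and the topological facts in
   [regular_twist] are established. The two sections in the theorem are unrelated; norms on the two
   twists are compared through the section [alex_sec], built from the one of [E]. *)
Require Import Defs.
From HB Require Import structures.
From mathcomp Require Import all_boot all_order all_algebra complex.
From mathcomp Require Import all_classical all_reals all_analysis.
From mathcomp Require Import ring lra.

Set Implicit Arguments.
Unset Strict Implicit.
Unset Printing Implicit Defensive.
Import Order.TTheory GRing.Theory Num.Theory.
Import numFieldNormedType.Exports.
Local Open Scope classical_set_scope.
Local Open Scope ring_scope.
Local Open Scope complex_scope.

(** * Complex-valued functions on the circle *)

Section RNorm.
Variables (R : realType) (V : normedModType R[i]).
Implicit Types v w : V.

Lemma rnormE v : `|v| = (rnorm v)%:C.
Proof. by rewrite /rnorm RRe_real// normr_real. Qed.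

Lemma rnorm_ge0 v : 0 <= rnorm v.
Proof. by rewrite -lecR -[X in _ <= X]rnormE normr_ge0. Qed.

Lemma rnorm0 : rnorm (0 : V) = 0.
Proof. by rewrite /rnorm normr0. Qed.

Lemma rnorm0_eq0 v : rnorm v = 0 -> v = 0.
Proof. by move=> v0; apply/eqP; rewrite -normr_eq0 rnormE v0. Qed.

Lemma rnormD v w : rnorm (v + w) <= rnorm v + rnorm w.
Proof. by rewrite -lecR raddfD /= -!rnormE ler_normD. Qed.

Lemma rnormN v : rnorm (- v) = rnorm v.
Proof. by rewrite /rnorm normrN. Qed.

Lemma rnormB v w : rnorm (v - w) = rnorm (w - v).
Proof. by rewrite -opprB rnormN. Qed.

Lemma rnormBD u v w : rnorm (v - w) <= rnorm (v - u) + rnorm (u - w).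
Proof. by rewrite (le_trans _ (rnormD _ _))// addrA subrK. Qed.

Lemma rnormZ (a : R[i]) v : rnorm (a *: v) = complex.Re `|a| * rnorm v.
Proof.
apply: (@complexI R); rewrite -rnormE normrZ rmorphM /= -rnormE; congr (_ * _).
Qed.

(** The order of [R[i]] only compares numbers with equal imaginary parts, so a positive epsilon in
    [R[i]] is already real. *)
Lemma cvg_rnorm (T : Type) (F : set_system T) (f : T -> V) (v : V) :
  Filter F ->
  (f x @[x --> F] --> v) <-> (forall e : R, 0 < e -> \near F, rnorm (v - f F) < e).
Proof.
move=> FF; split => [/cvgrPdist_lt fv e e0|fv].
  have := fv e%:C; rewrite ltcR => /(_ e0); apply: filterS => x.
  by rewrite rnormE ltcR.
apply/cvgrPdist_lt => e; rewrite ltcE /= => /andP[/eqP e0 epos].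
apply: filterS (fv _ epos) => x; rewrite rnormE ltcE/= e0 eqxx/=.
by [].
Qed.

End RNorm.

Section ComplexNorm.
Variable R : realType.
Implicit Types z w : R[i].

Lemma rnormc_def z : rnorm z = Num.sqrt (complex.Re z ^+ 2 + complex.Im z ^+ 2).
Proof. by rewrite /rnorm normc_def. Qed.

Lemma rnormM z w : rnorm (z * w) = rnorm z * rnorm w.
Proof. exact: rnormZ. Qed.

Lemma rnormJ z : rnorm (conjc z) = rnorm z.
Proof. by rewrite /rnorm normcJ. Qed.

Lemma rnormR (x : R) : rnorm x%:C = `|x|.
Proof. by rewrite rnormc_def /= expr0n addr0 sqrtr_sqr. Qed.

Lemma normr_Re z : `|complex.Re z| <= rnorm z.
Proof. by rewrite rnormc_def -sqrtr_sqr ler_wsqrtr// lerDl sqr_ge0. Qed.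

Lemma normr_Im z : `|complex.Im z| <= rnorm z.
Proof. by rewrite rnormc_def -sqrtr_sqr ler_wsqrtr// lerDr sqr_ge0. Qed.

Lemma rnorm_ReIm z : rnorm z <= `|complex.Re z| + `|complex.Im z|.
Proof.
case: z => a b; have -> : a +i* b = a%:C + b *i by apply/eqP; rewrite eq_complex/= !(addr0, add0r) !eqxx.
rewrite (le_trans (rnormD _ _))//= addr0 add0r rnormR lerD2l.
by rewrite rnormc_def /= expr0n add0r sqrtr_sqr.
Qed.

Lemma mulcJ z : z * conjc z = (rnorm z ^+ 2)%:C.
Proof. by rewrite -sqr_normc rnormE rmorphXn. Qed.

Lemma Re_continuous : continuous (@complex.Re R).
Proof.
move=> z; apply/(@cvgrPdist_lt _ _ _ _ (nbhs_filter z)) => e e0.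
have /cvg_rnorm/(_ e e0) : (w @[w --> z] --> z) by exact: cvg_id.
apply: filterS => w; apply: le_lt_trans; rewrite (le_trans _ (normr_Re _))//.
by rewrite raddfB.
Qed.

Lemma Im_continuous : continuous (@complex.Im R).
Proof.
move=> z; apply/(@cvgrPdist_lt _ _ _ _ (nbhs_filter z)) => e e0.
have /cvg_rnorm/(_ e e0) : (w @[w --> z] --> z) by exact: cvg_id.
apply: filterS => w; apply: le_lt_trans; rewrite (le_trans _ (normr_Im _))//.
by rewrite raddfB.
Qed.

Lemma cvg_complex (T : Type) (F : set_system T) (FF : Filter F) (a b : T -> R) (z : R[i]) :
  a x @[x --> F] --> complex.Re z -> b x @[x --> F] --> complex.Im z ->
  a x +i* b x @[x --> F] --> z.
Proof.
move=> /cvgrPdist_lt az /cvgrPdist_lt bz; apply/cvg_rnorm => e e0.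
have e2 : 0 < e / 2 by rewrite divr_gt0.
move: (az _ e2) (bz _ e2); apply: filterS2 => x ax bx.
rewrite (le_lt_trans (rnorm_ReIm _))//.
by rewrite [e]splitr ltrD//; case: (z) ax bx => u v /=.
Qed.

Lemma conjc_continuous : continuous (@conjc R).
Proof.
move=> z; apply/(@cvg_rnorm _ _ _ _ _ _ (nbhs_filter z)) => e e0.
have /cvg_rnorm/(_ e e0) : (w @[w --> z] --> z) by exact: cvg_id.
by apply: filterS => w; rewrite -rmorphB rnormJ.
Qed.

End ComplexNorm.

Section ContinuousFunctions.
Variables X Y Z : topologicalType.

Lemma cont_cst (y : Y) : continuous (fun _ : X => y).
Proof. by move=> x; exact: cvg_cst. Qed.

Lemma cont_comp (f : X -> Y) (g : Y -> Z) :
  continuous f -> continuous g -> continuous (fun x => g (f x)).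
Proof. by move=> cf cg x; apply: continuous_comp; [exact: cf|exact: cg]. Qed.

Lemma cont_pair (f : X -> Y) (g : X -> Z) :
  continuous f -> continuous g -> continuous (fun x => (f x, g x)).
Proof. by move=> cf cg x; apply: cvg_pair; [exact: cf|exact: cg]. Qed.

Lemma cont_fst : continuous (@fst X Y).
Proof. by move=> x; exact: cvg_fst. Qed.

Lemma cont_snd : continuous (@snd X Y).
Proof. by move=> x; exact: cvg_snd. Qed.

Lemma cont_pairr (x : X) : continuous (fun y : Y => (x, y)).
Proof. by move=> y; apply: cvg_pair; [exact: cvg_cst|exact: cvg_id]. Qed.

Variable K : numFieldType.
Implicit Types f g : X -> K.

Lemma contD f g : continuous f -> continuous g -> continuous (fun x => f x + g x).
Proof. by move=> cf cg x; apply: cvgD; [exact: cf|exact: cg]. Qed.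

Lemma contB f g : continuous f -> continuous g -> continuous (fun x => f x - g x).
Proof. by move=> cf cg x; apply: cvgB; [exact: cf|exact: cg]. Qed.

Lemma contM f g : continuous f -> continuous g -> continuous (fun x => f x * g x).
Proof. by move=> cf cg x; apply: cvgM; [exact: cf|exact: cg]. Qed.

Lemma cont_sum (I : Type) (r : seq I) (F : I -> X -> K) :
  (forall i, continuous (F i)) -> continuous (fun x => \sum_(i <- r) F i x).
Proof.
move=> cF; elim: r => [|i r IH].
  by under eq_fun do rewrite big_nil; move=> x; exact: cvg_cst.
by under eq_fun do rewrite big_cons; exact: contD.
Qed.

End ContinuousFunctions.

Section ComplexContinuous.
Variables (R : realType) (X : topologicalType).
Implicit Types f g : X -> R[i].

Lemma ccontD f g : continuous f -> continuous g -> continuous (fun x => f x + g x).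
Proof. by move=> cf cg x; apply: cvgD; [exact: cf|exact: cg]. Qed.

Lemma ccontB f g : continuous f -> continuous g -> continuous (fun x => f x - g x).
Proof. by move=> cf cg x; apply: cvgB; [exact: cf|exact: cg]. Qed.

Lemma ccontM f g : continuous f -> continuous g -> continuous (fun x => f x * g x).
Proof. by move=> cf cg x; apply: cvgM; [exact: cf|exact: cg]. Qed.

Lemma ccontZ (a : R[i]) f : continuous f -> continuous (fun x => a * f x).
Proof. by move=> cf x; apply: cvgM; [exact: cvg_cst|exact: cf]. Qed.
End ComplexContinuous.

Section CircleTopology.
Variable R : realType.
Local Notation circle := (circle R).
Implicit Types z w : circle.

Lemma circle_mulA : associative (@circle_mul R).
Proof. by move=> x y z; apply: val_inj; rewrite /= mulrA. Qed.

Lemma circle_mulC : commutative (@circle_mul R).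
Proof. by move=> x y; apply: val_inj; rewrite /= mulrC. Qed.

Lemma circle_mul1 : left_id (circle_one R) (@circle_mul R).
Proof. by move=> x; apply: val_inj; rewrite /= mul1r. Qed.

Lemma circle_neq0 z : val z != 0.
Proof. by rewrite -normr_eq0 (eqP (valP z)) oner_eq0. Qed.

Lemma circle_mulV : left_inverse (circle_one R) (@circle_inv R) (@circle_mul R).
Proof. by move=> x; apply: val_inj; rewrite /= mulVf// circle_neq0. Qed.

Lemma circle_mulK z w : circle_mul (circle_inv z) (circle_mul z w) = w.
Proof. by rewrite circle_mulA circle_mulV circle_mul1. Qed.

Lemma circle_invK : involutive (@circle_inv R).
Proof. by move=> z; apply: val_inj; rewrite /= invrK. Qed.

Lemma rnorm_circle z : rnorm (val z) = 1.
Proof. by apply: (@complexI R); rewrite -rnormE (eqP (valP z)). Qed.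

Lemma conj_circle z : conjc (val z) = (val z)^-1.
Proof.
apply: (mulfI (circle_neq0 z)); rewrite mulfV ?circle_neq0//.
by rewrite mulcJ rnorm_circle expr1n.
Qed.

Lemma val_circle_continuous : continuous (val : circle -> R[i]).
Proof. exact: initial_continuous. Qed.

Lemma circle_continuousP (X : topologicalType) (f : X -> circle) :
  continuous (val \o f) -> continuous f.
Proof. exact: continuous_comp_initial. Qed.

Lemma circle_mul_continuous :
  continuous (fun p : circle * circle => circle_mul p.1 p.2).
Proof.
apply: circle_continuousP => p; apply: (@cvgM R[i]).
- by apply: (@cvg_comp _ _ _ fst val); [exact: cvg_fst|exact: val_circle_continuous].
- by apply: (@cvg_comp _ _ _ snd val); [exact: cvg_snd|exact: val_circle_continuous].
Qed.

Lemma circle_mull_continuous w : continuous (circle_mul w).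
Proof.
apply: circle_continuousP; apply: contM; first exact: cont_cst.
exact: val_circle_continuous.
Qed.

Lemma circle_inv_continuous : continuous (@circle_inv R).
Proof.
apply: circle_continuousP => z.
have -> : val \o @circle_inv R = @conjc R \o val.
  by apply/funext => x /=; rewrite conj_circle.
by apply: continuous_comp; [exact: val_circle_continuous|exact: conjc_continuous].
Qed.

Lemma cis_continuous : continuous (@cis R).
Proof.
apply: circle_continuousP => t; apply: cvg_complex.
- exact: continuous_cos.
- exact: continuous_sin.
Qed.

Lemma cisD (s t : R) : cis (s + t) = circle_mul (cis s) (cis t).
Proof.
apply: val_inj; apply/eqP; rewrite eq_complex/= cosD sinD eqxx/=.
by rewrite addrC.
Qed.

Lemma cis2pi : cis (2 * pi) = circle_one R.
Proof.
apply: val_inj; apply/eqP; rewrite mulr_natl eq_complex/= cos2pi eqxx/=.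
by rewrite sin2pi.
Qed.

Lemma cisN (t : R) : cis (- t) = circle_inv (cis t).
Proof.
by apply: val_inj; rewrite /= -(conj_circle (cis t)) /= cosN sinN.
Qed.

(** The angle is [acos] of the real part on the upper half circle, and [2 pi] minus it on the lower
    half. Compactness and rotation invariance are both derived from this parametrization. *)
Lemma circle_cis z : exists2 t : R, 0 <= t <= 1 & z = cis (2 * pi * t).
Proof.
have pi0 := pi_gt0 R.
case: z => -[a b] ab; have := ab; rewrite normc_def => /eqP[/(congr1 (fun x => x ^+ 2))].
rewrite expr1n sqr_sqrtr ?addr_ge0 ?sqr_ge0//= => ab1.
have a1 : -1 <= a <= 1.
  by rewrite -ler_norml -(@ler_pXn2r _ 2)// ?nnegrE// expr1n real_normK ?num_real// -ab1 lerDl sqr_ge0.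
have /andP[ac0 acpi] : 0 <= acos a <= pi by rewrite acos_ge0 ?acos_lepi.
have sb : Num.sqrt (1 - a ^+ 2) = `|b|.
  by rewrite -ab1 addrAC subrr add0r sqrtr_sqr.
have tp0 : 0 < 2 * pi :> R by rewrite mulr_gt0.
have tp1 (x : R) : 0 <= x <= 2 * pi -> 0 <= x / (2 * pi) <= 1.
  by move=> /andP[x0 x1]; rewrite ler_pdivrMr// mul1r x1 andbT divr_ge0// ltW.
have tpK (x : R) : 2 * pi * (x / (2 * pi)) = x by rewrite mulrC divfK// gt_eqF.
case: (leP 0 b) => b0.
  exists (acos a / (2 * pi)); first by apply: tp1; rewrite ac0/=; lra.
  by rewrite tpK; apply: val_inj; rewrite /= acosK ?in_itv//= sin_acos// sb ger0_norm.
exists ((2 * pi - acos a) / (2 * pi)); first by apply: tp1; apply/andP; split; lra.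
rewrite tpK cisD cis2pi circle_mul1 cisN.
apply: val_inj; rewrite /= -(conj_circle (cis (acos a)))/=.
by rewrite acosK ?in_itv//= sin_acos// sb ltr0_norm// opprK.
Qed.

Lemma circle_compact : compact [set: circle].
Proof.
have -> : [set: circle] = (fun t : R => cis (2 * pi * t)) @` `[0, 1]%classic.
  apply/seteqP; split => // z _; have [t t01 ->] := circle_cis z.
  by exists t => //=; rewrite in_itv.
apply: continuous_compact; last exact: segment_compact.
apply: continuous_subspaceT => t; apply: continuous_comp; last exact: cis_continuous.
by apply: cvgM; [exact: cvg_cst|exact: cvg_id].
Qed.

End CircleTopology.

Section CircleIntegral.
Variable R : realType.
Local Notation circle := (circle R).
Local Notation mu := (@lebesgue_measure R).
Implicit Types (z w : circle) (p q : circle -> R) (f g : circle -> R[i]).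

Definition wind (t : R) : circle := cis (2 * pi * t).

Definition circle_rint p : R := \int[mu]_(t in `[0, 1]) p (wind t).

Lemma windD (s t : R) : wind (s + t) = circle_mul (wind s) (wind t).
Proof. by rewrite /wind mulrDr cisD. Qed.

Lemma wind1 : wind 1 = circle_one R.
Proof. by rewrite /wind mulr1 cis2pi. Qed.

Lemma wind_continuous : continuous wind.
Proof.
move=> t; apply: continuous_comp; last exact: cis_continuous.
by apply: cvgM; [exact: cvg_cst|exact: cvg_id].
Qed.

Lemma comp_wind_continuous p : continuous p -> continuous (p \o wind).
Proof. by move=> cp t; apply: continuous_comp; [exact: wind_continuous|exact: cp]. Qed.

Lemma circle_integrable p (a b : R) : continuous p ->
  mu.-integrable `[a, b] (EFin \o (p \o wind)).
Proof.
move=> cp; apply: continuous_compact_integrable; first exact: segment_compact.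
by apply: continuous_subspaceT; exact: comp_wind_continuous.
Qed.

Lemma circle_eintE p : continuous p ->
  circle_eint (fun z => (p z)%:E) = (circle_rint p)%:E.
Proof.
move=> cp; rewrite /circle_eint /circle_rint /Rintegral fineK//.
apply: integrable_fin_num => //.
exact: circle_integrable.
Qed.

Lemma circle_rintD p q : continuous p -> continuous q ->
  circle_rint (fun z => p z + q z) = circle_rint p + circle_rint q.
Proof. by move=> cp cq; apply: RintegralD => //; exact: circle_integrable. Qed.

Lemma circle_rintZ (a : R) p : continuous p ->
  circle_rint (fun z => a * p z) = a * circle_rint p.
Proof.
by move=> cp; rewrite /circle_rint RintegralZl//; exact: (circle_integrable _ _ cp).
Qed.

Lemma circle_rint_cst (a : R) : circle_rint (fun=> a) = a.
Proof.
rewrite /circle_rint /Rintegral.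
rewrite integral_cst//= [lebesgue_measure _]lebesgue_measure_itv/= lte01 /=.
by rewrite subr0 mulr1.
Qed.

Lemma le_circle_rint p q : continuous p -> continuous q ->
  (forall z, p z <= q z) -> circle_rint p <= circle_rint q.
Proof.
move=> cp cq pq; apply: le_Rintegral => //; by [exact: (circle_integrable _ _ cp)|exact: (circle_integrable _ _ cq)].
Qed.

Lemma normr_circle_rint p : continuous p ->
  `|circle_rint p| <= circle_rint (fun z => `|p z|).
Proof. by move=> cp; apply: le_normr_Rintegral => //; exact: (circle_integrable _ _ cp). Qed.

Lemma Rintegral_wind_translate p (a b c : R) : continuous p -> b <= c ->
  \int[mu]_(t in `[b, c]) p (wind (t + a)) =
  \int[mu]_(t in `[b + a, c + a]) p (wind t).
Proof.
move=> cp bc; rewrite /Rintegral; congr fine.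
have D1 : (fun x : R => x + a)^`()%classic = cst 1.
  apply/funext => x; rewrite derive1E deriveD//.
  by rewrite derive_id derive_cst addr0.
have := @integration_by_substitution_increasing R (fun x => x + a) (p \o wind) b c bc.
rewrite D1 => ->.
- by apply: eq_integral => t _ /=; rewrite mulr1.
- by move=> x y _ _; rewrite ltrD2r.
- by move=> x _; exact: cvg_cst.
- exact: is_cvg_cst.
- exact: is_cvg_cst.
- split.
  + by move=> x _; apply: derivableD.
  + apply: cvg_at_right_filter; apply: cvgD; [exact: cvg_id|exact: cvg_cst].
  + apply: cvg_at_left_filter; apply: cvgD; [exact: cvg_id|exact: cvg_cst].
- by apply: continuous_subspaceT; exact: comp_wind_continuous.
Qed.

(** Rotation by [wind a] moves the interval of integration to [[a, 1 + a]]; the piece beyond 1 is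
    brought back to [[0, a]] by periodicity. *)
Lemma circle_rint_rot p w : continuous p ->
  circle_rint (fun z => p (circle_mul w z)) = circle_rint p.
Proof.
move=> cp; have [a /andP[a0 a1] ->] := circle_cis w.
rewrite /circle_rint -/(wind a).
under eq_Rintegral do rewrite circle_mulC -windD.
rewrite (Rintegral_wind_translate _ cp ler01) add0r.
have i0 b c := circle_integrable b c cp.
have io b c : mu.-integrable `]b, c] (EFin \o (p \o wind)).
  apply: integrableS (i0 b c) => //.
  by apply: subset_itvr; rewrite bnd_simp.
have h1 := Rintegral_itvB (i0 a (1 + a)) (x := 1).
have h0 := Rintegral_itvB (i0 0 1) (x := a).
rewrite !bnd_simp in h0 h1.
have e0 := h0 a0 a1; have e1 := h1 a1 ltac:(by rewrite lerDl).
have := Rintegral_wind_translate 1 cp a0.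
rewrite add0r (addrC a); under eq_Rintegral do rewrite windD wind1 circle_mulC circle_mul1.
move=> e2; move: e0 e1; rewrite !Rintegral_itv_obnd_cbnd//.
move=> /= e0 e1; lra.
Qed.

Lemma circle_rint_inv p : continuous p ->
  circle_rint (fun z => p (circle_inv z)) = circle_rint p.
Proof.
move=> cp; rewrite /circle_rint.
rewrite (@Rintegration_by_substitution_onem R (p \o wind) 1) ?ler01 ?lexx//.
  rewrite /unstable.onem subrr; apply: eq_Rintegral => t _ /=.
  rewrite windD wind1 circle_mul1; congr p.
  by rewrite /wind mulrN cisN.
by apply: continuous_subspaceT; exact: comp_wind_continuous.
Qed.

End CircleIntegral.

Section CircleFubini.
Variable R : realType.
Local Notation circle := (circle R).
Local Notation mu := (@lebesgue_measure R).
Implicit Types (z w : circle) (p q : circle -> R).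

Lemma compact_normr_bounded (X : topologicalType) (A : set X) (f : X -> R) :
  compact A -> {within A, continuous f} ->
  exists2 M : R, 0 < M & forall x, A x -> `|f x| <= M.
Proof.
move=> cA cf; have [M [_ HM]] := compact_bounded (continuous_compact cf cA).
exists (`|M| + 1); first by rewrite ltr_pwDr.
move=> x Ax; apply: (HM (`|M| + 1)); last exact: imageP.
by rewrite (le_lt_trans (ler_norm _))// ltrDl.
Qed.

Lemma circle_bounded p : continuous p -> exists M : R, forall z, `|p z| <= M.
Proof.
move=> cp.
have [M _ HM] := compact_normr_bounded (@circle_compact R) (continuous_subspaceT cp).
by exists M => z; exact: HM.
Qed.

(** Fubini on the unit square, then rotation invariance of the inner integral. The complex version
    makes the isotypic projection [mean] multiplicative. *)
Lemma circle_rint_conv p q : continuous p -> continuous q ->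
  circle_rint (fun z => circle_rint (fun w => p w * q (circle_mul (circle_inv w) z))) =
  circle_rint p * circle_rint q.
Proof.
move=> cp cq.
pose f (x : R * R) : R := p (wind x.2) * q (wind (x.1 - x.2)).
pose I : set R := `[0%R, 1%R]%classic.
have mI : measurable I by exact: measurable_itv.
have muI : mu I = 1%E.
  by rewrite [LHS]lebesgue_measure_itv/= lte01 /= sube0.
have mf : measurable_fun [set: R * R] f.
  apply: measurable_realfun.measurable_funM.
    apply: (measurableT_comp (f := p \o @wind R)) => //; apply: measurable_realfun.continuous_measurable_fun.
    exact: comp_wind_continuous.
  apply: (measurableT_comp (f := q \o @wind R)).
    apply: measurable_realfun.continuous_measurable_fun; exact: comp_wind_continuous.
  by apply: measurable_realfun.measurable_funB.
have [Mp HMp] := circle_bounded cp; have [Mq HMq] := circle_bounded cq.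
have intf : (mu \x mu)%E.-integrable (I `*` I) (EFin \o f).
  apply: measurable_bounded_integrable => //.
  - exact: measurableX.
  - apply: (@eq_ind_r _ _ (fun y => (y < +oo)%E) _ _ (product_measure1E mu mu mI mI)).
    by suff : (mu I * mu I < +oo)%E by []; rewrite muI mule1 ltry.
  - exact: measurable_funTS.
  - exists (Mp * Mq); split; first by rewrite num_real.
    move=> M MM x _ /=; rewrite normrM (le_trans _ (ltW MM))//.
    by apply: ler_pM.
have := intf; rewrite integrable_mkcond; last exact: measurableX.
move=> /(@Fubini _ _ _ _ _ mu mu).
have int1 s : mu.-integrable I (EFin \o (fun t => f (s, t))).
  apply: measurable_bounded_integrable => //.
  - by suff : (mu I < +oo)%E by []; rewrite muI ltry.
  - by apply: measurable_funTS; exact: (measurable_fun_pair2 s mf).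
  - exists (Mp * Mq); split; first by rewrite num_real.
    move=> M MM x _ /=; rewrite normrM (le_trans _ (ltW MM))//.
    by apply: ler_pM.
have int2 t : mu.-integrable I (EFin \o (fun s => f (s, t))).
  apply: measurable_bounded_integrable => //.
  - by suff : (mu I < +oo)%E by []; rewrite muI ltry.
  - by apply: measurable_funTS; exact: (measurable_fun_pair1 t mf).
  - exists (Mp * Mq); split; first by rewrite num_real.
    move=> M MM x _ /=; rewrite normrM (le_trans _ (ltW MM))//.
    by apply: ler_pM.
have fin1 s : (\int[mu]_(t in I) (f (s, t))%:E)%E \is a fin_num.
  by apply: integrable_fin_num (int1 s); exact: measurable_itv.
have fin2 t : (\int[mu]_(s in I) (f (s, t))%:E)%E \is a fin_num.
  by apply: integrable_fin_num (int2 t); exact: measurable_itv.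
have L : (\int[mu]_s \int[mu]_t ((EFin \o f) \_ (I `*` I)) (s, t) =
    \int[mu]_(s in I) (\int[mu]_(t in I) f (s, t))%:E)%E.
  rewrite [RHS]integral_mkcond; apply: eq_integral => s _.
  rewrite [RHS]/patch; case: ifPn => sI.
    rewrite /Rintegral (fineK (fin1 s)) [RHS]integral_mkcond.
    by apply: eq_integral => t _; rewrite /patch in_setX sI.
  by rewrite integral0_eq// => t _; rewrite /patch in_setX (negbTE sI).
have K : (\int[mu]_t \int[mu]_s ((EFin \o f) \_ (I `*` I)) (s, t) =
    \int[mu]_(t in I) (\int[mu]_(s in I) f (s, t))%:E)%E.
  rewrite [RHS]integral_mkcond; apply: eq_integral => t _.
  rewrite [RHS]/patch; case: ifPn => tI.
    rewrite /Rintegral (fineK (fin2 t)) [RHS]integral_mkcond.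
    by apply: eq_integral => s _; rewrite /patch in_setX tI andbT.
  by rewrite integral0_eq// => s _; rewrite /patch in_setX (negbTE tI) andbF.
rewrite L K => LK.
have windB s t : wind (s - t) = circle_mul (circle_inv (wind t)) (wind s).
  by rewrite windD circle_mulC /wind mulrN cisN.
transitivity (\int[mu]_(s in I) \int[mu]_(t in I) f (s, t)).
  apply: eq_Rintegral => s _; apply: eq_Rintegral => t _.
  by rewrite /f /= windB.
rewrite {1}/Rintegral LK -/(Rintegral _ _ _).
transitivity (\int[mu]_(t in I) (circle_rint q * p (wind t))).
  apply: eq_Rintegral => t _; rewrite mulrC -[X in _ * X](circle_rint_rot (circle_inv (wind t)) cq).
  rewrite -circle_rintZ; last first.
    by move=> z; apply: continuous_comp; [exact: circle_mull_continuous|exact: cq].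
  by apply: eq_Rintegral => s _; rewrite /f /= windB.
rewrite mulrC RintegralZl//; exact: (circle_integrable _ _ cp).
Qed.

End CircleFubini.

Section CircleComplexIntegral.
Variable R : realType.
Local Notation circle := (circle R).
Implicit Types (z w : circle) (f g : circle -> R[i]).

Let cRe f : continuous f -> continuous (fun z => complex.Re (f z)).
Proof. by move=> cf z; apply: (continuous_comp (cf z)); exact: Re_continuous. Qed.

Let cIm f : continuous f -> continuous (fun z => complex.Im (f z)).
Proof. by move=> cf z; apply: (continuous_comp (cf z)); exact: Im_continuous. Qed.

Lemma rnorm_continuous (V : normedModType R[i]) : continuous (@rnorm R V).
Proof.
move=> v; apply: continuous_comp; last exact: Re_continuous.
exact: norm_continuous.
Qed.

Let crn f : continuous f -> continuous (fun z => rnorm (f z)).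
Proof. by move=> cf z; apply: (continuous_comp (cf z)); exact: rnorm_continuous. Qed.

Lemma circle_intE f : circle_int f =
  circle_rint (fun z => complex.Re (f z)) +i* circle_rint (fun z => complex.Im (f z)).
Proof. by []. Qed.

Lemma eq_circle_int f g : f =1 g -> circle_int f = circle_int g.
Proof. by move=> /funext ->. Qed.

Lemma circle_int_cst (a : R[i]) : circle_int (fun=> a) = a.
Proof. by rewrite circle_intE !circle_rint_cst; case: a. Qed.

Lemma circle_intD f g : continuous f -> continuous g ->
  circle_int (fun z => f z + g z) = circle_int f + circle_int g.
Proof.
move=> cf cg; rewrite !circle_intE.
under [in RHS]eq_fun do idtac.
have -> : (fun z => complex.Re (f z + g z)) = (fun z => complex.Re (f z) + complex.Re (g z)).
  by apply/funext => z; rewrite raddfD.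
have -> : (fun z => complex.Im (f z + g z)) = (fun z => complex.Im (f z) + complex.Im (g z)).
  by apply/funext => z; rewrite raddfD.
by rewrite !circle_rintD//; by [exact: cRe|exact: cIm].
Qed.

Lemma circle_intZ (a : R[i]) f : continuous f ->
  circle_int (fun z => a * f z) = a * circle_int f.
Proof.
move=> cf; rewrite !circle_intE; case: a => a b.
have cr x := @cRe f cf x; have ci x := @cIm f cf x.
have cZ (c : R) (p : circle -> R) : continuous p -> continuous (fun z => c * p z).
  by move=> cp; apply: contM => //; exact: cont_cst.
have -> : (fun z => complex.Re ((a +i* b) * f z)) = (fun z => a * complex.Re (f z) + - b * complex.Im (f z)).
  by apply/funext => z; case: (f z) => x y /=; rewrite mulNr.
have -> : (fun z => complex.Im ((a +i* b) * f z)) = (fun z => a * complex.Im (f z) + b * complex.Re (f z)).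
  by apply/funext => z; case: (f z) => x y /=.
rewrite !circle_rintD ?circle_rintZ//; try exact: cZ.
by apply/eqP; rewrite eq_complex/= mulNr !eqxx.
Qed.

Lemma circle_int_sum (I : Type) (r : seq I) (F : I -> circle -> R[i]) :
  (forall i, continuous (F i)) ->
  circle_int (fun z => \sum_(i <- r) F i z) = \sum_(i <- r) circle_int (F i).
Proof.
move=> cF; elim: r => [|i r IH].
  by rewrite big_nil -[RHS]circle_int_cst; apply: eq_circle_int => z; rewrite big_nil.
rewrite big_cons -IH -circle_intD//.
  by apply: eq_circle_int => z; rewrite big_cons.
exact: cont_sum.
Qed.

(** The factor 2 comes from bounding real and imaginary parts separately. It only enters the bound
    of a representation, where any constant will do. *)
Lemma rnorm_circle_int f : continuous f ->
  rnorm (circle_int f) <= 2 * circle_rint (fun z => rnorm (f z)).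
Proof.
move=> cf; rewrite circle_intE (le_trans (rnorm_ReIm _))//= mulr_natl mulr2n.
have cn (p : circle -> R) : continuous p -> continuous (fun z => `|p z|).
  by move=> cp z; apply: (continuous_comp (cp z)); exact: norm_continuous.
apply: lerD; (apply: le_trans (normr_circle_rint _) _; first by [exact: cRe|exact: cIm]);
  apply: le_circle_rint; rewrite ?normr_Re ?normr_Im //; try exact: crn; try (apply: cn; by [exact: cRe|exact: cIm]).
- by move=> z; exact: normr_Re.
- by move=> z; exact: normr_Im.
Qed.

Lemma circle_rint_le (p : circle -> R) (M : R) : continuous p ->
  (forall z, p z <= M) -> circle_rint p <= M.
Proof.
move=> cp pM; rewrite -[leRHS]circle_rint_cst; apply: le_circle_rint => //.
exact: cont_cst.
Qed.

Lemma circle_int_rot f w : continuous f ->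
  circle_int (fun z => f (circle_mul w z)) = circle_int f.
Proof.
move=> cf; rewrite !circle_intE.
by rewrite (circle_rint_rot w (cRe cf)) (circle_rint_rot w (cIm cf)).
Qed.

Lemma circle_int_inv f : continuous f ->
  circle_int (fun z => f (circle_inv z)) = circle_int f.
Proof.
move=> cf; rewrite !circle_intE.
by rewrite (circle_rint_inv (cRe cf)) (circle_rint_inv (cIm cf)).
Qed.

Lemma circle_int_conj f : continuous f ->
  circle_int (fun z => conjc (f z)) = conjc (circle_int f).
Proof.
move=> cf; rewrite !circle_intE /=.
have -> : (fun z => complex.Re (conjc (f z))) = (fun z => complex.Re (f z)).
  by apply/funext => z; case: (f z).
have -> : (fun z => complex.Im (conjc (f z))) = (fun z => -1 * complex.Im (f z)).
  by apply/funext => z; case: (f z) => x y /=; rewrite mulN1r.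
by rewrite circle_rintZ ?mulN1r//; exact: cIm.
Qed.

(** Compactness of the circle makes the neighbourhood of [x0] uniform in [z], as continuity of an
    integral with a parameter requires. *)
Lemma circle_tube (X : topologicalType) (K : numFieldType)
    (V : pseudoMetricNormedZmodType K) (F : X * circle -> V) (x0 : X) (e : K) :
  continuous F -> 0 < e ->
  \forall x \near x0, forall z, `|F (x0, z) - F (x, z)| < e.
Proof.
move=> cF e0.
have := (compact_near_coveringP [set: circle]).1 (@circle_compact R) X (nbhs x0)
  (fun x z => `|F (x0, z) - F (x, z)| < e) (nbhs_filter x0).
move=> H; have {H} : \forall x \near nbhs x0, [set: circle] `<=` (fun z => `|F (x0, z) - F (x, z)| < e).
  apply: H => z0 _.
  have e2 : 0 < e / 2 by rewrite divr_gt0.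
  have F0 := (@cvgrPdist_lt _ _ _ _ (nbhs_filter (x0, z0)) _ _).1 (cF (x0, z0)) _ e2.
  have F1 : \forall p \near (z0, x0), `|F (x0, z0) - F (p.2, p.1)| < e / 2.
    case: F0 => -[A B] [/= A0 B0] AB; exists (B, A) => // -[z x] [/= Bz Ax].
    exact: (AB (x, z)).
  have F2 : \forall p \near (z0, x0), `|F (x0, z0) - F (x0, p.1)| < e / 2.
    case: F0 => -[A B] [/= A0 B0] AB; exists (B, A) => // -[z x] [/= Bz Ax].
    by apply: (AB (x0, z)); split => //=; exact: nbhs_singleton.
  apply: filterS2 F1 F2 => -[z x] /= h1 h2.
  rewrite -(subrKA (F (x0, z0))) [e]splitr (le_lt_trans (ler_normD _ _))// ltrD//.
  by rewrite distrC.
by apply: filterS => x h z; exact: h.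
Qed.

Lemma circle_rint_continuous (X : topologicalType) (F : X * circle -> R) :
  continuous F -> continuous (fun x => circle_rint (fun z => F (x, z))).
Proof.
move=> cF x0; apply/(@cvgrPdist_lt _ _ _ _ (nbhs_filter x0)) => e e0.
have e2 : 0 < e / 2 by rewrite divr_gt0.
have cFx x : continuous (fun z => F (x, z)).
  exact: (cont_comp (@cont_pairr _ _ x) cF).
apply: filterS (circle_tube x0 cF e2) => x Fx.
have -> : circle_rint (fun z => F (x0, z)) - circle_rint (fun z => F (x, z)) =
    circle_rint (fun z => F (x0, z) - F (x, z)).
  rewrite -mulN1r -circle_rintZ// -circle_rintD//; last by apply: contM => //; exact: cont_cst.
  by congr circle_rint; apply/funext => z; rewrite mulN1r.
have cB : continuous (fun z => F (x0, z) - F (x, z)) by exact: contB.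
rewrite (le_lt_trans (normr_circle_rint cB))//.
apply: (@le_lt_trans _ _ (e / 2)); last by rewrite ltr_pdivrMr// ltr_pMr// ltrDr.
apply: circle_rint_le => [|z]; last exact/ltW.
exact: (cont_comp cB (@norm_continuous _ _)).
Qed.

Lemma circle_int_continuous (X : topologicalType) (F : X * circle -> R[i]) :
  continuous F -> continuous (fun x => circle_int (fun z => F (x, z))).
Proof.
move=> cF x; apply: cvg_complex.
- apply: (@circle_rint_continuous X (fun p => complex.Re (F p))).
  exact: (cont_comp cF (@Re_continuous R)).
- apply: (@circle_rint_continuous X (fun p => complex.Im (F p))).
  exact: (cont_comp cF (@Im_continuous R)).
Qed.

(** The complex product splits the convolution into four real ones, each covered by
    [circle_rint_conv]. *)
Lemma circle_int_conv f g : continuous f -> continuous g ->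
  circle_int (fun z => circle_int (fun w => f w * g (circle_mul (circle_inv w) z))) =
  circle_int f * circle_int g.
Proof.
move=> cf cg.
pose P (p q : circle -> R) z := circle_rint (fun w => p w * q (circle_mul (circle_inv w) z)).
have cfw (p q : circle -> R) z : continuous p -> continuous q ->
    continuous (fun w => p w * q (circle_mul (circle_inv w) z)).
  move=> cp cq; apply: contM => //.
  have -> : (fun w => q (circle_mul (circle_inv w) z)) = (fun w => q (circle_mul z (circle_inv w))).
    by apply/funext => w; rewrite circle_mulC.
  exact: (cont_comp (cont_comp (@circle_inv_continuous R) (@circle_mull_continuous R z)) cq).
pose fr z := complex.Re (f z); pose fi z := complex.Im (f z).
pose gr z := complex.Re (g z); pose gi z := complex.Im (g z).
have cfr : continuous fr := cRe cf; have cfi : continuous fi := cIm cf.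
have cgr : continuous gr := cRe cg; have cgi : continuous gi := cIm cg.
have -> : (fun z => circle_int (fun w => f w * g (circle_mul (circle_inv w) z))) =
    (fun z => (P fr gr z - P fi gi z) +i* (P fr gi z + P fi gr z)).
  apply/funext => z; rewrite circle_intE.
  have -> : (fun w => complex.Re (f w * g (circle_mul (circle_inv w) z))) =
      (fun w => fr w * gr (circle_mul (circle_inv w) z) + -1 * (fi w * gi (circle_mul (circle_inv w) z))).
    by apply/funext => w; rewrite /fr /fi /gr /gi; case: (f w) (g _) => a b [c d] /=; rewrite mulN1r.
  have -> : (fun w => complex.Im (f w * g (circle_mul (circle_inv w) z))) =
      (fun w => fr w * gi (circle_mul (circle_inv w) z) + fi w * gr (circle_mul (circle_inv w) z)).
    by apply/funext => w; rewrite /fr /fi /gr /gi; case: (f w) (g _) => a b [c d] /=; rewrite (mulrC b).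
  rewrite circle_rintD ?circle_rintZ ?circle_rintD ?mulN1r//; try exact: cfw.
  by apply: contM; [exact: cont_cst|exact: cfw].
have cP p q : continuous p -> continuous q -> continuous (P p q).
  move=> cp cq.
  apply: (@circle_rint_continuous circle (fun x => p x.2 * q (circle_mul (circle_inv x.2) x.1))).
  apply: contM; first exact: (cont_comp (@cont_snd _ _) cp).
  apply: cont_comp cq.
  apply: (@cont_comp _ _ _ (fun x : circle * circle => (circle_inv x.2, x.1)) (fun x => circle_mul x.1 x.2)).
    apply: cont_pair; last exact: cont_fst.
    exact: (cont_comp (@cont_snd _ _) (@circle_inv_continuous R)).
  exact: circle_mul_continuous.
rewrite circle_intE /=.
have -> : (fun z => P fr gr z - P fi gi z) = (fun z => P fr gr z + -1 * P fi gi z).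
  by apply/funext => z; rewrite mulN1r.
rewrite !circle_rintD ?circle_rintZ; try exact: cP; last first.
  by apply: contM; [exact: cont_cst|exact: cP].
rewrite /P !circle_rint_conv// mulN1r !circle_intE -/fr -/fi -/gr -/gi.
by apply/eqP; rewrite eq_complex/= eqxx/=.
Qed.

End CircleComplexIntegral.

(** * Completions and unitizations *)

Section ComplexComplete.
Variable R : realType.

(** Completeness makes [R[i]] a possible target of [dense_extension], for the character of the
    unitization, and a Hilbert space, for the representation at infinity. *)
Lemma complex_cauchy_cvg (F : set_system R[i]) : ProperFilter F -> cauchy F -> cvg F.
Proof.
move=> FF Fc.
have cauchyP (p : R[i] -> R) : (forall z w, `|p z - p w| <= rnorm (z - w)) ->
    cauchy (p x @[x --> F]).
  move=> pl; apply: cauchy_exP => e e0.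
  have ec : 0 < e%:C by rewrite ltcR.
  have [z Fz] := (cauchyP F).1 Fc _ ec.
  exists (p z); rewrite /= nbhs_simpl; apply: filterS Fz => w.
  rewrite -ball_normE /= => zw.
  apply: (@le_lt_trans _ _ (rnorm (z - w))); first exact: pl.
  by move: zw; rewrite rnormE ltcR.
have /cauchy_cvg reF : cauchy (complex.Re x @[x --> F]).
  by apply: cauchyP => z w; rewrite -raddfB normr_Re.
have /cauchy_cvg imF : cauchy (complex.Im x @[x --> F]).
  by apply: cauchyP => z w; rewrite -raddfB normr_Im.
apply/cvg_ex; exists (lim (complex.Re x @[x --> F]) +i* lim (complex.Im x @[x --> F])).
have := @cvg_complex R _ F _ (@complex.Re R) (@complex.Im R)
  (lim (complex.Re x @[x --> F]) +i* lim (complex.Im x @[x --> F])) reF imF.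
have -> : (fun x : R[i] => complex.Re x +i* complex.Im x) = id.
  by apply/funext => -[].
by move=> h; exact: (h FF).
Qed.

HB.instance Definition _ := Uniform_isComplete.Build R[i] complex_cauchy_cvg.

End ComplexComplete.

Section ApproxLimit.
Variables (R : realType) (W : completeNormedModType R[i]).

Lemma rnorm_le0 (V : normedModType R[i]) (v : V) : (forall e : R, 0 < e -> rnorm v <= e) -> v = 0.
Proof.
move=> v0; apply: rnorm0_eq0; apply/eqP; rewrite eq_le rnorm_ge0 andbT.
by apply/ler_addgt0Pr => e e0; rewrite add0r v0.
Qed.

(** [P e] stands for the values obtained from approximants of quality [e]. This one Cauchy argument
    serves the extension by density, the closedness of the range of [k] in the unitization, and the
    limits of representations. *)
Lemma approx_limit (P : R -> set W) (C : R) :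
  (forall e : R, 0 < e -> P e !=set0) ->
  (forall (e d : R) x y, 0 < e -> 0 < d -> P e x -> P d y -> rnorm (x - y) <= C * (e + d)) ->
  exists w, forall (e : R) x, 0 < e -> P e x -> rnorm (w - x) <= C * e.
Proof.
move=> P0 PC.
have e0 n : 0 < n.+1%:R^-1 :> R by rewrite invr_gt0.
have [u Pu] : exists u : nat -> W, forall n, P n.+1%:R^-1 (u n).
  have /choice[u Pu] : forall n, exists x, P n.+1%:R^-1 x by move=> n; exact: P0.
  by exists u.
have C0 : 0 <= C.
  have := PC _ _ _ _ (e0 0%N) (e0 0%N) (Pu 0%N) (Pu 0%N).
  by rewrite subrr rnorm0 pmulr_lge0// addr_gt0.
have small (e : R) : 0 < e -> \forall n \near \oo, C * n.+1%:R^-1 < e.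
  move=> ep; have : (C * n.+1%:R^-1) @[n --> \oo] --> C * 0 by apply: cvgM; [exact: cvg_cst|exact: cvg_harmonic].
  rewrite mulr0 => /cvgrPdist_lt/(_ e ep); apply: filterS => n.
  by rewrite sub0r normrN ger0_norm// mulr_ge0.
have uc : cvg (u n @[n --> \oo]).
  apply: cauchy_cvg; apply: cauchy_exP => e; rewrite ltcE/= => /andP[/eqP ei ep].
  have ep2 : 0 < complex.Re e / 2 by rewrite divr_gt0.
  have [N _ HN] := small _ ep2.
  exists (u N); exists N => // n /= Nn; rewrite -ball_normE /= rnormE ltcE /= ei eqxx/=.
  rewrite (le_lt_trans (PC _ _ _ _ (e0 _) (e0 _) (Pu _) (Pu _)))// mulrDr [ltRHS]splitr.
  by rewrite ltrD//; apply: HN => /=.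
move/cvg_ex: uc => [l ul]; exists l => e x ep Px.
apply/ler_addgt0Pr => d d0.
have d2 : 0 < d / 2 by rewrite divr_gt0.
have [N1 _ H1] := (cvg_rnorm _ _ _).1 ul _ d2.
have [N2 _ H2] := small _ d2.
pose n := maxn N1 N2.
rewrite (le_trans (rnormBD (u n) _ _))//.
have h1 : rnorm (l - u n) < d / 2 by apply: H1; rewrite /= leq_maxl.
have h2 : C * n.+1%:R^-1 < d / 2 by apply: H2; rewrite /= leq_maxr.
have h3 := PC _ _ _ _ (e0 n) ep (Pu n) Px.
rewrite (le_trans (lerD (ltW h1) h3))// mulrDr addrA addrC lerD2l [leRHS]splitr.
by rewrite lerD2l ltW.
Qed.

End ApproxLimit.

Section DenseExtension.
Variables (R : realType) (X : Type).
Local Notation fct := (X -> R[i]).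

Definition linear_on (S : set fct) (V : lmodType R[i]) (j : fct -> V) :=
  forall (a : R[i]) f g, S f -> S g -> j (fun x => a * f x + g x) = a *: j f + j g.

Definition subspace_on (S : set fct) :=
  S (fun=> 0) /\ forall (a : R[i]) f g, S f -> S g -> S (fun x => a * f x + g x).

Lemma linear_onB (S : set fct) (V : lmodType R[i]) (j : fct -> V) f g :
  linear_on S j -> S f -> S g -> j (fun x => f x - g x) = j f - j g.
Proof.
move=> jl Sf Sg; have -> : (fun x => f x - g x) = (fun x => -1 * g x + f x).
  by apply/funext => x; rewrite mulN1r addrC.
by rewrite jl// scaleN1r addrC.
Qed.

Lemma subspace_onB (S : set fct) f g : subspace_on S -> S f -> S g -> S (fun x => f x - g x).
Proof.
move=> [_ Sl] Sf Sg; have -> : (fun x => f x - g x) = (fun x => -1 * g x + f x).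
  by apply/funext => x; rewrite mulN1r addrC.
exact: Sl.
Qed.

Lemma dense_approx (V : normedModType R[i]) (D : set V) (v : V) (e : R) :
  closure D = setT -> 0 < e -> exists2 w, D w & rnorm (v - w) < e.
Proof.
move=> cD e0; have : closure D v by rewrite cD.
move=> /(_ (ball v e%:C)) []; first by apply: nbhsx_ballx; rewrite ltcR.
move=> w [Dw]; rewrite -ball_normE /= rnormE ltcR => vw.
by exists w.
Qed.

Lemma dense_eq (V W : normedModType R[i]) (D : set V) (f g : V -> W) (M : R) :
  closure D = setT -> (forall x y, rnorm (f x - f y) <= M * rnorm (x - y)) ->
  (forall x y, rnorm (g x - g y) <= M * rnorm (x - y)) ->
  (forall x, D x -> f x = g x) -> f =1 g.
Proof.
move=> cD fM gM fg x; apply/eqP; rewrite -subr_eq0; apply/eqP.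
apply: rnorm_le0 => e e0; pose N := `|M| + 1.
have N0 : 0 < N by rewrite ltr_pwDr.
have e1 : 0 < e / 2 / N by rewrite !divr_gt0.
have [y Dy xy] := dense_approx x cD e1.
rewrite (le_trans (rnormBD (f y) _ _))//.
have MN (h : V -> W) : (forall x y, rnorm (h x - h y) <= M * rnorm (x - y)) ->
    rnorm (h x - h y) <= e / 2.
  move=> hM; rewrite (le_trans (hM _ _))//.
  rewrite (@le_trans _ _ (N * rnorm (x - y)))// ?ler_wpM2r ?rnorm_ge0//.
    by rewrite (le_trans (ler_norm _))// lerDl.
  by rewrite -ler_pdivlMl// mulrC ltW.
by rewrite [e]splitr lerD// ?MN// fg// rnormB MN.
Qed.

(** A point [v] goes to the limit of [t f] as [j f] approaches [v]. The estimate makes [t f] depend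
    on [j f] only, so [j] may have a kernel, as happens when a completion is taken for a
    seminorm. *)
Lemma dense_extension (S : set fct) (V : normedModType R[i]) (W : completeNormedModType R[i])
    (j : fct -> V) (t : fct -> W) (C : R) :
  0 <= C -> subspace_on S -> linear_on S j -> linear_on S t -> closure (j @` S) = setT ->
  (forall f, S f -> rnorm (t f) <= C * rnorm (j f)) ->
  exists2 T : {linear V -> W}, forall f, S f -> T (j f) = t f &
    forall v, rnorm (T v) <= C * rnorm v.
Proof.
move=> C0 Ss jl tl cS tC.
have tCB f g : S f -> S g -> rnorm (t f - t g) <= C * rnorm (j f - j g).
  by move=> Sf Sg; rewrite -!(linear_onB _ Sf Sg)// tC//; exact: subspace_onB.
have lim1 v : exists w, forall (e : R) f, 0 < e -> S f -> rnorm (v - j f) < e ->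
    rnorm (w - t f) <= C * e.
  have [||w Hw] := @approx_limit R W (fun e => [set t f | f in [set f | S f /\ rnorm (v - j f) < e]]) C.
  - by move=> e e0; have [_ [f Sf <-] vf] := dense_approx v cS e0; exists (t f); exists f.
  - move=> e d _ _ e0 d0 [f [Sf vf] <-] [g [Sg vg] <-].
    rewrite (le_trans (tCB _ _ Sf Sg))// ler_wpM2l// (le_trans (rnormBD v _ _))//.
    by rewrite rnormB lerD// ltW.
  - by exists w => e f e0 Sf vf; apply: Hw => //; exists f.
have [T HT] := choice lim1.
have Tj f : S f -> T (j f) = t f.
  move=> Sf; apply/eqP; rewrite -subr_eq0; apply/eqP; apply: rnorm_le0 => e e0.
  have e1 : 0 < e / (C + 1) by rewrite divr_gt0// ltr_wpDl.
  have := HT (j f) _ _ e1 Sf; rewrite subrr rnorm0 => /(_ e1) h.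
  rewrite (le_trans h)// mulrA ler_pdivrMr ?ltr_wpDl// mulrC ler_wpM2l ?ltW//.
  by rewrite ltrDl.
have Tl : linear T.
  move=> a x y; apply/eqP; rewrite -subr_eq0; apply/eqP; apply: rnorm_le0 => e e0.
  pose A := complex.Re `|a| ; have A0 : 0 <= A by exact: (@rnorm_ge0 _ R[i]).
  pose N := (C + 1) * (A + 1) * 4.
  have N0 : 0 < N by rewrite !mulr_gt0// ltr_wpDl.
  have d0 : 0 < e / N by rewrite divr_gt0.
  have [_ [f Sf <-] xf] := dense_approx x cS d0.
  have [_ [g Sg <-] yg] := dense_approx y cS d0.
  have h1 := HT x _ _ d0 Sf xf; have h2 := HT y _ _ d0 Sg yg.
  have Sh := Ss.2 a _ _ Sf Sg.
  have d1 : 0 < (A + 1) * (e / N) by rewrite mulr_gt0// ltr_wpDl.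
  have := HT (a *: x + y) _ _ d1 Sh; rewrite jl// tl//.
  have -> : a *: x + y - (a *: j f + j g) = a *: (x - j f) + (y - j g).
    by rewrite scalerBr addrACA opprD.
  have -> : (rnorm (a *: (x - j f) + (y - j g)) < (A + 1) * (e / N)) = true.
    rewrite (le_lt_trans (rnormD _ _))// rnormZ -/A mulrDl mul1r ler_ltD//.
    by rewrite ler_wpM2l// ltW.
  move=> /(_ isT) h3.
  rewrite (le_trans (rnormBD (a *: t f + t g) _ _))//.
  have h4 : rnorm (a *: t f + t g - (a *: T x + T y)) <= (A + 1) * (C * (e / N)).
    have -> : a *: t f + t g - (a *: T x + T y) = a *: (t f - T x) + (t g - T y).
      by rewrite scalerBr addrACA opprD.
    rewrite (le_trans (rnormD _ _))// rnormZ -/A mulrDl mul1r lerD//.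
      by rewrite ler_wpM2l// rnormB.
    by rewrite rnormB.
  have E : C * ((A + 1) * (e / N)) + (A + 1) * (C * (e / N)) = (2 * C * (A + 1)) * (e / N) by ring.
  rewrite (le_trans (lerD h3 h4))// E mulrA ler_pdivrMr// mulrC ler_wpM2l ?ltW//.
  rewrite /N; have CA : 0 <= C * A by rewrite mulr_ge0.
  nra.
exists (HB.pack T (GRing.isLinear.Build _ _ _ _ T Tl) : {linear V -> W}) => // v.
rewrite /=.
apply/ler_addgt0Pr => e e0.
have e1 : 0 < e / (2 * (C + 1)) by rewrite divr_gt0// mulr_gt0// ltr_wpDl.
have [_ [f Sf <-] vf] := dense_approx v cS e1.
have h1 := HT v _ _ e1 Sf vf; have h2 := tC f Sf.
have h3 : rnorm (j f) <= rnorm v + e / (2 * (C + 1)).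
  by rewrite -[X in rnorm X](subrK v) (le_trans (rnormD _ _))// addrC lerD2l rnormB ltW.
have h4 : rnorm (T v) <= rnorm (T v - t f) + rnorm (t f).
  by rewrite (le_trans _ (rnormD _ _))// subrK.
have h5 : C * rnorm (j f) <= C * (rnorm v + e / (2 * (C + 1))) by rewrite ler_wpM2l.
have h6 : 2 * C * (e / (2 * (C + 1))) <= e.
  rewrite mulrA ler_pdivrMr ?mulr_gt0// ?ltr_wpDl//; nra.
nra.
Qed.

End DenseExtension.

Section CstarBasics.
Variables (R : realType) (A : cstar_algebra R).
Implicit Types x y : A.

Lemma cs_mulDl x x' y : cs_mul (x + x') y = cs_mul x y + cs_mul x' y.
Proof. by have := cs_mul_linl y 1 x x'; rewrite !scale1r. Qed.

Lemma cs_mulDr x y y' : cs_mul x (y + y') = cs_mul x y + cs_mul x y'.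
Proof. by have := cs_mul_linr x 1 y y'; rewrite !scale1r. Qed.

Lemma cs_mul0 x : cs_mul x 0 = 0.
Proof. by apply: (addrI (cs_mul x 0)); rewrite -cs_mulDr !addr0. Qed.

Lemma cs_0mul x : cs_mul 0 x = 0.
Proof. by apply: (addrI (cs_mul 0 x)); rewrite -cs_mulDl !addr0. Qed.

Lemma cs_mulZl a x y : cs_mul (a *: x) y = a *: cs_mul x y.
Proof. by have := cs_mul_linl y a x 0; rewrite !addr0 cs_0mul addr0. Qed.

Lemma cs_mulZr a x y : cs_mul x (a *: y) = a *: cs_mul x y.
Proof. by have := cs_mul_linr x a y 0; rewrite !addr0 cs_mul0 addr0. Qed.

Lemma cs_mulBl x x' y : cs_mul (x - x') y = cs_mul x y - cs_mul x' y.
Proof. by rewrite -scaleN1r cs_mulDl cs_mulZl scaleN1r. Qed.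

Lemma cs_mulBr x y y' : cs_mul x (y - y') = cs_mul x y - cs_mul x y'.
Proof. by rewrite -scaleN1r cs_mulDr cs_mulZr scaleN1r. Qed.

Lemma rnorm_cs_mul x y : rnorm (cs_mul x y) <= rnorm x * rnorm y.
Proof. by rewrite -lecR rmorphM /= -!rnormE cs_normM. Qed.

Lemma cs_star0 : cs_star (0 : A) = 0.
Proof.
have := cs_star_antilin (1 : R[i]) (0 : A) 0; rewrite scaler0 addr0 conjc1 scale1r.
by move=> h; apply: (addrI (cs_star 0)); rewrite -h addr0.
Qed.

Lemma cs_starD x y : cs_star (x + y) = cs_star x + cs_star y.
Proof. by have := cs_star_antilin 1 x y; rewrite conjc1 !scale1r. Qed.

Lemma cs_starZ a x : cs_star (a *: x) = conjc a *: cs_star x.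
Proof. by have := cs_star_antilin a x 0; rewrite !addr0 cs_star0 addr0. Qed.

Lemma cs_starB x y : cs_star (x - y) = cs_star x - cs_star y.
Proof. by rewrite -scaleN1r cs_starD cs_starZ rmorphN1 scaleN1r. Qed.

Lemma rnorm_cs_star x : rnorm (cs_star x) = rnorm x.
Proof.
have le y : rnorm y <= rnorm (cs_star y).
  have : rnorm y ^+ 2 <= rnorm (cs_star y) * rnorm y.
    by rewrite -lecR rmorphXn /= -rnormE -cs_norm_star rnormE lecR rnorm_cs_mul.
  have [y0|y0] := eqVneq (rnorm y) 0; first by rewrite y0 rnorm_ge0.
  by rewrite expr2 ler_pM2r// lt_neqAle eq_sym y0 rnorm_ge0.
by apply/eqP; rewrite eq_le le -{2}(cs_starK x) le.
Qed.

End CstarBasics.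

Section Unitization.
Variables (R : realType) (X Y : Type).
Variables (S : set (X -> R[i])) (mulS : (X -> R[i]) -> (X -> R[i]) -> X -> R[i])
  (starS : (X -> R[i]) -> X -> R[i]) (nu : (X -> R[i]) -> \bar R).
Variables (S' : set (Y -> R[i])) (mulS' : (Y -> R[i]) -> (Y -> R[i]) -> Y -> R[i])
  (starS' : (Y -> R[i]) -> Y -> R[i]) (nu' : (Y -> R[i]) -> \bar R).
Variables (A A' : cstar_algebra R) (j : (X -> R[i]) -> A) (j' : (Y -> R[i]) -> A').
Variables (ext : (X -> R[i]) -> Y -> R[i]) (u : Y -> R[i]) (ev : (Y -> R[i]) -> R[i]).

(** The common core of the full and the reduced case. Isometry of [ext] yields the embedding [k],
    contractivity of [ev] yields the functional [chi], and the approximation hypothesis puts the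
    kernel of [chi] into the range of [k]. *)
Lemma minimal_unitization_completion :
  is_completion S mulS starS nu j -> is_completion S' mulS' starS' nu' j' ->
  subspace_on S -> (forall f g, S f -> S g -> S (mulS f g)) ->
  (forall f, S f -> S (starS f)) ->
  subspace_on S' -> S' u ->
  (forall f, S f -> S' (ext f)) ->
  (forall a f g, ext (fun x => a * f x + g x) = (fun y => a * ext f y + ext g y)) ->
  (forall f g, S f -> S g -> ext (mulS f g) = mulS' (ext f) (ext g)) ->
  (forall f, S f -> ext (starS f) = starS' (ext f)) ->
  (forall f, S f -> nu' (ext f) = nu f) ->
  (forall F, S' F -> mulS' u F = F /\ mulS' F u = F) ->
  (forall a F G, ev (fun y => a * F y + G y) = a * ev F + ev G) ->
  ev u = 1 -> (forall f, S f -> ev (ext f) = 0) ->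
  (forall F, S' F -> ((rnorm (ev F))%:E <= nu' F)%E) ->
  (forall F (e : R), S' F -> ev F = 0 -> 0 < e ->
    exists2 f, S f & (nu' (fun y => F y - ext f y)%R <= e%:E)%E) ->
  minimal_unitization A A'.
Proof.
move=> [jl jM jS jn jd] [jl' jM' jS' jn' jd'] Ss SM SS Ss' Su Se el eM eS en uid evl evu eve evn evd.
have elin f g : S f -> S g -> forall a, j' (ext (fun x => a * f x + g x)) = a *: j' (ext f) + j' (ext g).
  by move=> Sf Sg a; rewrite el jl'//; exact: Se.
have jeq f : S f -> rnorm (j' (ext f)) = rnorm (j f).
  by move=> Sf; apply/eqP; rewrite -eqe jn' ?en ?jn//; exact: Se.
have [||k kj kn] := @dense_extension R X S A A' j (j' \o ext) 1 ler01 Ss jl _ jd.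
- by move=> a f g Sf Sg /=; rewrite elin.
- by move=> f Sf; rewrite mul1r /= jeq.
have kiso a : rnorm (k a) = rnorm a.
  apply/eqP; rewrite eq_le; apply/andP; split; first by rewrite -[leRHS]mul1r.
  apply/ler_addgt0Pr => e e0; have e2 : 0 < e / 2 by rewrite divr_gt0.
  have [_ [f Sf <-] af] := dense_approx a jd e2.
  have h1 := kn (j f - a); rewrite linearB /= kj// mul1r in h1.
  have h2 : rnorm (j' (ext f)) <= rnorm (j' (ext f) - k a) + rnorm (k a).
    by rewrite (le_trans _ (rnormD _ _))// subrK.
  have h3 : rnorm a <= rnorm (a - j f) + rnorm (j f).
    by rewrite (le_trans _ (rnormD _ _))// subrK.
  rewrite /= in h1; rewrite -jeq// in h3; rewrite (rnormB (j f)) in h1; lra.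
have klip x y : rnorm (k x - k y) <= 1 * rnorm (x - y) by rewrite -linearB kiso mul1r.
have kM x y : k (cs_mul x y) = cs_mul (k x) (k y).
  (* Multiplicativity is extended from the dense image one variable at a time, since each side is
     Lipschitz only in a single variable. *)
  have kM1 f : S f -> forall y, k (cs_mul (j f) y) = cs_mul (k (j f)) (k y).
    move=> Sf; apply: (@dense_eq _ _ _ _ _ _ (rnorm (j f)) jd).
    - by move=> v w; rewrite -linearB kiso -cs_mulBr rnorm_cs_mul.
    - by move=> v w; rewrite -cs_mulBr -linearB (le_trans (rnorm_cs_mul _ _))// !kiso.
    - by move=> _ [g Sg <-]; rewrite -jM// !kj//=; [rewrite eM// jM'//; exact: Se|exact: SM].
  apply: (@dense_eq _ _ _ _ (fun x => k (cs_mul x y)) (fun x => cs_mul (k x) (k y)) (rnorm y) jd).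
  - by move=> v w; rewrite -linearB kiso -cs_mulBl (le_trans (rnorm_cs_mul _ _))// mulrC.
  - by move=> v w; rewrite -cs_mulBl -linearB (le_trans (rnorm_cs_mul _ _))// !kiso mulrC.
  - by move=> _ [f Sf <-]; exact: kM1.
have kS x : k (cs_star x) = cs_star (k x).
  apply: (@dense_eq _ _ _ _ (fun x => k (cs_star x)) (fun x => cs_star (k x)) 1 jd).
  - by move=> v w; rewrite -linearB kiso -cs_starB rnorm_cs_star mul1r.
  - by move=> v w; rewrite -cs_starB rnorm_cs_star -linearB kiso mul1r.
  - by move=> _ [f Sf <-]; rewrite -jS// !kj//=; [rewrite eS// jS'//; exact: Se|exact: SS].
pose one := j' u.
have onel x : cs_mul one x = x.
  apply: (@dense_eq _ _ _ _ (cs_mul one) id (rnorm one + 1) jd').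
  - move=> v w; rewrite -cs_mulBr (le_trans (rnorm_cs_mul _ _))// ler_wpM2r ?rnorm_ge0//.
    by rewrite lerDl.
  - by move=> v w; rewrite ler_peMl ?rnorm_ge0// lerDr rnorm_ge0.
  - by move=> _ [F SF <-]; rewrite -jM'// (uid F SF).1.
have oner x : cs_mul x one = x.
  apply: (@dense_eq _ _ _ _ (fun x => cs_mul x one) (fun x => x) (rnorm one + 1) jd').
  - move=> v w; rewrite -cs_mulBl (le_trans (rnorm_cs_mul _ _))// mulrC ler_wpM2r ?rnorm_ge0//.
    by rewrite lerDl.
  - by move=> v w; rewrite ler_peMl ?rnorm_ge0// lerDr rnorm_ge0.
  - by move=> _ [F SF <-]; rewrite -jM'// (uid F SF).2.
have [||chi chij chin] := @dense_extension R Y S' A' R[i] j' ev 1 ler01 Ss' jl' _ jd'.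
- by move=> a F G _ _; rewrite evl.
- by move=> F SF; rewrite mul1r -lee_fin jn'// evn.
have chi1 : chi one = 1 by rewrite chij.
have chik a : chi (k a) = 0.
  apply: (@dense_eq _ _ _ _ (chi \o k) (fun=> 0) 1 jd).
  - by move=> v w /=; rewrite -!linearB -(kiso (v - w)); exact: chin.
  - by move=> v w; rewrite subrr rnorm0 mul1r rnorm_ge0.
  - by move=> _ [f Sf <-] /=; rewrite kj// chij ?eve//; exact: Se.
have ker x : chi x = 0 -> range k x.
  move=> cx.
  have ap (e : R) : 0 < e -> exists a, rnorm (x - k a) <= e.
    move=> e0; pose N := 2 * (2 + rnorm one).
    have N0 : 0 < N by rewrite mulr_gt0// ltr_wpDr// rnorm_ge0.
    have d0 : 0 < e / N by rewrite divr_gt0.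
    have [_ [F SF <-] xF] := dense_approx x jd' d0.
    have evF : rnorm (ev F) <= e / N.
      have := chin (j' F - x); rewrite linearB /= chij// cx subr0 mul1r => h.
      by rewrite (le_trans h)// rnormB ltW.
    (* Subtracting [ev F] times the unit makes the approximation hypothesis applicable. The
       correction is small because [chi x = 0] forces [ev F] to be at most the distance from [x] to
       [j' F]. *)
    pose F0 y := - ev F * u y + F y.
    have SF0 : S' F0 by exact: Ss'.2.
    have evF0 : ev F0 = 0 by rewrite evl evu mulr1 addNr.
    have e2 : 0 < e / 2 by rewrite divr_gt0.
    have [f Sf nf] := evd _ _ SF0 evF0 e2.
    exists (j f); rewrite kj//=.
    have h1 : rnorm (j' F0 - j' (ext f)) <= e / 2.
      rewrite -lee_fin -(linear_onB jl' SF0 (Se _ Sf)) jn'//.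
      exact: (subspace_onB Ss' SF0 (Se _ Sf)).
    have h2 : rnorm (j' F - j' F0) <= e / N * rnorm one.
      rewrite jl'// opprD addrC -addrA addNr addr0 scaleNr opprK rnormZ.
      by rewrite ler_wpM2r ?rnorm_ge0.
    have h3 : rnorm (x - j' (ext f)) <= rnorm (x - j' F) + (rnorm (j' F - j' F0) + rnorm (j' F0 - j' (ext f))).
      by rewrite (le_trans (rnormBD (j' F) _ _))// lerD2l rnormBD.
    have h4 : e / N * (2 + rnorm one) = e / 2.
      rewrite /N; field; rewrite ?gt_eqF ?ltr_wpDr ?rnorm_ge0//.
    nra.
  (* The range of [k] is closed: [k] is isometric, so preimages of good approximants of [x] are
     close to each other in the complete algebra [A]. *)
  have [||a Ha] := @approx_limit R A (fun e => [set a | rnorm (x - k a) <= e]) 1.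
  - by move=> e e0; have [a Ha] := ap e e0; exists a.
  - move=> e d a b e0 d0 /= xa xb; rewrite mul1r -kiso linearB /=.
    by rewrite (le_trans (rnormBD x _ _))// rnormB lerD.
  exists a => //; apply/eqP; rewrite eq_sym -subr_eq0; apply/eqP; apply: rnorm_le0 => e e0.
  have e2 : 0 < e / 2 by rewrite divr_gt0.
  have [b Hb] := ap _ e2.
  have := Ha _ b e2 Hb; rewrite mul1r -kiso linearB /= => ab.
  by rewrite (le_trans (rnormBD (k b) _ _))// [e]splitr lerD// rnormB.
(* Since [chi] kills the range of [k], which is stable under product and star, this decomposition
   makes [chi] multiplicative and compatible with the star. *)
have dec x : exists a, x = k a + chi x *: one.
  have [|a _ ka] := ker (x - chi x *: one).
    by rewrite linearB linearZ /= chi1 [_ *: _]mulr1 subrr.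
  by exists a; rewrite ka subrK.
have chiM x y : chi (cs_mul x y) = chi x * chi y.
  have [a xa] := dec x; have [b yb] := dec y.
  rewrite [in LHS]xa [in LHS]yb cs_mulDl !cs_mulDr !cs_mulZl !cs_mulZr !onel oner -kM.
  have chiD v w : chi (v + w) = chi v + chi w by exact: linearD.
  have chiZ c v : chi (c *: v) = c * chi v by exact: linearZ.
  by rewrite !(chiD, chiZ) !chik chi1 !mulr0 !add0r mulr1.
have ones : cs_star one = one.
  have := cs_starM (cs_star one) one.
  by rewrite !oner cs_starK oner => /esym.
have chiS x : chi (cs_star x) = conjc (chi x).
  have [a xa] := dec x.
  by rewrite [in LHS]xa cs_starD cs_starZ -kS ones linearD linearZ /= chik chi1 add0r [_ *: _]mulr1.
exists k, one, chi; split => //.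
- split=> // a b kab; apply/eqP; rewrite -subr_eq0; apply/eqP; apply: rnorm0_eq0.
  by rewrite -kiso linearB /= kab subrr rnorm0.
- by move=> a x; split; apply: ker; rewrite chiM chik ?mul0r ?mulr0.
- apply/seteqP; split => [x /ker//|_ [a _ <-]]; exact: chik.
Qed.

End Unitization.

Section HilbertBasics.
Variables (R : realType) (H : hilbert R).
Local Notation "''[' u , v ]" := (hil_dot H u v).
Implicit Types u v w : H.

Lemma hil_dotDl u v w : '[u + v, w] = '[u, w] + '[v, w].
Proof. exact: linearDl. Qed.

Lemma hil_dotZl a u w : '[a *: u, w] = a * '[u, w].
Proof. exact: linearZl_LR. Qed.

Lemma hil_dotBl u v w : '[u - v, w] = '[u, w] - '[v, w].
Proof. exact: linearBl. Qed.

Lemma hil_dotDr u v w : '[w, u + v] = '[w, u] + '[w, v].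
Proof. exact: linearDr. Qed.

Lemma hil_dotBr u v w : '[w, u - v] = '[w, u] - '[w, v].
Proof. exact: linearBr. Qed.

Lemma hil_dotZr a u w : '[w, a *: u] = conjc a * '[w, u].
Proof. exact: linearZr_LR. Qed.

Lemma hil_dotC u v : '[u, v] = conjc '[v, u].
Proof. by rewrite (hermC (hil_dot H)) expr0 mul1r. Qed.

Lemma hil_rnorm v : (rnorm v ^+ 2)%:C = '[v, v].
Proof. by rewrite rmorphXn /= -rnormE hil_norm. Qed.

(** Pythagoras: the squared norms of [P v] and [v - P v] add up to that of [v]. *)
Lemma hil_projection_le (P : H -> H) v : (forall x y, '[P x, y] = '[x, P y]) ->
  (forall x, P (P x) = P x) -> rnorm (P v) <= rnorm v.
Proof.
move=> Ps Pi; rewrite -(@ler_pXn2r _ 2)// ?nnegrE ?rnorm_ge0// -lecR hil_rnorm.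
have e1 : '[v, P v] = '[P v, P v] by rewrite (Ps v (P v)) Pi.
have : '[v - P v, v - P v] = '[v, v] - '[P v, P v].
  by rewrite hil_dotBl !hil_dotBr (Ps v v) e1 subrr subr0.
rewrite -!hil_rnorm => h; rewrite -subr_ge0 -h ler0c.
by rewrite exprn_ge0// rnorm_ge0.
Qed.

End HilbertBasics.

Section OpNorm.
Variable R : realType.

Lemma op_norm_le (V : normedModType R[i]) (T : V -> V) (M : R) : 0 <= M ->
  (forall v, rnorm (T v) <= M * rnorm v) -> (op_norm T <= M%:E)%E.
Proof.
move=> M0 TM; apply: ge_ereal_sup => _ [v /= v1 <-]; rewrite lee_fin.
by rewrite (le_trans (TM v))// ler_piMr.
Qed.

Lemma op_norm_bound (V : normedModType R[i]) (T : V -> V) (M : R) v :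
  linear T -> (op_norm T <= M%:E)%E -> rnorm (T v) <= M * rnorm v.
Proof.
move=> Tl TM.
have TZ a x : T (a *: x) = a *: T x.
  have T0 : T 0 = 0.
    by have := Tl (-1) 0 0; rewrite scaler0 addr0 scaleN1r addNr.
  by have := Tl a x 0; rewrite !addr0 T0 addr0.
have [v0|v0] := eqVneq (rnorm v) 0.
  have /rnorm0_eq0 -> := v0; have := TZ 0 0; rewrite !scale0r => ->.
  by rewrite !rnorm0 mulr0.
have vp : 0 < rnorm v by rewrite lt_neqAle eq_sym v0 rnorm_ge0.
pose w := (rnorm v)^-1%:C *: v.
have rv : complex.Re `|(rnorm v)^-1%:C| = (rnorm v)^-1.
  by rewrite -/(rnorm _) rnormR ger0_norm// invr_ge0 ltW.
have w1 : rnorm w <= 1 by rewrite /w rnormZ rv mulVf.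
have : ((rnorm (T w))%:E <= M%:E)%E.
  by apply: le_trans TM; apply: ereal_sup_ubound; exists w.
by rewrite lee_fin /w TZ rnormZ rv ler_pdivrMl// mulrC.
Qed.

End OpNorm.

Section ScalarHilbert.
Variable R : realType.

Definition cdot (x y : R[i]) : R[i] := x * conjc y.

Let cdot_bilinear : bilinear_for (GRing.Scale.Law.clone _ _ *%R _)
  (GRing.Scale.Law.clone _ _ (conjc \; *%R) _) cdot.
Proof.
split => [u a x y|u a x y]; rewrite /cdot /=.
  by rewrite mulrDl mulrA.
by rewrite rmorphD rmorphM mulrDr mulrCA.
Qed.

HB.instance Definition _ := bilinear_isBilinear.Build R[i] R[i] R[i] R[i] _ _ cdot cdot_bilinear.

Let cdot_herm x y : cdot x y = (-1) ^+ false * conjc (cdot y x).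
Proof.
rewrite expr0 mul1r /cdot; case: x y => a b [c d]; apply/eqP.
by rewrite eq_complex /=; apply/andP; split; apply/eqP; ring.
Qed.

HB.instance Definition _ := isHermitianSesquilinear.Build R[i] R[i] false conjc cdot cdot_herm.

Let cdot_pos x : x != 0 -> 0 < cdot x x.
Proof. by move=> x0; rewrite /cdot -sqr_normc exprn_gt0// normr_gt0. Qed.

HB.instance Definition _ := isDotProduct.Build R[i] R[i] cdot cdot_pos.

(** The space of the one-dimensional representation given by evaluation at infinity, which bounds
    the full norm from below. *)
Definition scalar_hilbert : hilbert R :=
  @Hilbert R R[i] cdot (@sqr_normc R).

End ScalarHilbert.

(** * Algebra of groupoids and twists *)

Section GroupoidAlgebra.
Variable G : groupoid.
Hypothesis L : groupoid_laws G.
Implicit Types g h k : G.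

Lemma composable_invr g : composable (g, ginv g).
Proof. by have := composable_invl L (ginv g); rewrite (ginvK L). Qed.

Lemma composable_src_rng g h : composable (g, h) -> src g = rng h.
Proof.
move=> gh; have cg := composable_invl L g.
have e1 : gmul (src g) h = h by rewrite /src (gmulA L cg gh) (gmulKl L gh).
have c1 : composable (src g, h) := (composable_mul L cg gh).1.
by have := gmulKr L c1; rewrite e1.
Qed.

Lemma gmul_rng g : gmul (rng g) g = g.
Proof. by rewrite /rng (gmulA L (composable_invr g) (composable_invl L g)) -[X in gmul X _](ginvK L) (gmulKl L)// ?(ginvK L)//; exact: composable_invl. Qed.

Lemma gmul_src g : gmul g (src g) = g.
Proof. by rewrite /src -(gmulA L (composable_invr g) (composable_invl L g)) gmul_rng. Qed.

(** For the converse, [(g, src g)] and [(rng h, h)] are always composable, and when the two units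
    agree [composable_mul] glues the pairs. *)
Lemma composableP g h : composable (g, h) <-> src g = rng h.
Proof.
split; first exact: composable_src_rng.
move=> gh.
have c1 : composable (g, src g) := (composable_mul L (composable_invr g) (composable_invl L g)).2.
have c2 : composable (rng h, h) := (composable_mul L (composable_invr h) (composable_invl L h)).1.
rewrite gh in c1; have := (composable_mul L c1 c2).1.
by rewrite -gh gmul_src.
Qed.

Lemma rng_inv g : rng (ginv g) = src g.
Proof. by rewrite /rng /src (ginvK L). Qed.

Lemma src_inv g : src (ginv g) = rng g.
Proof. by rewrite /rng /src (ginvK L). Qed.

Lemma rng_mul g h : composable (g, h) -> rng (gmul g h) = rng g.
Proof.
move=> gh; have c2 : composable (rng g, g) := (composable_mul L (composable_invr g) (composable_invl L g)).1.
have := composable_src_rng (composable_mul L c2 gh).2.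
have := composable_src_rng c2; move=> ->. by [].
Qed.

Lemma src_mul g h : composable (g, h) -> src (gmul g h) = src h.
Proof.
move=> gh; have c2 : composable (h, src h) := (composable_mul L (composable_invr h) (composable_invl L h)).2.
have := composable_src_rng (composable_mul L gh c2).1.
by have := composable_src_rng c2; move=> <-.
Qed.

Lemma rng_rng g : rng (rng g) = rng g.
Proof. by rewrite {2}/rng rng_mul//; exact: composable_invr. Qed.

Lemma src_rng g : src (rng g) = rng g.
Proof. by rewrite {1}/rng src_mul ?src_inv//; exact: composable_invr. Qed.

Lemma units_rng g : units (rng g).
Proof. by exists g. Qed.

Lemma units_src g : units (src g).
Proof. by exists (ginv g); rewrite ?rng_inv. Qed.

Lemma unitsP g : units g <-> rng g = g.
Proof. by split => [[h _ <-]|<-]; [exact: rng_rng|exact: units_rng]. Qed.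

Lemma src_unit g : units g -> src g = g.
Proof. by move=> [h _ <-]; exact: src_rng. Qed.

Lemma rng_unit g : units g -> rng g = g.
Proof. by move/unitsP. Qed.

Lemma inv_unit g : units g -> ginv g = g.
Proof.
move=> ug; have := gmul_src (ginv g); rewrite src_inv (rng_unit ug).
by rewrite -/(src g) src_unit.
Qed.

Lemma gmul_idem g : composable (g, g) -> gmul g g = g -> units g.
Proof. by move=> cg gg; have := gmulKl L cg; rewrite gg -/(src g) => <-; exact: units_src. Qed.

Lemma gmulVK g h : rng g = rng h -> gmul g (gmul (ginv g) h) = h.
Proof.
move=> gh; rewrite -{1}(ginvK L g) (gmulKl L)//.
by apply/composableP; rewrite src_inv.
Qed.

Lemma rng_mulVl g h : rng g = rng h -> rng (gmul (ginv g) h) = src g.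
Proof. by move=> gh; rewrite rng_mul ?rng_inv//; apply/composableP; rewrite src_inv. Qed.

Lemma src_mulVl g h : rng g = rng h -> src (gmul (ginv g) h) = src h.
Proof. by move=> gh; rewrite src_mul//; apply/composableP; rewrite src_inv. Qed.

Lemma composable_Vl g h : rng g = rng h -> composable (ginv g, h).
Proof. by move=> gh; apply/composableP; rewrite src_inv. Qed.

End GroupoidAlgebra.

Section HomAlgebra.
Variables (G H : groupoid) (f : G -> H).
Hypotheses (LG : groupoid_laws G) (LH : groupoid_laws H) (hf : groupoid_hom f).

(** Units are idempotent, idempotents are preserved, and an idempotent of a groupoid is a unit. *)
Lemma hom_units g : units g -> units (f g).
Proof.
move=> ug; have cg : composable (g, g) by apply/(composableP LG); rewrite (src_unit LG) ?(rng_unit LG).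
have [cf ef] := hf cg; apply: (gmul_idem LH cf).
by rewrite -ef -{2}(src_unit LG ug) (gmul_src LG).
Qed.

Lemma hom_inv g : f (ginv g) = ginv (f g).
Proof.
have [cf ef] := hf (composable_invr LG g).
rewrite -[LHS](gmulKl LH cf) -ef -/(rng g).
have ur : units (f (rng g)) by apply: hom_units; exact: units_rng.
have cr : composable (f (rng g), f g).
  by apply: (hf _).1; apply/(composableP LG); rewrite (src_rng LG).
have := (composableP LH _ _).1 cr; rewrite (src_unit LH ur) => ->.
by rewrite -(src_inv LH) (gmul_src LH).
Qed.

Lemma hom_rng g : f (rng g) = rng (f g).
Proof. by rewrite /rng (hf (composable_invr LG g)).2 hom_inv. Qed.

Lemma hom_src g : f (src g) = src (f g).
Proof. by rewrite /src (hf (composable_invl LG g)).2 hom_inv. Qed.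

End HomAlgebra.

(** The part of a twist that mentions no topology. It passes to the Alexandrov twist by case
    analysis, so the algebra of convolution is developed once for both twists. *)
Record algebraic_twist (R : realType) (G : groupoid) (E : twist_data R G) : Prop := {
  at_base : groupoid_laws G;
  at_total : groupoid_laws E;
  at_iota_hom : forall u, units u -> forall w z : circle R,
    composable (twist_iota E u w, twist_iota E u z) /\
    twist_iota E u (circle_mul w z) = gmul (twist_iota E u w) (twist_iota E u z);
  at_proj_hom : groupoid_hom (twist_proj (t := E));
  at_iota_bij : set_bij (@units G `*` [set: circle R])
    (twist_proj (t := E) @^-1` @units G) (fun p => twist_iota E p.1 p.2);
  at_iota_unit : forall u : E, units u -> twist_iota E (twist_proj u) (circle_one R) = u;
  at_central : forall (e : E) z,
    gmul (twist_iota E (twist_proj (rng e)) z) e = gmul e (twist_iota E (twist_proj (src e)) z) }.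

Section TwistAlgebra.
Variables (R : realType) (G : groupoid) (E : twist_data R G).
Hypothesis T : algebraic_twist E.
Let LG := at_base T.
Let LE := at_total T.
Let PH := at_proj_hom T.
Local Notation iota := (twist_iota E).
Local Notation proj := (@twist_proj R G E).
Local Notation act := (@circle_act R G E).
Implicit Types (u : G) (d e : E) (w z : circle R).

Lemma proj_rng e : proj (rng e) = rng (proj e).
Proof. exact: hom_rng. Qed.

Lemma proj_src e : proj (src e) = src (proj e).
Proof. exact: hom_src. Qed.

Lemma proj_inv e : proj (ginv e) = ginv (proj e).
Proof. exact: hom_inv. Qed.

Lemma proj_mul d e : composable (d, e) -> proj (gmul d e) = gmul (proj d) (proj e).
Proof. by case/PH. Qed.

Lemma proj_unit e : units e -> units (proj e).
Proof. exact: hom_units. Qed.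

Lemma iota_inj u v w z : units u -> units v -> iota u w = iota v z -> u = v /\ w = z.
Proof.
move=> uu uv uw; have [_ /(_ (u, w) (v, z)) inj _] := at_iota_bij T.
by have [] := inj (mem_set (conj uu I)) (mem_set (conj uv I)) uw.
Qed.

Lemma iota_surj e : units (proj e) -> exists u z, units u /\ e = iota u z.
Proof.
have [_ _ /(_ e) sj] := at_iota_bij T.
by move=> /sj [[u z] [/= uu _] <-]; exists u, z.
Qed.

Lemma proj_iota_units u z : units u -> units (proj (iota u z)).
Proof. by move=> uu; have [/(_ (u, z)) + _ _] := at_iota_bij T; apply. Qed.

Lemma iota1_unit u : units u -> units (iota u (circle_one R)).
Proof.
move=> uu; have [c e] := at_iota_hom T uu (circle_one R) (circle_one R).
by apply: (gmul_idem LE c); rewrite -e circle_mul1.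
Qed.

(** The axioms only place [iota u z] over some unit. As [iota u 1] is idempotent it is a unit of
    [E], and [at_iota_unit] with injectivity of [iota] tells which one lies below. *)
Lemma proj_iota1 u : units u -> proj (iota u (circle_one R)) = u.
Proof.
move=> uu; have u1 := iota1_unit uu.
by have [] := iota_inj (proj_unit u1) uu (at_iota_unit T u1).
Qed.

Lemma rng_iota u z : units u -> rng (iota u z) = iota u (circle_one R).
Proof.
move=> uu; have [c _] := at_iota_hom T uu (circle_one R) z.
by have /(composableP LE) <- := c; rewrite (src_unit LE)//; exact: iota1_unit.
Qed.

Lemma src_iota u z : units u -> src (iota u z) = iota u (circle_one R).
Proof.
move=> uu; have [c _] := at_iota_hom T uu z (circle_one R).
by have /(composableP LE) -> := c; rewrite (rng_unit LE)//; exact: iota1_unit.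
Qed.

Lemma proj_iota u z : units u -> proj (iota u z) = u.
Proof.
move=> uu; have pu := proj_iota_units z uu.
by rewrite -(rng_unit LG pu) -proj_rng rng_iota// proj_iota1.
Qed.

Lemma iota_rng e : iota (proj (rng e)) (circle_one R) = rng e.
Proof. by apply: at_iota_unit => //; exact: units_rng. Qed.

Lemma iota_src e : iota (proj (src e)) (circle_one R) = src e.
Proof. by apply: at_iota_unit => //; exact: (units_src LE). Qed.

Lemma rng_eq d e : (rng d = rng e) <-> (rng (proj d) = rng (proj e)).
Proof.
rewrite -(proj_rng d) -(proj_rng e); split => [->//|h].
by rewrite -(iota_rng d) -(iota_rng e) h.
Qed.

Lemma src_eq d e : (src d = src e) <-> (src (proj d) = src (proj e)).
Proof.
rewrite -(proj_src d) -(proj_src e); split => [->//|h].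
by rewrite -(iota_src d) -(iota_src e) h.
Qed.

Lemma composable_proj d e : composable (d, e) <-> composable (proj d, proj e).
Proof.
split=> [/PH[]//|/(composableP LG)]; rewrite -(proj_src d) -(proj_rng e) => h.
by apply/(composableP LE); rewrite -(iota_src d) -(iota_rng e) h.
Qed.

Lemma units_proj_rng e : units (proj (rng e)).
Proof. by apply: proj_unit; exact: units_rng. Qed.

Lemma units_proj_src e : units (proj (src e)).
Proof. by apply: proj_unit; exact: (units_src LE). Qed.

Lemma composable_act z e : composable (iota (proj (rng e)) z, e).
Proof. by apply/(composableP LE); rewrite src_iota ?iota_rng//; exact: units_proj_rng. Qed.

Lemma actE z e : act z e = gmul e (iota (proj (src e)) z).
Proof. exact: at_central. Qed.

Lemma composable_actr z e : composable (e, iota (proj (src e)) z).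
Proof. by apply/(composableP LE); rewrite rng_iota ?iota_src//; exact: units_proj_src. Qed.

Lemma rng_act z e : rng (act z e) = rng e.
Proof. by rewrite actE (rng_mul LE)//; exact: composable_actr. Qed.

Lemma src_act z e : src (act z e) = src e.
Proof. by rewrite (src_mul LE)//; exact: composable_act. Qed.

Lemma proj_act z e : proj (act z e) = proj e.
Proof.
rewrite proj_mul; last exact: composable_act.
by rewrite proj_iota ?proj_rng ?(gmul_rng LG)//; exact: units_rng.
Qed.

Lemma act1 e : act (circle_one R) e = e.
Proof. by rewrite /circle_act iota_rng (gmul_rng LE). Qed.

Lemma actM w z e : act (circle_mul w z) e = act w (act z e).
Proof.
rewrite /circle_act -/(act z e) rng_act.
have ur := units_proj_rng e.
rewrite -(gmulA LE) ?(at_iota_hom T ur w z).2//; first exact: (at_iota_hom T ur w z).1.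
exact: composable_act.
Qed.

Lemma actKV z e : act (circle_inv z) (act z e) = e.
Proof. by rewrite -actM circle_mulV act1. Qed.

Lemma composable_actl z d e : composable (act z d, e) <-> composable (d, e).
Proof. by rewrite !(composableP LE) src_act. Qed.

Lemma composable_act2 z d e : composable (d, act z e) <-> composable (d, e).
Proof. by rewrite !(composableP LE) rng_act. Qed.

Lemma gmul_actl z d e : composable (d, e) -> gmul (act z d) e = act z (gmul d e).
Proof.
move=> de; rewrite /circle_act (gmulA LE)//; last exact: composable_act.
by rewrite (rng_mul LE de).
Qed.

Lemma gmul_actr z d e : composable (d, e) -> gmul d (act z e) = act z (gmul d e).
Proof.
move=> de; rewrite !actE -(gmulA LE)//; last exact: composable_actr.
by rewrite (src_mul LE de).
Qed.

Lemma ginv_act z e : ginv (act z e) = act (circle_inv z) (ginv e).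
Proof.
have c : composable (act z e, ginv (act z e)) := composable_invr LE _.
have c' : composable (act z e, act (circle_inv z) (ginv e)).
  by apply/composable_act2/composable_actl; exact: composable_invr.
rewrite -[RHS](gmulKl LE c').
rewrite gmul_actr ?gmul_actl ?composable_actl; try exact: (composable_invr LE).
rewrite actKV -/(rng e) -(rng_act z) /rng (gmulKl LE)//.
Qed.

(** The quotient of [d] by [e] lies over a unit, hence comes from [iota]: the fibres of the
    projection are the circle orbits. *)
Lemma same_proj d e : proj d = proj e -> exists z, d = act z e.
Proof.
move=> de; have c : composable (d, ginv e).
  by apply/composable_proj/(composableP LG); rewrite proj_inv (rng_inv LG) de.
have : units (proj (gmul d (ginv e))).
  by rewrite proj_mul// proj_inv de -/(rng _); exact: units_rng.
move=> /iota_surj[u [z [uu ez]]]; exists z.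
have sde : src d = src e by apply/src_eq; rewrite de.
have ue : u = proj (rng e).
  rewrite -(proj_iota z uu) -ez proj_mul// proj_inv de proj_rng//.
rewrite /circle_act -ue -ez (gmulA LE c)//; last exact: (composable_invl LE).
by rewrite -/(src e) -sde (gmul_src LE).
Qed.

Lemma iota_act u z : units u -> iota u z = act z (iota u (circle_one R)).
Proof.
move=> uu; rewrite /circle_act (rng_iota _ uu) (proj_iota _ uu).
by rewrite -(at_iota_hom T uu _ _).2 circle_mulC circle_mul1.
Qed.

Lemma act_iota u w z : units u -> act w (iota u z) = iota u (circle_mul w z).
Proof. by move=> uu; rewrite (iota_act _ uu) -actM -iota_act. Qed.

End TwistAlgebra.

Lemma alex_groupoid_laws (G : groupoid) : groupoid_laws G -> groupoid_laws (alex_groupoid G).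
Proof.
move=> L; split.
- by case=> [g|] //=; rewrite (ginvK L).
- by case=> [g|] //=; exact: composable_invl.
- move=> [g|] [h|] [k|]//= gh hk; exact: (composable_mul L gh hk).
- by move=> [g|] [h|] [k|]//= gh hk; rewrite (gmulA L gh hk).
- by move=> [g|] [h|]//= gh; rewrite (gmulKl L gh).
- by move=> [g|] [h|]//= gh; rewrite (gmulKr L gh).
Qed.

Lemma alex_twist_laws (R : realType) (G : groupoid) (E : twist_data R G) :
  groupoid_laws E -> groupoid_laws (alex_twist E).
Proof.
move=> L; split.
- by case=> [g|z] //=; rewrite ?(ginvK L) ?circle_invK.
- by case=> [g|] //=; exact: composable_invl.
- move=> [g|?] [h|?] [k|?]//= gh hk; exact: (composable_mul L gh hk).
- by move=> [g|?] [h|?] [k|?]//= gh hk; rewrite ?(gmulA L gh hk) ?circle_mulA.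
- by move=> [g|?] [h|?]//= gh; rewrite ?(gmulKl L gh) ?circle_mulK.
- move=> [g|?] [h|?]//= gh; rewrite ?(gmulKr L gh)//.
  by rewrite circle_mulC [X in circle_mul _ X]circle_mulC circle_mulK.
Qed.

Lemma alex_units (G : groupoid) (x : alex_groupoid G) : units x <-> if x is Some g then units g else True.
Proof.
case: x => [g|]; split => //; last by exists None.
- by move=> [[h|//] _ [<-]]; exists h.
- by move=> [h _ <-]; exists (Some h).
Qed.

Lemma alex_twist_units (R : realType) (G : groupoid) (E : twist_data R G) (x : alex_twist E) :
  units x <-> match x with inl e => units e | inr z => z = circle_one R end.
Proof.
case: x => [e|z]; split.
- by move=> [[h|//] _ [<-]]; exists h.
- by move=> [h _ <-]; exists (inl h).
- by move=> [[//|w] _ [<-]]; rewrite circle_mulC circle_mulV.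
- by move=> ->; exists (inr (circle_one R)) => //; rewrite /rng /= circle_mulC circle_mulV.
Qed.

Lemma alex_algebraic_twist (R : realType) (G : groupoid) (E : twist_data R G) :
  algebraic_twist E -> algebraic_twist (alex_twist E).
Proof.
move=> T; split.
- exact: (alex_groupoid_laws (at_base T)).
- exact: (alex_twist_laws (at_total T)).
- case=> [u|] /alex_units uu w z //=.
  have [c e] := at_iota_hom T uu w z; split => //=.
  by rewrite e.
- by move=> [g|?] [h|?]//= gh; have [c e] := at_proj_hom T gh; split => //=; rewrite e.
- split.
  + by move=> [[u|] z] [/= /alex_units uu _]; apply/alex_units => //=; exact: (proj_iota_units T).
  + move=> [[u|] z] [[v|] w] /=; rewrite !inE => -[/= /alex_units uu _] [/= /alex_units uv _] //.
      by move=> [] /(iota_inj T uu uv)[-> ->].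
    by move=> [->].
  + move=> [e|z] /alex_units /=.
      move=> /(iota_surj T)[u [z [uu ->]]].
      by exists (Some u, z) => //; split => //=; apply/alex_units.
    by move=> _; exists (None, z) => //; split => //=; apply/alex_units.
- move=> [e|z] /alex_twist_units /=; first by move=> ue; rewrite (at_iota_unit T ue).
  by move=> ->.
- case=> [e|w] z /=; first by have := at_central T e z; rewrite /rng /src /= => ->.
  by rewrite circle_mulC.
Qed.

(** * Convolution *)

Section ConvolutionAlgebra.
Variables (R : realType) (G : groupoid) (E : twist_data R G).
Hypothesis T : algebraic_twist E.
Let LG := at_base T.
Let LE := at_total T.
Local Notation proj := (@twist_proj R G E).
Local Notation act := (@circle_act R G E).
Variable sec : G -> E.
Hypothesis hsec : cancel sec proj.
Local Notation conv := (convolution sec).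
Implicit Types (u : G) (d e : E) (w z : circle R) (f g : E -> R[i]).

Definition equivariant f := forall z e, f (circle_act z e) = val z * f e.

Definition unit_supported f := forall e, ~ units (proj e) -> f e = 0.

(** A sum [\sum_(_ \in _)] with infinite support is 0 by convention, so convolution is additive only
    once such finiteness is known. *)
Definition fiber_finite f :=
  forall x : G, finite_set [set y | rng y = x /\ f (sec y) != 0].

Lemma equivariant0 : equivariant (fun=> 0).
Proof. by move=> z e; rewrite mulr0. Qed.

Lemma equivariant_lin (a : R[i]) f g : equivariant f -> equivariant g -> equivariant (fun e => a * f e + g e).
Proof. by move=> ef eg z e; rewrite ef eg mulrDr mulrCA. Qed.

Lemma rnorm_equivariant f z e : equivariant f -> rnorm (f (act z e)) = rnorm (f e).
Proof. by move=> ->; rewrite rnormM rnorm_circle mul1r. Qed.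

Lemma equivariant_fstar f : equivariant f -> equivariant (fstar f).
Proof.
move=> ef z e; rewrite /fstar (ginv_act T) ef rmorphM /=; congr (_ * _).
by rewrite conjc_inv conj_circle invrK.
Qed.

Lemma rng_sec x e : (rng x = proj (rng e)) <-> (rng (sec x) = rng e).
Proof. by rewrite (rng_eq T) hsec (proj_rng T). Qed.

Lemma conv_term f g e z d : equivariant f ->
  (forall z' e', src e' = src e -> g (act z' e') = val z' * g e') -> rng d = rng e ->
  f (act z d) * g (gmul (ginv (act z d)) e) = f d * g (gmul (ginv d) e).
Proof.
move=> ef eg de.
rewrite ef (ginv_act T) (gmul_actl T); last exact: (composable_Vl LE).
rewrite eg; last exact: (src_mulVl LE).
by rewrite /= mulrACA mulfV ?mul1r// circle_neq0.
Qed.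

Lemma conv_gen f g e : equivariant f ->
  (forall z' e', src e' = src e -> g (act z' e') = val z' * g e') ->
  conv f g e = \sum_(y \in [set y | rng y = proj (rng e)]) f (sec y) * g (gmul (ginv (sec y)) e).
Proof.
move=> ef eg; apply: eq_fsbigr => y; rewrite inE /= => /rng_sec ye.
rewrite -[RHS]circle_int_cst; apply: eq_circle_int => z.
exact: conv_term.
Qed.

Lemma convE f g e : equivariant f -> equivariant g ->
  conv f g e = \sum_(y \in [set y | rng y = proj (rng e)]) f (sec y) * g (gmul (ginv (sec y)) e).
Proof. by move=> ef eg; apply: conv_gen => // *; exact: eg. Qed.

(** The only unit in the range fibre over [proj (rng e)] is that point itself, so a single term
    survives. *)
Lemma conv_unitl_gen f g e : equivariant f ->
  (forall z' e', src e' = src e -> g (act z' e') = val z' * g e') -> unit_supported f ->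
  conv f g e = f (rng e) * g e.
Proof.
move=> ef eg uf; rewrite conv_gen//.
rewrite -(@fsbig_widen _ _ _ _ [set proj (rng e)]).
- rewrite fsbig_set1.
  have /(same_proj T)[z ->] : proj (sec (proj (rng e))) = proj (rng e) by rewrite hsec.
  rewrite conv_term// ?(rng_rng LE)//.
  by rewrite (inv_unit LE (units_rng e)) (gmul_rng LE).
- by move=> y -> /=; rewrite (proj_rng T) (rng_rng LG).
- move=> y [/= ye /eqP ny]; rewrite /= uf ?mul0r// hsec => uy.
  by move/eqP: ny; apply; rewrite -ye (rng_unit LG).
Qed.

Lemma conv_unitl f g e : equivariant f -> equivariant g -> unit_supported f ->
  conv f g e = f (rng e) * g e.
Proof. by move=> ef eg; apply: conv_unitl_gen => // *; exact: eg. Qed.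

(** The argument of [g] lies over a unit only for the arrow [y = proj e], so a single term
    survives. *)
Lemma conv_unitr f g e : equivariant f -> equivariant g -> unit_supported g ->
  conv f g e = f e * g (src e).
Proof.
move=> ef eg ug; rewrite convE//.
rewrite -(@fsbig_widen _ _ _ _ [set proj e]).
- rewrite fsbig_set1.
  have /(same_proj T)[z ->] : proj (sec (proj e)) = proj e by rewrite hsec.
  by rewrite conv_term// => *; exact: eg.
- by move=> y -> /=; rewrite (proj_rng T).
- move=> y [/= ye ny].
  have ye' : rng (sec y) = rng e by apply/rng_sec.
  rewrite /= [g _]ug ?mulr0//.
  rewrite (proj_mul T (composable_Vl LE ye')) (proj_inv T) hsec => uu.
  apply: ny; rewrite -[RHS](gmulVK LG (g := y)); last by rewrite ye (proj_rng T).
  have c : composable (y, gmul (ginv y) (proj e)).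
    by apply/(composableP LG); rewrite (rng_mulVl LG)// ye (proj_rng T).
  by rewrite -(rng_unit LG uu) -((composableP LG _ _).1 c) (gmul_src LG).
Qed.

Lemma equivariant_conv f g : equivariant f -> equivariant g -> equivariant (conv f g).
Proof.
move=> ef eg z e; rewrite !convE// (rng_act T) mulr_fsumr.
apply: eq_fsbigr => y; rewrite inE /= => /rng_sec ye.
by rewrite (gmul_actr T z (composable_Vl LE ye)) eg mulrCA.
Qed.

Lemma conv_sum f g e (s : seq G) : equivariant f -> equivariant g -> uniq s ->
  (forall y, y \in s -> rng y = proj (rng e)) ->
  (forall y, rng y = proj (rng e) -> y \notin s -> f (sec y) = 0) ->
  conv f g e = \sum_(y <- s) f (sec y) * g (gmul (ginv (sec y)) e).
Proof.
move=> ef eg us sr s0; rewrite convE//.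
rewrite -(@fsbig_widen _ _ _ _ [set` s]).
- by rewrite (fsbig_seq _ _ us).
- by move=> y /= /sr.
- by move=> y [/= ye /negP ys]; rewrite /= s0// mul0r.
Qed.

Lemma fiber_finite_seq (f1 f2 : E -> R[i]) x : fiber_finite f1 -> fiber_finite f2 ->
  exists s : seq G, [/\ uniq s, forall y, y \in s -> rng y = x &
    forall y, rng y = x -> y \notin s -> f1 (sec y) = 0 /\ f2 (sec y) = 0].
Proof.
move=> /(_ x) F1 /(_ x) F2.
have /finite_seqP[D eD] : finite_set ([set y | rng y = x /\ f1 (sec y) != 0] `|` [set y | rng y = x /\ f2 (sec y) != 0]).
  by rewrite finite_setU.
exists (undup D); split => [|y yD|y yx yD].
- exact: undup_uniq.
- have : [set` D] y by rewrite /= -mem_undup.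
  by rewrite -eD => -[[]|[]].
- have : ~ [set` D] y by apply/negP; rewrite -mem_undup.
  rewrite -eD => /not_orP[/not_andP[//|/negP n1] /not_andP[//|/negP n2]].
  by split; apply/eqP; rewrite -[_ == _]negbK.
Qed.

Lemma conv_linl (a : R[i]) f1 f2 g e : equivariant f1 -> equivariant f2 -> equivariant g ->
  fiber_finite f1 -> fiber_finite f2 ->
  conv (fun d => a * f1 d + f2 d) g e = a * conv f1 g e + conv f2 g e.
Proof.
move=> e1 e2 eg F1 F2.
have [s [us sr s0]] := fiber_finite_seq (proj (rng e)) F1 F2.
rewrite !(conv_sum _ _ us sr)//; last first.
- by move=> y yx ys; have [-> ->] := s0 y yx ys; rewrite mulr0 addr0.
- exact: equivariant_lin.
- by move=> y yx ys; have [] := s0 y yx ys.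
- by move=> y yx ys; have [] := s0 y yx ys.
rewrite mulr_sumr -big_split; apply: eq_bigr => y _ /=.
by rewrite mulrDl mulrA.
Qed.

Lemma conv_linr (a : R[i]) f g1 g2 e : equivariant f -> equivariant g1 -> equivariant g2 ->
  fiber_finite f ->
  conv f (fun d => a * g1 d + g2 d) e = a * conv f g1 e + conv f g2 e.
Proof.
move=> ef e1 e2 F.
have [s [us sr s0]] := fiber_finite_seq (proj (rng e)) F F.
have s0' y : rng y = proj (rng e) -> y \notin s -> f (sec y) = 0.
  by move=> yx ys; have [-> _] := s0 y yx ys.
rewrite !(conv_sum _ _ us sr)//; last exact: equivariant_lin.
rewrite mulr_sumr -big_split; apply: eq_bigr => y _ /=.
by rewrite mulrDr mulrCA.
Qed.

Lemma fiber_finite_unit f : unit_supported f -> fiber_finite f.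
Proof.
move=> uf x; apply: (@sub_finite_set _ _ [set x]); last exact: finite_set1.
move=> y [<- fy]; have [uy|ny] := pselect (units y); first by rewrite /= (rng_unit LG).
by move: fy; rewrite uf ?hsec ?eqxx.
Qed.

Lemma fiber_finite_lin (a : R[i]) f g : fiber_finite f -> fiber_finite g ->
  fiber_finite (fun e => a * f e + g e).
Proof.
move=> Ff Fg x.
apply: (@sub_finite_set _ _ ([set y | rng y = x /\ f (sec y) != 0] `|` [set y | rng y = x /\ g (sec y) != 0])); last by rewrite finite_setU.
move=> y [yx]; have [f0|f0] := eqVneq (f (sec y)) 0; last by left.
by rewrite f0 mulr0 add0r; right.
Qed.

End ConvolutionAlgebra.

(** Two sections differ by a phase on each arrow, which [conv_term] absorbs. *)
Lemma conv_section (R : realType) (G : groupoid) (E : twist_data R G) (sec sec' : G -> E) f g e :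
  algebraic_twist E -> cancel sec (@twist_proj R G E) -> cancel sec' (@twist_proj R G E) ->
  equivariant f ->
  (forall z' e', src e' = src e -> g (circle_act z' e') = val z' * g e') ->
  convolution sec f g e = convolution sec' f g e.
Proof.
move=> T h h' ef eg; rewrite !(conv_gen T)//; apply: eq_fsbigr => y; rewrite inE /= => ye.
have [z ->] : exists z, sec y = circle_act z (sec' y) by apply: (same_proj T); rewrite h h'.
by rewrite (conv_term T)//; apply/(rng_sec T h').
Qed.

(** * Topology of étale groupoids and of their twists *)

Section Topology.

Lemma within_comp (X Y Z : topologicalType) (A : set Y) (f : Y -> Z) (g : X -> Y) :
  {within A, continuous f} -> continuous g -> (forall x, A (g x)) -> continuous (f \o g).
Proof.
move=> /subspace_continuousP cf cg gA x V /(cf (g x) (gA x)).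
rewrite /= !nbhs_simpl /within /= => nV; have := cg x _ nV; rewrite /= nbhs_simpl /=.
by apply: filterS => y /=; apply.
Qed.

Lemma within_comp_at (X Y Z : topologicalType) (A : set Y) (f : Y -> Z) (g : X -> Y) (B : set X) :
  {within A, continuous f} -> {within B, continuous g} -> (forall x, B x -> A (g x)) ->
  {within B, continuous (f \o g)}.
Proof.
move=> /subspace_continuousP cf /subspace_continuousP cg gA; apply/subspace_continuousP.
move=> x Bx V /(cf (g x) (gA x Bx)).
rewrite /= !nbhs_simpl /within /= => nV; have := cg x Bx _ nV; rewrite /= !nbhs_simpl /within /=.
by apply: filterS => y /= h By; exact: h By (gA _ By).
Qed.

Lemma cont_open_preimage (X Y : topologicalType) (f : X -> Y) (B : set Y) :
  continuous f -> open B -> open (f @^-1` B).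
Proof. by move=> cf; apply: open_comp => x _; exact: cf. Qed.

Lemma cont_closed_preimage (X Y : topologicalType) (f : X -> Y) (B : set Y) :
  continuous f -> closed B -> closed (f @^-1` B).
Proof. by move=> cf; apply: closed_comp => x _; exact: cf. Qed.

Lemma closed_eq_fun (X Y : topologicalType) (f g : X -> Y) :
  hausdorff_space Y -> continuous f -> continuous g -> closed [set x | f x = g x].
Proof.
move=> hY cf cg x clx; apply: hY => A B nA nB.
have /clx[y [/= fg [Ay By]]] : nbhs x (f @^-1` A `&` g @^-1` B).
  by apply: filterI; [exact: cf|exact: cg].
by exists (f y); split => //; rewrite fg.
Qed.

(** The sets satisfying [P] are directed by inclusion. Near-covering compactness, applied to the
    filter of this directed family, absorbs [K] into one of them. *)
Lemma compact_induction (X : topologicalType) (K : set X) (P : set X -> Prop) :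
  compact K -> P set0 -> (forall A B, P A -> P B -> P (A `|` B)) ->
  (forall A B, A `<=` B -> P B -> P A) ->
  (forall x, K x -> exists2 U, nbhs x U & P U) -> P K.
Proof.
move=> /compact_near_coveringP cK P0 PU PS Ploc.
pose F : set_system (set X) := [set Q | exists2 A, P A & forall B, P B -> A `<=` B -> Q B].
have FF : Filter F.
  split.
  - by exists set0.
  - move=> Q1 Q2 [A1 PA1 H1] [A2 PA2 H2]; exists (A1 `|` A2); first exact: PU.
    move=> B PB AB; split.
      by apply: H1 => // x Ax; apply: AB; left.
    by apply: H2 => // x Ax; apply: AB; right.
  - by move=> Q1 Q2 QQ [A PA H]; exists A => // B PB AB; apply: QQ; exact: H.
have [|A PA H] := cK _ F (fun B x => B x) FF.
  move=> x /Ploc[U nU PU']; exists (U, [set B | U `<=` B]) => /=.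
    by split => //; exists U.
  by move=> [y B] /= [Uy UB]; exact: UB.
by apply: (PS _ A) => //; exact: H.
Qed.

End Topology.

Section GroupoidTopology.
Variable G : groupoid.
Hypothesis tG : topological_groupoid G.
Let L := topological_groupoid_laws tG.

Lemma rng_continuous : continuous (@rng G).
Proof.
have : continuous (fun g : G => (g, ginv g)).
  by apply: cont_pair; [move=> x; exact: cvg_id|exact: (ginv_continuous tG)].
move=> c; apply: (within_comp (gmul_continuous tG) c) => g.
exact: composable_invr.
Qed.

Lemma src_continuous : continuous (@src G).
Proof.
have : continuous (fun g : G => (ginv g, g)).
  by apply: cont_pair; [exact: (ginv_continuous tG)|move=> x; exact: cvg_id].
move=> c; apply: (within_comp (gmul_continuous tG) c) => g.
exact: composable_invl.
Qed.

Lemma units_closed : hausdorff_space G -> closed (@units G).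
Proof.
move=> hG; have -> : @units G = [set g | rng g = g].
  by apply/seteqP; split => g /(unitsP L).
by apply: closed_eq_fun => //; [exact: rng_continuous|move=> x; exact: cvg_id].
Qed.

Hypothesis etG : etale G.

Lemma etale_local (g : G) : exists U, [/\ open U, U g,
  {in U &, injective (@rng G)} & forall V, open V -> exists2 O, open O & @rng G @` (U `&` V) = @units G `&` O].
Proof.
have [U [W [oU Ug oW [[_ ri _] _ ro]]]] := etG g.
exists U; split => // V oV; have [W' oW' e] := ro V oV; exists (W `&` W'); first exact: openI.
by rewrite e setIA.
Qed.

(** Take a unit [u] and a neighbourhood [U] on which the range map is injective. If [v] and [rng v]
    both lie in [U], they have the same range, so [v = rng v] is a unit. *)
Lemma units_open : open (@units G).
Proof.
rewrite openE => u uu; have [U [oU Uu ri _]] := etale_local u.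
have oV : open (U `&` (@rng G) @^-1` U).
  by apply: openI => //; apply: open_comp oU => x _; exact: rng_continuous.
have : nbhs u (U `&` (@rng G) @^-1` U).
  by apply: open_nbhs_nbhs; split => //; split => //=; rewrite (rng_unit L uu).
rewrite /interior; apply: filterS => v [Uv Urv].
apply/(unitsP L); apply: ri; rewrite ?inE//.
by rewrite (rng_rng L).
Qed.

Lemma rng_open_local (g : G) : exists U, [/\ open U, U g,
  {in U &, injective (@rng G)} & forall V, open V -> open (@rng G @` (U `&` V))].
Proof.
have [U [oU Ug ri ro]] := etale_local g; exists U; split => // V oV.
by have [W' oW' ->] := ro V oV; apply: openI => //; exact: units_open.
Qed.

(** A neighbourhood on which the range map is injective contributes at most one point to each fibre.
    That [n] does not depend on [x] makes I-norms of compactly supported functions finite. *)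
Lemma compact_fiber_bound (K : set G) : compact K ->
  exists n : nat, forall x, exists s : seq G, (size s <= n)%N /\ (forall g, K g -> rng g = x -> g \in s).
Proof.
move=> cK; apply: (compact_induction (P := fun K => exists n : nat, forall x, exists s : seq G, (size s <= n)%N /\ (forall g, K g -> rng g = x -> g \in s)) cK).
- by exists 0%N => x; exists [::].
- move=> A B [n Hn] [m Hm]; exists (n + m)%N => x.
  have [s [ns sA]] := Hn x; have [t [nt tB]] := Hm x; exists (s ++ t); split.
    by rewrite size_cat leq_add.
  by move=> g [Ag|Bg] gx; rewrite mem_cat ?(sA g Ag gx)// (tB g Bg gx) orbT.
- move=> A B AB [n Hn]; exists n => x; have [s [ns sA]] := Hn x.
  by exists s; split => // g /AB; exact: sA.
- move=> g Kg; have [U [oU Ug ri _]] := rng_open_local g; exists U.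
    by apply: open_nbhs_nbhs.
  exists 1%N => x; have [[h Uh hx]|no] := pselect (exists2 h, U h & rng h = x).
    exists [:: h]; split => // k Uk kx; rewrite inE; apply/eqP.
    by apply: ri; rewrite ?inE// kx.
  by exists [::]; split => // k Uk kx; case: no; exists k.
Qed.

Lemma compact_fiber_finite (K : set G) x : compact K -> finite_set [set g | K g /\ rng g = x].
Proof.
move=> /compact_fiber_bound[n /(_ x)[s [_ Hs]]].
by apply: (@sub_finite_set _ _ [set` s]) => //; move=> g [Kg gx]; exact: Hs.
Qed.

End GroupoidTopology.

Section TwistTopology.
Variables (R : realType) (G : groupoid) (E : twist_data R G).
Hypotheses (hG : lch_groupoid G) (etG : etale G) (hE : is_twist E).
Local Notation iota := (twist_iota E).
Local Notation proj := (@twist_proj R G E).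
Local Notation act := (@circle_act R G E).

Lemma is_twist_algebraic : algebraic_twist E.
Proof.
case: hG => tG _ _; case: (hE) => -[tE _ _] ih ph [ib _ _] iu _ _ _ ic.
by split => //; [exact: topological_groupoid_laws tG|exact: topological_groupoid_laws tE].
Qed.
Let T := is_twist_algebraic.

Lemma twist_topological : topological_groupoid E.
Proof. by case: (twist_lch hE). Qed.

Lemma twist_hausdorff : hausdorff_space E.
Proof. by case: (twist_lch hE). Qed.

Lemma base_topological : topological_groupoid G.
Proof. by case: hG. Qed.

Lemma base_hausdorff : hausdorff_space G.
Proof. by case: hG. Qed.

Lemma proj_cont : continuous proj.
Proof. exact: (Defs.proj_continuous hE). Qed.

Lemma iota_continuous : {within @units G `*` [set: circle R], continuous (fun p => iota p.1 p.2)}.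
Proof. by case: (iota_homeo hE). Qed.

Lemma act_continuous : continuous (fun p : circle R * E => act p.1 p.2).
Proof.
have c1 : continuous (fun p : circle R * E => (proj (rng p.2), p.1)).
  apply: cont_pair; last exact: cont_fst.
  exact: (cont_comp (@cont_snd _ _) (cont_comp (rng_continuous twist_topological) proj_cont)).
have c2 : continuous (fun p : circle R * E => iota (proj (rng p.2)) p.1).
  apply: (within_comp iota_continuous c1) => p; split => //=.
  exact: (units_proj_rng T).
have c3 : continuous (fun p : circle R * E => (iota (proj (rng p.2)) p.1, p.2)).
  by apply: cont_pair => //; exact: cont_snd.
apply: (within_comp (gmul_continuous twist_topological) c3) => p.
exact: composable_act.
Qed.

Lemma proj_units_open : open (proj @^-1` @units G).
Proof.
apply: cont_open_preimage (units_open base_topological etG).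
exact: proj_cont. Qed.

Lemma proj_units_closed : closed (proj @^-1` @units G).
Proof.
apply: cont_closed_preimage (units_closed base_topological base_hausdorff).
exact: proj_cont.
Qed.

End TwistTopology.

Section CompactSupport.
Variables (R : realType) (G : groupoid) (E : twist_data R G).
Implicit Types f g : E -> R[i].

(** Closedness of [K] is asked separately because the lemma also serves the Alexandrov twist, where
    it is checked by hand. *)
Lemma Cc_intro f (K : set E) : continuous f -> compact K -> closed K ->
  (forall e, f e != 0 -> K e) -> Cc f.
Proof.
move=> cf cK clK fK; split => //; apply: (subclosed_compact (@closed_closure _ _) cK).
by rewrite [X in _ `<=` X](closure_id K).1//; apply: closureS.
Qed.

Lemma Cc_elim f : Cc f -> exists K : set E, [/\ compact K, closed K & forall e, f e != 0 -> K e].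
Proof.
move=> [_ cK]; exists (closure [set e | f e != 0]); split => //.
- exact: closed_closure.
- by move=> e fe; exact: subset_closure.
Qed.

Lemma Cc0 : @Cc R G E (fun=> 0).
Proof.
by apply: (@Cc_intro _ set0); [exact: cont_cst|exact: compact0|exact: closed0|move=> e; rewrite eqxx].
Qed.

Lemma Cc_lin (a : R[i]) f g : Cc f -> Cc g -> Cc (fun e => a * f e + g e).
Proof.
move=> Cf Cg; have [K [cK clK fK]] := Cc_elim Cf; have [K' [cK' clK' gK']] := Cc_elim Cg.
apply: (@Cc_intro _ (K `|` K')).
- apply: contD; last exact: Cg.1.
  by apply: contM; [exact: cont_cst|exact: Cf.1].
- exact: compactU.
- exact: closedU.
- move=> e; have [f0|f0] := eqVneq (f e) 0; last by left; exact: fK.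
  by rewrite f0 mulr0 add0r; right; exact: gK'.
Qed.

Lemma Cc_mul f g : continuous g -> Cc f -> Cc (fun e => f e * g e).
Proof.
move=> cg Cf; have [K [cK clK fK]] := Cc_elim Cf.
apply: (@Cc_intro _ K (contM Cf.1 cg) cK clK) => e.
by rewrite mulf_eq0 negb_or => /andP[fe _]; exact: fK.
Qed.

Lemma Cc_equivariant_subspace : subspace_on (@Cc_equivariant R G E).
Proof.
split; first by split; [exact: Cc0|exact: equivariant0].
by move=> a f g [Cf ef] [Cg eg]; split; [exact: Cc_lin|exact: equivariant_lin].
Qed.

End CompactSupport.

Lemma near_all (I : eqType) (T : Type) (F : set_system T) (s : seq I) (P : I -> T -> Prop) :
  Filter F -> (forall i, i \in s -> \forall x \near F, P i x) ->
  \forall x \near F, forall i, i \in s -> P i x.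
Proof.
move=> FF; elim: s => [_|i s IH H].
  by apply: filterE => x i; rewrite in_nil.
have h1 := H i (mem_head _ _).
have h2 := IH (fun k ks => H k (mem_behead (s := i :: s) ks)).
apply: filterS2 h1 h2 => x Px Pxs k; rewrite inE => /orP[/eqP -> //|]; exact: Pxs.
Qed.

Lemma cvg_sum_seq (R : realType) (I : eqType) (T : Type) (F : set_system T) (s : seq I)
    (h : I -> T -> R[i]) (l : I -> R[i]) : Filter F ->
  (forall i, i \in s -> h i x @[x --> F] --> l i) ->
  (\sum_(i <- s) h i x) @[x --> F] --> \sum_(i <- s) l i.
Proof.
move=> FF; elim: s => [_|i s IH H].
  by rewrite big_nil; under eq_fun do rewrite big_nil; exact: cvg_cst.
rewrite big_cons; under eq_fun do rewrite big_cons.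
apply: cvgD; first exact: H (mem_head _ _).
by apply: IH => k ks; apply: H; rewrite inE ks orbT.
Qed.

(** * Convolution of compactly supported equivariant functions *)

Section ConvolutionTopology.
Variables (R : realType) (G : groupoid) (E : twist_data R G).
Hypotheses (hG : lch_groupoid G) (etG : etale G) (hE : is_twist E).
Let T := is_twist_algebraic hG hE.
Let LE := at_total T.
Let tG := base_topological hG.
Let tE := twist_topological hE.
Local Notation proj := (@twist_proj R G E).
Variable sec : G -> E.
Hypothesis hsec : cancel sec proj.
Local Notation conv := (convolution sec).
Local Notation S := (@Cc_equivariant R G E).
Implicit Types (f g : E -> R[i]).

Lemma Cc_introE f (K : set E) : continuous f -> compact K -> (forall e, f e != 0 -> K e) -> Cc f.
Proof.
by move=> cf cK; apply: Cc_intro => //; exact: compact_closed (twist_hausdorff hE) cK.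
Qed.

Lemma ginv_continuousE : continuous (@ginv E).
Proof. exact: (ginv_continuous tE). Qed.

Lemma fstar_continuous f : continuous f -> continuous (fstar f).
Proof. by move=> cf; exact: (cont_comp (cont_comp ginv_continuousE cf) (@conjc_continuous R)). Qed.

Lemma Cc_fstar f : Cc f -> Cc (fstar f).
Proof.
move=> Cf; have [K [cK clK fK]] := Cc_elim Cf.
apply: (@Cc_introE _ (@ginv E @` K)).
- by apply: fstar_continuous; exact: Cf.1.
- apply: continuous_compact cK; apply: continuous_subspaceT; exact: ginv_continuousE.
- move=> e; rewrite /fstar conjc_eq0 => /fK Ke.
  by exists (ginv e) => //; rewrite (ginvK LE).
Qed.

Lemma Cc_equivariant_fstar f : S f -> S (fstar f).
Proof. by move=> [Cf ef]; split; [exact: Cc_fstar|exact: (equivariant_fstar T)]. Qed.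

Lemma proj_compact (K : set E) : compact K -> compact (proj @` K).
Proof.
move=> cK; apply: continuous_compact cK; apply: continuous_subspaceT; exact: (proj_cont hE).
Qed.

Lemma Cc_fiber_finite f : Cc f -> fiber_finite sec f.
Proof.
move=> /Cc_elim[K [cK _ fK]] x.
apply: (@sub_finite_set _ _ [set g | (proj @` K) g /\ rng g = x]).
  by move=> y [yx /fK Ky]; split => //; exists (sec y).
by apply: compact_fiber_finite => //; exact: proj_compact.
Qed.

Let xr (e : E) := proj (rng e).

Let xr_continuous : continuous xr.
Proof. exact: (cont_comp (rng_continuous tE) (proj_cont hE)). Qed.

(* Near the fibre over [x0], the support of [f] is swept out by finitely many
   continuous local sections [t y] of the range map, so that the convolution is
   locally a finite sum of continuous functions. *)
Lemma conv_continuous f g : S f -> continuous g -> equivariant g -> continuous (conv f g).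
Proof.
move=> [Cf ef] cg eg e0.
have [K' [cK' _ fK']] := Cc_elim Cf.
pose K := proj @` K'; have cK : compact K by exact: proj_compact.
have fK y : f (sec y) != 0 -> K y by move=> /fK' Ky; exists (sec y).
pose x0 := xr e0.
have ux0 : units x0 := units_proj_rng T e0.
have /choice[U HU] : forall y : G, exists U : set G, [/\ open U, U y,
    {in U &, injective (@rng G)} & forall V, open V -> open ((@rng G) @` (U `&` V))].
  by move=> y; exact: rng_open_local.
(* The continuation of [y] to the fibre over [x]. For [y] over [x0] and [x] near [x0] the point
   exists in [U y], so the default [y] does not interfere. *)
pose t y x := xget y [set y' | U y y' /\ rng y' = x].
have Ht y V : rng y = x0 -> nbhs y V ->
    \forall x \near x0, [/\ U y (t y x), rng (t y x) = x & V (t y x)].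
  move=> yx nV; have [oU Uy ri ro] := HU y.
  have oV : open (V°) by exact: open_interior.
  have : nbhs x0 ((@rng G) @` (U y `&` V°)).
    by apply: open_nbhs_nbhs; split; [exact: ro|exists y].
  apply: filterS => x [y' [Uy' Vy'] yx'].
  have [Ut tx] : U y (t y x) /\ rng (t y x) = x.
    by apply: (@xgetPex _ y [set y' | U y y' /\ rng y' = x]); exists y'.
  split => //; have -> : t y x = y' by apply: ri; rewrite ?inE// tx yx'.
  exact: interior_subset.
have /finite_seqP[s' es] := compact_fiber_finite tG etG x0 cK.
pose s := undup s'.
have sP y : y \in s <-> K y /\ rng y = x0.
  rewrite mem_undup; have : [set` s'] y <-> [set g | K g /\ rng g = x0] y by rewrite es.
  by [].
(* No arrow of [K] over [x] is missed. Close to some [y] in [s] it must be the unique point [t y x]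
   of [U y], and arrows of [K] near one whose range is not [x0] keep their ranges away from [x0];
   compactness of [K] makes this uniform. *)
have Hcov : \forall x \near x0, forall y, K y -> rng y = x -> y \in [seq t y x | y <- s].
  have := (compact_near_coveringP K).1 cK G (nbhs x0)
    (fun x y => rng y = x -> y \in [seq t y x | y <- s]) (nbhs_filter x0).
  move=> H; have {H} : \forall x \near nbhs x0, K `<=` (fun y => rng y = x -> y \in [seq t y x | y <- s]).
    apply: H => y Ky; have [yx|yx] := pselect (rng y = x0).
      have [oU Uy ri ro] := HU y.
      have n1 := Ht y setT yx (@filterT _ _ (nbhs_filter y)).
      exists (U y, [set x | [/\ U y (t y x), rng (t y x) = x & True]]).
        by split; [apply: open_nbhs_nbhs; split|exact: n1].
      move=> [y' x] /= [Uy' [Ut tx _]] yx'.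
      apply/mapP; exists y; first by apply/sP.
      by apply: ri; rewrite ?inE// tx yx'.
    have : exists A B, [/\ nbhs (rng y) A, nbhs x0 B & forall z, ~ (A z /\ B z)].
      apply: contrapT => no; apply: yx; apply: (base_hausdorff hG) => A B nA nB.
      apply: contrapT => AB; apply: no; exists A, B; split => // z Hz; apply: AB; by exists z.
    move=> [A [B [nA nB AB]]].
    exists ((@rng G) @^-1` A, B).
      by split => //=; exact: (rng_continuous tG).
    by move=> [y' x] /= [Ay Bx] yx'; case: (AB x); rewrite -{1}yx'.
  by apply: filterS => x H y; exact: H.
(* Distinct arrows of [s] have disjoint neighbourhoods, which keep their continuations apart;
   otherwise the list could count an arrow twice. *)
have Huniq : \forall x \near x0, uniq [seq t y x | y <- s].
  have : \forall x \near x0, forall y, y \in s -> forall y', y' \in s -> t y x = t y' x -> y = y'.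
    apply: near_all => y /sP[Ky yx]; apply: near_all => y' /sP[Ky' yx'].
    have [->|/eqP yy] := eqVneq y y'; first exact: nearW.
    have : exists A B, [/\ nbhs y A, nbhs y' B & forall z, ~ (A z /\ B z)].
      apply: contrapT => no; apply: yy; apply: (base_hausdorff hG) => A B nA nB.
      apply: contrapT => AB; apply: no; exists A, B; split => // z Hz; apply: AB; by exists z.
    move=> [A [B [nA nB AB]]].
    apply: filterS2 (Ht y A yx nA) (Ht y' B yx' nB) => x [_ _ Ax] [_ _ Bx] tt.
    by case: (AB (t y x)); split => //; rewrite tt.
  apply: filterS => x H; rewrite map_inj_in_uniq ?undup_uniq//.
  by move=> y y' ys y's /=; exact: H.
(* A term of the sum as a function of a free lift [d] of the arrow: jointly continuous in [d] and
   [e] where their ranges agree, and independent of the lift by [conv_term]. *)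
pose Th (p : E * E) := f p.1 * g (gmul (ginv p.1) p.2).
pose A := [set p : E * E | rng p.1 = rng p.2].
have cTh : {within A, continuous Th}.
  apply: (@contM (subspace A) R[i] (fun p => f p.1) (fun p => g (gmul (ginv p.1) p.2))).
    apply: (@continuous_subspaceT _ _ A (fun p : E * E => f p.1)).
    exact: (cont_comp (@cont_fst _ _) Cf.1).
  have c1 : {within A, continuous (fun p : E * E => gmul (ginv p.1) p.2)}.
    apply: (within_comp_at (gmul_continuous tE) (g := fun p : E * E => (ginv p.1, p.2))).
      apply: continuous_subspaceT; apply: cont_pair; last exact: cont_snd.
      exact: (cont_comp (@cont_fst _ _) ginv_continuousE).
    by move=> p pA; exact: (composable_Vl LE).
  exact: (cont_comp c1 cg).
pose Psi y e := f (sec y) * g (gmul (ginv (sec y)) e).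
have xrE e y : rng y = xr e <-> rng (sec y) = rng e by exact: (rng_sec T hsec).
have Hsum : \forall e \near e0, conv f g e = \sum_(y <- s) Psi (t y (xr e)) e.
  have Hrng : \forall x \near x0, forall y, y \in s -> rng (t y x) = x.
    by apply: near_all => y /sP[Ky yx]; apply: filterS (Ht y setT yx (@filterT _ _ (nbhs_filter y))) => x [].
  have nx := @filterI _ _ (nbhs_filter x0) _ _ (@filterI _ _ (nbhs_filter x0) _ _ Hcov Huniq) Hrng.
  have := xr_continuous nx.
  rewrite nbhs_simpl /=; apply: filterS => e [[h1 h2] h3].
  rewrite (conv_sum T hsec (s := [seq t y (xr e) | y <- s]))//.
  - by rewrite big_map.
  - by move=> _ /mapP[y ys ->]; exact: h3.
  - move=> y yx ys; apply/eqP; apply: contraTT isT => fy; exfalso.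
    by move/negP: ys; apply; apply: h1 => //; exact: fK.
have tx0 y : y \in s -> t y x0 = y.
  move=> /sP[Ky yx]; have [oU Uy ri ro] := HU y.
  have [Ut tx] : U y (t y x0) /\ rng (t y x0) = x0.
    by apply: (@xgetPex _ y [set y' | U y y' /\ rng y' = x0]); exists y.
  by apply: ri; rewrite ?inE// tx.
rewrite /continuous_at; have -> : conv f g e0 = \sum_(y <- s) Psi y e0.
  rewrite (nbhs_singleton Hsum) -/x0; apply: eq_big_seq => y ys.
  by rewrite tx0.
suff : (\sum_(y <- s) Psi (t y (xr e)) e) @[e --> e0] --> \sum_(y <- s) Psi y e0.
  apply: cvg_trans; apply: near_eq_cvg; apply: filterS Hsum => e he.
  by rewrite he.
apply: cvg_sum_seq => y /sP[Ky yx]; apply/cvg_rnorm => eps eps0.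
have Ay : A (sec y, e0) by apply/xrE.
have := (subspace_continuousP _ _).1 cTh _ Ay.
move=> /(@cvg_rnorm _ _ _ _ _ _ _)/(_ eps eps0).
rewrite near_withinE => -[[V W] [/= nV nW] VW].
(* The section may jump, but [proj] is open: for [x] near [x0] the arrow [t y x] has some lift [d]
   close to [sec y]. *)
have nV' : nbhs y (proj @` V°).
  apply: open_nbhs_nbhs; split; first by apply: (Defs.proj_open hE); exact: open_interior.
  by exists (sec y); [exact: nV|rewrite hsec].
have n2 := xr_continuous (Ht y _ yx nV').
rewrite nbhs_simpl /= in n2.
apply: filterS2 n2 nW => e [Ut tx [d Vd pd]] We.
have rd : rng d = rng e.
  by apply/(rng_eq T); rewrite pd tx /xr (proj_rng T).
have -> : Psi (t y (xr e)) e = Th (d, e).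
  rewrite /Psi /Th /=; have /(same_proj T)[z ->] : proj (sec (t y (xr e))) = proj d by rewrite hsec pd.
  by apply: (conv_term T) => // *; exact: eg.
exact: (VW (d, e) (conj (interior_subset Vd) We) rd).
Qed.

Lemma Cc_equivariant_conv f g : S f -> S g -> S (conv f g).
Proof.
move=> Sf Sg; split; last by apply: (equivariant_conv T hsec); [exact: Sf.2|exact: Sg.2].
have [K [cK _ fK]] := Cc_elim Sf.1; have [K' [cK' _ gK']] := Cc_elim Sg.1.
(* Multiplication is continuous on composable pairs only, so the support is caught by the image of
   the compact set of composable pairs drawn from the two supports. *)
pose B := K `*` K' `&` [set p : E * E | src p.1 = rng p.2].
have cB : compact B.
  apply: (subclosed_compact _ (compact_setX cK cK')); last by move=> p [].
  apply: closedI; last first.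
    apply: (closed_eq_fun (twist_hausdorff hE)).
      exact: (cont_comp (@cont_fst _ _) (src_continuous tE)).
    exact: (cont_comp (@cont_snd _ _) (rng_continuous tE)).
  have -> : K `*` K' = (fst @^-1` K) `&` (snd @^-1` K') :> set (E * E) by [].
  apply: closedI.
    by apply: (cont_closed_preimage (@cont_fst _ _)); exact: compact_closed (twist_hausdorff hE) cK.
  by apply: (cont_closed_preimage (@cont_snd _ _)); exact: compact_closed (twist_hausdorff hE) cK'.
apply: (@Cc_introE _ ((fun p : E * E => gmul p.1 p.2) @` B)).
- by apply: conv_continuous => //; [exact: Sg.1.1|exact: Sg.2].
- apply: continuous_compact cB.
  apply: (continuous_subspaceW _ (gmul_continuous tE)) => p [_ pc].
  by case: p pc => d e /= pc; apply/(composableP LE).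
- move=> e; apply: contraPP => nB; apply/negP; rewrite negbK; apply/eqP.
  rewrite (convE T hsec e Sf.2 Sg.2); apply: fsbig1 => y /= /(rng_sec T hsec) ye.
  apply/eqP; rewrite mulf_eq0; apply: contrapT => /negP; rewrite negb_or => /andP[/fK Ky /gK' Ky'].
  apply: nB; exists (sec y, gmul (ginv (sec y)) e); last by rewrite /= (gmulVK LE).
  by split => //=; rewrite (rng_mulVl LE).
Qed.

End ConvolutionTopology.

(** * Functions vanishing at infinity along the units *)

Section INorm.
Variables (R : realType) (G : groupoid) (E : twist_data R G).
Hypothesis T : algebraic_twist E.
Let LG := at_base T.
Local Notation proj := (@twist_proj R G E).
Variable sec : G -> E.
Hypothesis hsec : cancel sec proj.
Implicit Types (f g : E -> R[i]) (x : G).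

Definition fiber_sum x f : \bar R :=
  \esum_(y in [set y | rng y = x]) (rnorm (f (sec y)))%:E.

Lemma haar_eintE x f : equivariant f ->
  haar_eint sec x (fun e => (rnorm (f e))%:E) = fiber_sum x f.
Proof.
move=> ef; apply: eq_esum => y _.
transitivity (circle_eint (fun _ : circle R => (rnorm (f (sec y)))%:E)).
  by congr circle_eint; apply/funext => z; rewrite rnorm_equivariant.
by rewrite circle_eintE ?circle_rint_cst//; exact: cont_cst.
Qed.

Lemma haar_eint_srcE x f : equivariant f ->
  haar_eint_src sec x (fun e => (rnorm (f e))%:E) = fiber_sum x (fstar f).
Proof.
move=> ef; rewrite -haar_eintE; last exact: equivariant_fstar.
by rewrite /haar_eint_src; congr (haar_eint _ _); apply/funext => e; rewrite /fstar rnormJ.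
Qed.

Lemma fiber_sum_le (k f : E -> R[i]) (a M : R) x : 0 <= a ->
  (forall e, rnorm (k e) <= a * rnorm (f e)) -> (fiber_sum x f <= M%:E)%E ->
  (fiber_sum x k <= (a * M)%:E)%E.
Proof.
move=> a0 kf fM; apply: ge_ereal_sup => _ [A [finA Ax] <-].
apply: (@le_trans _ _ (\sum_(y \in A) (a * rnorm (f (sec y)))%:E)%E).
  by apply: lee_fsum => // y Ay; rewrite lee_fin.
have -> : (\sum_(y \in A) (a * rnorm (f (sec y)))%:E)%E = (a%:E * \sum_(y \in A) (rnorm (f (sec y)))%:E)%E.
  by rewrite ge0_mule_fsumr// => y; rewrite lee_fin rnorm_ge0.
rewrite EFinM; apply: lee_wpmul2l; first by rewrite lee_fin.
by apply: le_trans fM; apply: ereal_sup_ubound; exists A.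
Qed.

Lemma fiber_sumD (k f g : E -> R[i]) (M N : R) x :
  (forall e, rnorm (k e) <= rnorm (f e) + rnorm (g e)) ->
  (fiber_sum x f <= M%:E)%E -> (fiber_sum x g <= N%:E)%E ->
  (fiber_sum x k <= (M + N)%:E)%E.
Proof.
move=> kfg fM gN; rewrite EFinD; apply: le_trans (leeD fM gN).
rewrite /fiber_sum -esumD; try by move=> y _; rewrite lee_fin rnorm_ge0.
by apply: le_esum => y _; rewrite -EFinD lee_fin.
Qed.

(** A range fibre contains at most one unit, so the sum has at most one nonzero term. *)
Lemma fiber_sum_unit f (M : R) x : 0 <= M -> unit_supported f ->
  (forall e, rnorm (f e) <= M) -> (fiber_sum x f <= M%:E)%E.
Proof.
move=> M0 uf fM; apply: ge_ereal_sup => _ [A [finA Ax] <-].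
have [xA|xA] := pselect (A x /\ units x).
  rewrite -(@fsbig_widen _ _ _ _ [set x]).
  - by rewrite fsbig_set1 lee_fin.
  - by move=> _ ->; exact: xA.1.
  - move=> y [Ay nyx] /=; rewrite uf ?rnorm0// hsec => uy.
    by apply: nyx; rewrite /= -(Ax _ Ay) (rng_unit LG).
rewrite fsbig1 ?lee_fin// => y Ay; rewrite uf ?rnorm0// hsec => uy.
have yx : y = x by rewrite -(Ax _ Ay) (rng_unit LG).
by apply: xA; rewrite -yx.
Qed.

(** [x] runs over all of [G]: the range fibre over a non-unit is empty and its sums are 0. A real
    bound avoids arithmetic with the extended real [I_norm]. *)
Definition I_bounded f (M : R) := forall x,
  (fiber_sum x f <= M%:E)%E /\ (fiber_sum x (fstar f) <= M%:E)%E.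

Lemma I_norm_le f (M : R) : equivariant f -> I_bounded f M -> (I_norm sec f <= M%:E)%E.
Proof.
move=> ef fM; rewrite /I_norm ge_max; apply/andP; split.
  by apply: ge_ereal_sup => _ [x _ <-]; rewrite haar_eintE//; exact: (fM x).1.
by apply: ge_ereal_sup => _ [x _ <-]; rewrite haar_eint_srcE//; exact: (fM x).2.
Qed.

Lemma fiber_sum_nonunit x f : ~ units x -> fiber_sum x f = 0%E.
Proof.
move=> nx; have -> : fiber_sum x f = \esum_(y in set0) (rnorm (f (sec y)))%:E.
  congr (esum _ _); apply/seteqP; split => // y /= yx.
  by apply: nx; rewrite -yx; exact: units_rng.
exact: esum_set0.
Qed.

Lemma rnorm_fstar f e : rnorm (fstar f e) = rnorm (f (ginv e)).
Proof. by rewrite /fstar rnormJ. Qed.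

Lemma I_bounded_le (k f : E -> R[i]) (a M : R) : 0 <= a ->
  (forall e, rnorm (k e) <= a * rnorm (f e)) -> I_bounded f M -> I_bounded k (a * M).
Proof.
move=> a0 kf fM x; split; first exact: (fiber_sum_le a0 kf (fM x).1).
by apply: (fiber_sum_le a0 _ (fM x).2) => e; rewrite !rnorm_fstar.
Qed.

Lemma I_boundedD (k f g : E -> R[i]) (M N : R) :
  (forall e, rnorm (k e) <= rnorm (f e) + rnorm (g e)) ->
  I_bounded f M -> I_bounded g N -> I_bounded k (M + N).
Proof.
move=> kfg fM gN x; split; first exact: (fiber_sumD kfg (fM x).1 (gN x).1).
by apply: (fiber_sumD _ (fM x).2 (gN x).2) => e; rewrite !rnorm_fstar.
Qed.

Lemma units_proj_inv e : units (proj (ginv e)) <-> units (proj e).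
Proof.
rewrite (proj_inv T); split => ue; last by rewrite (inv_unit LG).
by rewrite -(ginvK LG (proj e)) (inv_unit LG ue).
Qed.

Lemma unit_supported_fstar f : unit_supported f -> unit_supported (fstar f).
Proof. by move=> uf e ne; rewrite /fstar uf ?conjc0// => /units_proj_inv. Qed.

Lemma I_bounded_unit f (M : R) : 0 <= M -> unit_supported f ->
  (forall e, rnorm (f e) <= M) -> I_bounded f M.
Proof.
move=> M0 uf fM x; split; first exact: fiber_sum_unit.
apply: fiber_sum_unit => //; first exact: unit_supported_fstar.
by move=> e; rewrite rnorm_fstar.
Qed.

End INorm.

Section C0Equivariant.
Variables (R : realType) (G : groupoid) (E : twist_data R G).
Hypotheses (hG : lch_groupoid G) (etG : etale G) (hE : is_twist E).
Let T := is_twist_algebraic hG hE.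
Let tG := base_topological hG.
Let tE := twist_topological hE.
Local Notation proj := (@twist_proj R G E).
Variable sec : G -> E.
Hypothesis hsec : cancel sec proj.
Local Notation conv := (convolution sec).
Local Notation S := (@Cc_equivariant R G E).
Implicit Types (f g h : E -> R[i]).

(** The function is bounded, and its support meets every range fibre in at most [n] points, with [n]
    independent of the fibre. The source sums are the range sums of [fstar f]. *)
Lemma Cc_I_bounded f : S f -> exists2 M : R, 0 <= M & I_bounded sec f M.
Proof.
have main g : S g -> exists2 M : R, 0 <= M & forall x, (fiber_sum sec x g <= M%:E)%E.
  move=> [Cg eg]; have [K [cK _ gK]] := Cc_elim Cg.
  have cn : {within K, continuous (fun e => rnorm (g e))}.
    apply: continuous_subspaceT; exact: (cont_comp Cg.1 (@rnorm_continuous R _)).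
  have [M M0 HM] := compact_normr_bounded cK cn.
  have gM e : rnorm (g e) <= M.
    have [->|ge] := eqVneq (g e) 0; first by rewrite rnorm0 ltW.
    by rewrite (le_trans (ler_norm _))// HM//; exact: gK.
  have [n Hn] := compact_fiber_bound tG etG (proj_compact hE cK).
  exists (n%:R * M); first by rewrite mulr_ge0// ltW.
  move=> x; have [s [sn Hs]] := Hn x.
  apply: ge_ereal_sup => _ [A [finA Ax] <-].
  pose B := [set` undup s].
  apply: (@le_trans _ _ (\sum_(y \in A `&` B) (rnorm (g (sec y)))%:E)%E).
    rewrite le_eqVlt; apply/orP; left; apply/eqP; apply: esym.
    apply: fsbig_widen; first by move=> y [].
    move=> y [Ay nB] /=; congr (_%:E); have [->|gy] := eqVneq (g (sec y)) 0; first exact: rnorm0.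
    exfalso; apply: nB; split => //; rewrite /B /= mem_undup; apply: Hs; last exact: Ax.
    by exists (sec y) => //; exact: gK.
  apply: (@le_trans _ _ (\sum_(y \in B) (rnorm (g (sec y)))%:E)%E).
    apply: lee_fsum_nneg_subset.
    - exact: finite_setIl.
    - exact: finite_seq.
    - by move=> y; rewrite !inE => -[].
    - by move=> y _; rewrite lee_fin rnorm_ge0.
  rewrite /B -(fsbig_seq _ _ (undup_uniq s)) sumEFin lee_fin.
  apply: (@le_trans _ _ (\sum_(y <- undup s) M)); first by apply: ler_sum.
  rewrite big_const_seq count_predT iter_addr_0 -[X in X <= _]mulr_natl.
  apply: ler_wpM2r; first exact: ltW.
  by rewrite ler_nat (leq_trans (size_undup s)).
move=> Sf; have [M M0 HM] := main _ Sf.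
have [N N0 HN] := main _ (Cc_equivariant_fstar hG hE Sf).
exists (M + N); first by rewrite addr_ge0.
move=> x; split; [apply: le_trans (HM x) _|apply: le_trans (HN x) _].
  by rewrite lee_fin lerDl.
by rewrite lee_fin lerDr.
Qed.

(** The error must vanish off the units so that [e] also bounds its I-norm. The functions
    approximable in this sense for every [e] form a *-algebra on which representations extend by
    continuity. *)
Definition near_Cc h (e : R) f := [/\ S f, unit_supported (fun d => h d - f d) &
  forall d, rnorm (h d - f d) <= e].

Definition C0_equivariant h := [/\ continuous h, equivariant h &
  forall e : R, 0 < e -> exists f, near_Cc h e f].

Lemma C0_Cc f : S f -> C0_equivariant f.
Proof.
move=> Sf; split; [exact: Sf.1.1|exact: Sf.2|].
move=> e e0; exists f; split => // d; first by rewrite subrr.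
by rewrite subrr rnorm0 ltW.
Qed.

Lemma near_Cc_lin (a : R[i]) h k (d e : R) f g : near_Cc h d f -> near_Cc k e g ->
  near_Cc (fun x => a * h x + k x) (complex.Re `|a| * d + e) (fun x => a * f x + g x).
Proof.
move=> [Sf uf fd] [Sg ug ge].
have E1 x : a * h x + k x - (a * f x + g x) = a * (h x - f x) + (k x - g x).
  by rewrite opprD addrACA mulrBr.
split.
- exact: (Cc_equivariant_subspace E).2.
- by move=> x nx; rewrite E1 uf// ug// mulr0 addr0.
- move=> x; rewrite E1 (le_trans (rnormD _ _))// rnormM lerD// ler_wpM2l//.
  exact: (@rnorm_ge0 _ R[i]).
Qed.

Lemma C0_lin (a : R[i]) h k : C0_equivariant h -> C0_equivariant k ->
  C0_equivariant (fun x => a * h x + k x).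
Proof.
move=> [ch eh Hh] [ck ek Hk]; split.
- exact: (ccontD (ccontZ ch) ck).
- exact: equivariant_lin.
- move=> e e0; pose A := complex.Re `|a|.
  have A0 : 0 <= A by exact: (@rnorm_ge0 _ R[i]).
  have d0 : 0 < e / (A + 1) by rewrite divr_gt0// ltr_wpDl.
  have [f Hf] := Hh _ d0; have [g Hg] := Hk _ d0.
  exists (fun x => a * f x + g x); have [Sfg ufg le] := near_Cc_lin a Hf Hg; split => // x.
  rewrite (le_trans (le x))// -/A -[X in _ + X]mul1r -mulrDl mulrCA mulfV ?mulr1//.
  by rewrite gt_eqF// ltr_wpDl.
Qed.

Lemma near_Cc_fstar h (e : R) f : near_Cc h e f -> near_Cc (fstar h) e (fstar f).
Proof.
move=> [Sf uf fe].
have E1 x : fstar h x - fstar f x = fstar (fun d => h d - f d) x by rewrite /fstar rmorphB.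
split; first exact: Cc_equivariant_fstar.
- by move=> x nx; rewrite E1 (unit_supported_fstar T uf).
- by move=> x; rewrite E1 rnorm_fstar.
Qed.

Lemma C0_fstar h : C0_equivariant h -> C0_equivariant (fstar h).
Proof.
move=> [ch eh Hh]; split; [exact: fstar_continuous|exact: equivariant_fstar|].
by move=> e /Hh[f Hf]; exists (fstar f); exact: near_Cc_fstar.
Qed.

Lemma Cc_conv_unitr f p : S f -> continuous p -> equivariant p -> unit_supported p -> S (conv f p).
Proof.
move=> Sf cp ep up.
have -> : conv f p = (fun e => f e * p (src e)).
  by apply/funext => e; rewrite (conv_unitr T hsec)//; exact: Sf.2.
split; first by apply: Cc_mul Sf.1; exact: (cont_comp (src_continuous tE) cp).
by move=> z e; rewrite Sf.2 (src_act T) mulrA.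
Qed.

Lemma Cc_conv_unitl f p : S f -> continuous p -> equivariant p -> unit_supported p -> S (conv p f).
Proof.
move=> Sf cp ep up.
have -> : conv p f = (fun e => f e * p (rng e)).
  by apply/funext => e; rewrite (conv_unitl T hsec) 1?mulrC//; exact: Sf.2.
split; first by apply: Cc_mul Sf.1; exact: (cont_comp (rng_continuous tE) cp).
by move=> z e; rewrite Sf.2 (rng_act T) mulrA.
Qed.

Lemma C0_fiber_finite h : C0_equivariant h -> fiber_finite sec h.
Proof.
move=> [ch eh /(_ 1 ltr01)[f [Sf uf _]]].
have -> : h = (fun e => 1 * f e + (h e - f e)) by apply/funext => e; rewrite mul1r addrC subrK.
apply: fiber_finite_lin.
- exact: (Cc_fiber_finite hG etG hE hsec Sf.1).
- exact: fiber_finite_unit.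
Qed.

Lemma C0_I_bounded h : C0_equivariant h -> exists2 M : R, 0 <= M & I_bounded sec h M.
Proof.
move=> [ch eh /(_ 1 ltr01)[f [Sf uf f1]]].
have [M M0 fM] := Cc_I_bounded Sf.
exists (M + 1); first by rewrite addr_ge0.
apply: (I_boundedD _ fM (I_bounded_unit T hsec ler01 uf f1)) => e.
by rewrite (le_trans _ (rnormD _ _))// addrC subrK.
Qed.

Lemma near_Cc_bounded h (e : R) f (M : R) : 0 <= e -> near_Cc h e f -> I_bounded sec h M -> I_bounded sec f (M + e).
Proof.
move=> e0 [Sf uf fe] hM.
apply: (I_boundedD _ hM (I_bounded_unit T hsec e0 uf fe)) => d.
by rewrite -(rnormN (h d - f d)) (le_trans _ (rnormD _ _))// opprB addrC subrK.
Qed.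

Lemma near_Cc_rest h (e : R) f : C0_equivariant h -> near_Cc h e f ->
  [/\ continuous (fun d => h d - f d), equivariant (fun d => h d - f d) & unit_supported (fun d => h d - f d)].
Proof.
move=> [ch eh _] [Sf uf _]; split; [exact: (ccontB ch Sf.1.1)| |exact: uf].
by move=> z d; rewrite eh Sf.2 mulrBr.
Qed.

Lemma conv_decompose h k f g (d e : R) x : C0_equivariant h -> C0_equivariant k ->
  near_Cc h d f -> near_Cc k e g ->
  conv h k x = conv f g x + conv f (fun y => k y - g y) x + conv (fun y => h y - f y) k x.
Proof.
move=> Dh Dk nf ng.
have [ch eh _] := Dh; have [ck ek _] := Dk.
have [cp ep up] := near_Cc_rest Dh nf; have [cq eq uq] := near_Cc_rest Dk ng.
have [Sf _ _] := nf; have [Sg _ _] := ng.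
have Ff : fiber_finite sec f by exact: (Cc_fiber_finite hG etG hE hsec Sf.1).
have Fp : fiber_finite sec (fun y => h y - f y) by exact: fiber_finite_unit.
have eh1 : h = (fun y => 1 * f y + (h y - f y)).
  by apply/funext => y; rewrite mul1r addrC subrK.
have ek1 : k = (fun y => 1 * g y + (k y - g y)).
  by apply/funext => y; rewrite mul1r addrC subrK.
have E1 : conv h k x = 1 * conv f k x + conv (fun y => h y - f y) k x.
  rewrite {1}eh1; apply: (conv_linl T hsec) Ff Fp => //; exact: Sf.2.
have E2 : conv f k x = 1 * conv f g x + conv f (fun y => k y - g y) x.
  rewrite {1}ek1; apply: (conv_linr T hsec) Ff => //; [exact: Sf.2|exact: Sg.2].
by rewrite E1 E2 !mul1r.
Qed.

Lemma C0_conv h k : C0_equivariant h -> C0_equivariant k -> C0_equivariant (conv h k).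
Proof.
move=> Dh Dk; have [ch eh Hh] := Dh; have [ck ek Hk] := Dk.
have [g ng] := Hk 1 ltr01; have [cq eq uq] := near_Cc_rest Dk ng.
have [Sg _ g1] := ng.
split; last 1 first.
(* With [p = h - f] and [q = k - g], the terms built from [f g], [f q] and [p g] have compact
   support. Only [p q] is left out; it lives over the units and is at most [e] there, so [g] may
   stay at distance 1 from [k]. *)
- move=> e e0; have [f nf] := Hh e e0.
  have [cp ep up] := near_Cc_rest Dh nf; have [Sf _ fe] := nf.
  have e1 (x : E) : conv (fun y => h y - f y) k x = conv (fun y => h y - f y) g x + (h (rng x) - f (rng x)) * (k x - g x).
    rewrite !(conv_unitl T hsec)//; last exact: Sg.2.
    by rewrite -mulrDr [X in _ = _ * X]addrC subrK.
  have e2 (x : E) : conv h k x - (1 * (1 * conv f g x + conv f (fun y => k y - g y) x) + conv (fun y => h y - f y) g x) = (h (rng x) - f (rng x)) * (k x - g x).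
    by rewrite (conv_decompose x Dh Dk nf ng) e1; ring.
  exists (fun x => 1 * (1 * conv f g x + conv f (fun y => k y - g y) x) + conv (fun y => h y - f y) g x).
  split.
  + apply: (Cc_equivariant_subspace E).2; last exact: (Cc_conv_unitl Sg cp ep up).
    by apply: (Cc_equivariant_subspace E).2; [exact: (Cc_equivariant_conv hG etG hE hsec Sf Sg)|exact: (Cc_conv_unitr Sf cq eq uq)].
  + by move=> x nx; rewrite e2 uq// mulr0.
  + move=> x; rewrite e2.
    by rewrite rnormM -[leRHS]mulr1 ler_pM ?rnorm_ge0.
- have [f nf] := Hh 1 ltr01.
  have [cp ep up] := near_Cc_rest Dh nf; have [Sf _ fe] := nf.
  have -> : conv h k = (fun x => conv f g x + conv f (fun y => k y - g y) x + k x * (h (rng x) - f (rng x))).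
    apply/funext => x; rewrite (conv_decompose x Dh Dk nf ng); congr (_ + _).
    by rewrite (conv_unitl T hsec)// mulrC.
  apply: (ccontD (ccontD (Cc_equivariant_conv hG etG hE hsec Sf Sg).1.1 (Cc_conv_unitr Sf cq eq uq).1.1)).
  exact: (ccontM ck (cont_comp (rng_continuous tE) cp)).
- exact: (equivariant_conv T hsec).
Qed.

(* The only error terms are products with functions supported on units, for
   which convolution is pointwise. *)
Lemma conv_near_bound h k f g q (e M N : R) : 0 < e -> C0_equivariant h -> C0_equivariant k ->
  near_Cc h e f -> near_Cc k e g -> near_Cc (conv h k) e q ->
  I_bounded sec h M -> I_bounded sec k N ->
  I_bounded sec (fun x => q x - conv f g x) (e * (1 + (M + e) + N)).
Proof.
move=> e0 Dh Dk nf ng nq hM kN.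
have [ch eh _] := Dh; have [ck ek _] := Dk.
have [cp ep up] := near_Cc_rest Dh nf; have [cq eq uq] := near_Cc_rest Dk ng.
have [Sf _ fe] := nf; have [Sg _ ge] := ng; have [Sq uqq qe] := nq.
have fM := near_Cc_bounded (ltW e0) nf hM.
have b1 : I_bounded sec (fun x => conv h k x - q x) e by exact: (I_bounded_unit T hsec (ltW e0)).
have b2 : I_bounded sec (conv f (fun y => k y - g y)) (e * (M + e)).
  apply: I_bounded_le fM; first exact: ltW.
  by move=> x; rewrite (conv_unitr T hsec)//; [rewrite rnormM mulrC ler_wpM2r ?rnorm_ge0|exact: Sf.2].
have b3 : I_bounded sec (conv (fun y => h y - f y) k) (e * N).
  apply: I_bounded_le kN; first exact: ltW.
  by move=> x; rewrite (conv_unitl T hsec)// rnormM ler_wpM2r ?rnorm_ge0.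
have -> : e * (1 + (M + e) + N) = e + (e * (M + e) + e * N) by ring.
pose r (x : E) : R[i] := conv f (fun y => k y - g y) x + conv (fun y => h y - f y) k x.
have b4 : I_bounded sec r (e * (M + e) + e * N).
  by apply: I_boundedD b2 b3 => x; exact: rnormD.
suff kb : forall x, rnorm (q x - conv f g x) <= rnorm (conv h k x - q x) + rnorm (r x).
  exact: (I_boundedD kb b1 b4).
move=> x.
rewrite (rnormB (conv h k x)) (le_trans _ (rnormD _ _))//.
have -> : q x - conv f g x = q x - conv h k x + r x; last by [].
by rewrite (conv_decompose x Dh Dk nf ng) /r; ring.
Qed.

End C0Equivariant.

Section Embeddings.
Variables (X Y : topologicalType) (f : X -> Y).

(** A filter on the preimage is pushed forward to [Q]; its cluster point lies in the range of [f],
    and openness of [f] makes the preimage of that point a cluster point. *)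
Lemma open_embedding_compact (Q : set Y) : injective f ->
  (forall U, open U -> open (f @` U)) -> compact Q -> Q `<=` range f -> compact (f @^-1` Q).
Proof.
move=> fi fo cQ Qf F FF FQ.
have FFf : ProperFilter (f @ F) by exact: fmap_proper_filter.
have [y [Qy cly]] := cQ (f @ F) FFf FQ.
have [x _ xy] := Qf y Qy; exists x; split; first by rewrite /preimage /= xy.
move=> A B FA nB.
have FA' : (f @ F) (f @` A) by apply: (filterS (P := A)) FA => a Aa; exists a.
have nB' : nbhs y (f @` B).
  have oB : open (f @` B°) by apply: fo; exact: open_interior.
  rewrite -xy; apply: (filterS (P := f @` B°)).
    by move=> _ [b Bb <-]; exists b => //; exact: interior_subset.
  by apply: open_nbhs_nbhs; split => //; exists x.
have [_ [[a Aa <-] [b Bb /fi ba]]] := cly _ _ FA' nB'.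
by exists a; split => //; rewrite -ba.
Qed.

End Embeddings.

Lemma cont_clopen (X Y : topologicalType) (A : set X) (f g : X -> Y) :
  open A -> closed A -> continuous f -> continuous g ->
  continuous (fun x => if `[< A x >] then f x else g x).
Proof.
move=> oA cA cf cg x; have [Ax|nAx] := pselect (A x).
  apply: (@cvg_trans _ (f y @[y --> x])); last by rewrite (asboolT Ax); exact: cf.
  apply: near_eq_cvg; have : nbhs x A by exact: open_nbhs_nbhs.
  by apply: filterS => y Ay; rewrite (asboolT Ay).
apply: (@cvg_trans _ (g y @[y --> x])); last by rewrite (asboolF nAx); exact: cg.
apply: near_eq_cvg; have : nbhs x (~` A) by apply: open_nbhs_nbhs; split => //; exact: closed_openC.
by apply: filterS => y nAy; rewrite (asboolF nAy).
Qed.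

Section Shrink.
Variable R : realType.
Implicit Types (w : R[i]) (e : R).

(* Radial truncation of the complex plane: it sends the disc of radius [e] to
   [0] and moves every point by at most [e]. *)
Definition shrink e w : R[i] := (Num.max (rnorm w - e) 0 / Num.max (rnorm w) e)%:C * w.

Lemma shrink_continuous e : 0 < e -> continuous (shrink e).
Proof.
move=> e0.
have cm (c : R) : continuous (fun w : R[i] => Num.max (rnorm w - c) 0).
  have -> : (fun w : R[i] => Num.max (rnorm w - c) 0) = (fun w => (rnorm w - c + `|rnorm w - c|) / 2).
    apply/funext => w; have [h|h] := leP 0 (rnorm w - c).
      by rewrite ger0_norm//; lra.
    by rewrite ltr0_norm// subrr mul0r.
  have c1 : continuous (fun w : R[i] => rnorm w - c) by exact: (contB (@rnorm_continuous R R[i]) (@cont_cst R[i] R c)).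
  exact: (contM (contD c1 (cont_comp c1 (@norm_continuous _ _))) (@cont_cst R[i] R 2^-1)).
have cM : continuous (fun w : R[i] => Num.max (rnorm w) e).
  have -> : (fun w : R[i] => Num.max (rnorm w) e) = (fun w => Num.max (rnorm w - e) 0 + e).
    apply/funext => w; have [h|h] := leP (rnorm w) e.
      by rewrite max_r ?add0r// subr_le0.
    by rewrite max_l ?subrK// subr_ge0 ltW.
  exact: (contD (cm e) (@cont_cst R[i] R e)).
have M0 w : Num.max (rnorm w) e != 0 by rewrite gt_eqF// lt_max e0 orbT.
have cq : continuous (fun w : R[i] => Num.max (rnorm w - e) 0 / Num.max (rnorm w) e).
  apply: (contM (cm e)) => w; have Fw := nbhs_filter w.
  by apply: (@cvgV R R[i] (nbhs w) Fw) => //; exact: cM.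
have cqC : continuous (fun w : R[i] => (Num.max (rnorm w - e) 0 / Num.max (rnorm w) e)%:C).
  move=> w; apply: (@cvg_complex R R[i] (nbhs w) (nbhs_filter w)); first exact: cq.
  exact: (@cont_cst R[i] R 0 w).
apply: (ccontM cqC) => w; exact: cvg_id.
Qed.

Lemma shrinkZ e (z : circle R) w : shrink e (val z * w) = val z * shrink e w.
Proof. by rewrite /shrink rnormM rnorm_circle mul1r mulrCA. Qed.

Lemma shrink0 e w : rnorm w <= e -> shrink e w = 0.
Proof. by move=> we; rewrite /shrink max_r ?subr_le0// mul0r mul0r. Qed.

Lemma shrink_dist e w : 0 < e -> rnorm (w - shrink e w) <= e.
Proof.
move=> e0; have [we|we] := leP (rnorm w) e; first by rewrite shrink0// subr0.
have w0 : 0 < rnorm w by exact: lt_trans we.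
rewrite /shrink max_l ?subr_ge0 1?(ltW we)// max_l 1?(ltW we)//.
rewrite -{1}(mul1r w) -mulrBl rnormM.
have -> : 1 - ((rnorm w - e) / rnorm w)%:C = (e / rnorm w)%:C :> R[i].
  rewrite -[1]/(1%:C) -rmorphB /=; congr (_%:C); rewrite mulrBl divff ?gt_eqF//.
  by rewrite opprB addrC subrK.
by rewrite rnormR ger0_norm ?divr_ge0 ?divfK ?gt_eqF// ltW.
Qed.

End Shrink.

Section C0Intro.
Variables (R : realType) (G : groupoid) (E : twist_data R G).
Hypotheses (hG : lch_groupoid G) (etG : etale G) (hE : is_twist E).
Let T := is_twist_algebraic hG hE.
Local Notation proj := (@twist_proj R G E).

(** [h] is truncated by [shrink] over the units only. Those form a clopen part of [E], so the result
    is continuous and the error lives over the units; elsewhere the support of [h] is already inside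
    [K]. *)
Lemma C0_intro (h : E -> R[i]) : continuous h -> equivariant h ->
  (forall e : R, 0 < e -> exists2 K : set E, compact K &
    forall d, h d != 0 -> K d \/ (units (proj d) /\ rnorm (h d) < e)) ->
  C0_equivariant h.
Proof.
move=> ch eh Hh; split; [exact: ch|exact: eh|] => e e0.
pose A := proj @^-1` @units G.
pose f d := if `[< A d >] then shrink e (h d) else h d.
have cf : continuous f.
  apply: cont_clopen; [exact: (proj_units_open hG etG hE)|exact: (proj_units_closed hG hE)| |exact: ch].
  exact: (cont_comp ch (shrink_continuous e0)).
have [K cK HK] := Hh e e0.
exists f; split.
- split.
    apply: (Cc_introE hE cf cK) => d fd.
    have hd : h d != 0.
      apply: contraNneq fd => hd; rewrite /f hd; case: ifP => // _.
      by rewrite shrink0// rnorm0 ltW.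
    have [//|[ud small]] := HK d hd.
    by move: fd; rewrite /f (asboolT (ud : A d)) shrink0 ?eqxx// ltW.
  move=> z d; rewrite /f /A /preimage /= (proj_act T) eh; case: ifP => // _.
  exact: shrinkZ.
- by move=> d nd; rewrite /f (asboolF (nd : ~ A d)) subrr.
- move=> d; rewrite /f; case: ifP => _; last by rewrite subrr rnorm0 ltW.
  exact: shrink_dist.
Qed.

End C0Intro.

Section UnitPhase.
Variables (R : realType) (G : groupoid) (E : twist_data R G).
Hypothesis T : algebraic_twist E.
Let LE := at_total T.
Local Notation iota := (twist_iota E).
Local Notation proj := (@twist_proj R G E).

(* The unit of the convolution algebra when the unit space is compact. *)
Definition unit_phase (e : E) : R[i] :=
  if `[< units (twist_proj e) >] then val (xget (circle_one R) [set z | e = twist_iota E (twist_proj e) z]) else 0.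

Lemma unit_phase_iota u z : units u -> unit_phase (iota u z) = val z.
Proof.
move=> uu; rewrite /unit_phase (proj_iota T)// asboolT//; congr (val _).
have : [set z0 | iota u z = iota u z0] (xget (circle_one R) [set z0 | iota u z = iota u z0]).
  by apply: (@xgetPex _ _ [set z0 | iota u z = iota u z0]); exists z.
by move=> /= /(iota_inj T uu uu)[].
Qed.

Lemma unit_phase_supported : unit_supported unit_phase.
Proof. by move=> e ne; rewrite /unit_phase asboolF. Qed.

Lemma equivariant_unit_phase : equivariant unit_phase.
Proof.
move=> z e; have [/(iota_surj T)[u [w [uu ->]]]|ne] := pselect (units (proj e)).
  by rewrite (act_iota T)// !unit_phase_iota.
by rewrite !unit_phase_supported ?(proj_act T)// mulr0.
Qed.

Lemma fstar_unit_phase : fstar unit_phase = unit_phase.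
Proof.
apply/funext => e; rewrite /fstar.
have [/(iota_surj T)[u [w [uu ->]]]|ne] := pselect (units (proj e)); last first.
  by rewrite !unit_phase_supported ?conjc0// => /(units_proj_inv T).
have -> : ginv (iota u w) = iota u (circle_inv w).
  rewrite (iota_act T w uu) (ginv_act T) (inv_unit LE); last exact: (iota1_unit T).
  by rewrite -(iota_act T).
by rewrite (unit_phase_iota w uu) (unit_phase_iota (circle_inv w) uu) /= -conj_circle conjcK.
Qed.

Lemma unit_phase_unit e : units e -> unit_phase e = 1.
Proof. by move=> ue; rewrite -(at_iota_unit T ue) unit_phase_iota//; exact: proj_unit. Qed.

Variable sec : G -> E.
Hypothesis hsec : cancel sec proj.

Lemma conv_phase_l f : equivariant f -> convolution sec unit_phase f = f.
Proof.
move=> ef; apply/funext => e.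
rewrite (conv_unitl T hsec)//; [|exact: equivariant_unit_phase|exact: unit_phase_supported].
by rewrite unit_phase_unit ?mul1r//; exact: units_rng.
Qed.

Lemma conv_phase_r f : equivariant f -> convolution sec f unit_phase = f.
Proof.
move=> ef; apply/funext => e.
rewrite (conv_unitr T hsec)//; [|exact: equivariant_unit_phase|exact: unit_phase_supported].
by rewrite unit_phase_unit ?mulr1//; exact: units_src.
Qed.

Lemma rnorm_unit_phase e : rnorm (unit_phase e) <= 1.
Proof.
rewrite /unit_phase; case: ifP => _; last by rewrite rnorm0.
by rewrite rnorm_circle.
Qed.

End UnitPhase.

(** * The Alexandrov twist *)

Lemma open_setX (X Y : topologicalType) (A : set X) (B : set Y) :
  open A -> open B -> open (A `*` B).
Proof.
move=> oA oB; have -> : A `*` B = (fst @^-1` A) `&` (snd @^-1` B) by [].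
by apply: openI; [apply: cont_open_preimage oA; exact: cont_fst|apply: cont_open_preimage oB; exact: cont_snd].
Qed.

Section AlexandrovTopology.
Variables (R : realType) (G : groupoid) (E : twist_data R G).
Hypotheses (hG : lch_groupoid G) (etG : etale G) (hE : is_twist E).
Let T := is_twist_algebraic hG hE.
Local Notation iota := (twist_iota E).
Local Notation proj := (@twist_proj R G E).
Local Notation E' := (alex_twist E).
Local Notation opc := (unit_space_plus G).
Local Notation inlE := (inl : E -> E').
Implicit Types (V : set (opc * circle R)).

(** The chart at infinity: an open embedding of a compact space whose image, together with that of
    [E], covers the Alexandrov twist. *)
Definition plus_iota (p : opc * circle R) : E' := alex_iota E (alex_unit p.1) p.2.

Lemma alex_base_open (B : set E') : alex_twist_base (E := E) B -> open B.
Proof.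
move=> bB; exists [set B]; last by rewrite bigcup_set1.
by move=> _ ->; exact: finI_from1.
Qed.

Lemma alex_continuous (X : topologicalType) (f : X -> E') :
  (forall B, alex_twist_base (E := E) B -> open (f @^-1` B)) -> continuous f.
Proof.
move=> H; apply/continuousP => A [D sD <-]; rewrite preimage_bigcup; apply: bigcup_open => B DB.
have [F sF <-] := sD B DB; rewrite preimage_bigcap openE => x Bx.
apply: filter_bigI => i iF; apply: open_nbhs_nbhs; split; last exact: Bx.
by apply: H; have := sF _ iF; rewrite in_setE.
Qed.

Lemma inl_open (U : set E) : open U -> open (inlE @` U).
Proof. by move=> oU; apply: alex_base_open; left; right; exists U. Qed.

Lemma plus_iota_open V : open V -> open (plus_iota @` V).
Proof. by move=> oV; apply: alex_base_open; right; exists V. Qed.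

Lemma inl_inj : injective inlE. Proof. by move=> d e []. Qed.

Lemma plus_iota_inj : injective plus_iota.
Proof.
move=> [[v|] w] [[v'|] w'] //=; rewrite /plus_iota /=; last by move=> [->].
move=> /inl_inj /(iota_inj T (set_valP v) (set_valP v'))[vv ->].
by congr (Some _, _); exact: val_inj.
Qed.

Lemma unit_val_continuous : continuous (set_val : unit_space G -> G).
Proof. exact: initial_continuous. Qed.

Lemma unit_val_open (U : set (unit_space G)) : open U -> open (set_val @` U).
Proof.
move=> [W oW <-]; have -> : [set set_val v | v in (set_val : unit_space G -> G) @^-1` W] = @units G `&` W.
  apply/seteqP; split => [_ [v Wv <-]|x [ux Wx]]; first by split; [exact: set_valP|].
  by exists (exist _ x (mem_set ux)).
exact: openI (units_open (base_topological hG) etG) oW.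
Qed.

Lemma unit_iota_continuous :
  continuous (fun p : unit_space G * circle R => iota (set_val p.1) p.2).
Proof.
have c1 : continuous (fun p : unit_space G * circle R => (set_val p.1, p.2)).
  exact: (cont_pair (cont_comp (@cont_fst _ _) unit_val_continuous) (@cont_snd _ _)).
by apply: (within_comp (iota_continuous hE) c1) => p; split => //; exact: set_valP.
Qed.

(** Only the sets [plus_iota V] need an argument. They meet [E] in the image under [iota] of an open
    set, which is open because [iota] is a homeomorphism onto the open part of [E] over the
    units. *)
Lemma inl_continuous : continuous inlE.
Proof.
apply: alex_continuous => B [[->|[U oU <-]]|[V oV <-]].
- by rewrite preimage_setT; exact: openT.
- have -> // : inlE @^-1` (inlE @` U) = U.
  by apply/seteqP; split => [e [d Ud /inl_inj <-]|e Ue] //; exists e.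
rewrite openE => e [[[v|] z] // Vvz /inl_inj ez].
have [[P Q] [nP nQ] sV] : nbhs (Some v : opc, z) V by exact: open_nbhs_nbhs.
have oP : open (set_val @` (Some @^-1` P)° ) by apply: unit_val_open; exact: open_interior.
have [_ _ /(_ ((set_val @` (Some @^-1` P)°) `*` Q°))] := iota_homeo hE.
case; first by apply: open_setX => //; exact: open_interior.
move=> W oW Wi; have uv := set_valP v.
have We : W e.
  suff : (proj @^-1` @units G `&` W) e by case.
  rewrite -Wi -ez; exists (set_val v, z) => //; split; first by split.
  split; last exact: nbhs_singleton (nbhs_interior nQ).
  by exists v => //; apply: nbhs_singleton; apply: nbhs_interior; exact: nP.
have : nbhs e (proj @^-1` @units G `&` W).
  apply: open_nbhs_nbhs; split; first exact: openI (proj_units_open hG etG hE) oW.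
  by split => //; rewrite /preimage /= -ez (proj_iota T).
apply: filterS => d; rewrite -Wi => -[[x w] [_ [/= [v' Pv' <-] Qw]] <-].
exists (Some v', w) => //; apply: sV; split; first exact: (interior_subset Pv').
exact: interior_subset.
Qed.

Lemma plus_iota_continuous : continuous plus_iota.
Proof.
apply: alex_continuous => B [[->|[U oU <-]]|[V oV <-]].
- by rewrite preimage_setT; exact: openT.
- rewrite openE => -[[v|] z] [e Ue] //; rewrite /plus_iota /= => /inl_inj eU.
  have : nbhs (v, z) (fun p : unit_space G * circle R => U (iota (set_val p.1) p.2)).
    apply: unit_iota_continuous; apply: open_nbhs_nbhs; split => //=.
    by rewrite -eU.
  move=> [[P Q] [nP nQ] sU].
  exists (Some @` P, Q); first by split => //; exact: one_point_compactification_some_nbhs.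
  move=> [x w] [/= [v' Pv' <-] Qw]; exists (iota (set_val v') w) => //.
  exact: (sU (v', w)).
- have -> // : plus_iota @^-1` (plus_iota @` V) = V.
  by apply/seteqP; split => [p [q Vq /plus_iota_inj <-]|p Vp] //; exists p.
Qed.

Lemma plus_iota_compact : compact (range plus_iota).
Proof.
apply: continuous_compact; first exact: continuous_subspaceT plus_iota_continuous.
by rewrite -setXTT; apply: compact_setX; [exact: one_point_compactification_compact|exact: circle_compact].
Qed.

Lemma plus_iota_rangeC : ~` range plus_iota = inlE @` (~` (proj @^-1` @units G)).
Proof.
apply/seteqP; split => [[e|z] ne|_ [e ne <-] [[[v|] z] _]] //=.
- exists e => //= /(iota_surj T)[x [z [ux ez]]]; apply: ne.
  by exists (Some (exist _ x (mem_set ux)), z) => //=; rewrite /plus_iota /= ez.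
- by exfalso; apply: ne; exists (None, z).
- rewrite /plus_iota /= => /inl_inj ez; apply: ne.
  by rewrite /preimage /= -ez (proj_iota T); exact: set_valP.
Qed.

Lemma plus_iota_range_closed : closed (range plus_iota).
Proof.
rewrite -openC plus_iota_rangeC; apply: inl_open.
by apply: closed_openC; exact: (proj_units_closed hG hE).
Qed.

Lemma inl_image_compact (K : set E) : compact K -> compact (inlE @` K).
Proof.
by move=> cK; apply: continuous_compact cK; exact: continuous_subspaceT inl_continuous.
Qed.

(* Away from a compact part of [E], only the points at infinity and units close
   to infinity remain. *)
Lemma nbhs_infinity_avoid (K : set E) z : compact K ->
  \forall p \near (inr z : E'), ~ (inlE @` K) p.
Proof.
move=> cK; set Q := proj @` (K `&` proj @^-1` @units G).
have cQ : compact Q.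
  apply: (proj_compact hE).
  by apply: compact_closedI => //; exact: (proj_units_closed hG hE).
have cC : compact (set_val @^-1` Q : set (unit_space G)).
  apply: (open_embedding_compact _ unit_val_open cQ); first exact: val_inj.
  by move=> _ [e [_ ue] <-]; exists (exist _ (proj e) (mem_set (ue : @units G (proj e)))).
have clC : closed (set_val @^-1` Q : set (unit_space G)).
  apply: cont_closed_preimage unit_val_continuous _.
  exact: compact_closed (base_hausdorff hG) cQ.
set N := Some @` (~` (set_val @^-1` Q)) `|` [set None] : set opc.
have nN : nbhs (None : opc) N by exists (set_val @^-1` Q).
have : nbhs (inr z : E') (plus_iota @` (N° `*` setT)).
  apply: open_nbhs_nbhs; split.
    by apply: plus_iota_open; apply: open_setX; [exact: open_interior|exact: openT].
  by exists (None, z) => //; split => //; exact: nbhs_singleton (nbhs_interior nN).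
apply: filterS => _ [[x w] [/interior_subset Nx _] <-] [e Ke].
case: Nx => [[v nQv /= <-]|/= ->] //; rewrite /plus_iota /= => /inl_inj ew.
apply: nQv; exists e; last by rewrite ew (proj_iota T)//; exact: set_valP.
by split => //; rewrite /preimage /= ew (proj_iota T); exact: set_valP.
Qed.

Lemma inl_image_closed (K : set E) : compact K -> closed (inlE @` K).
Proof.
move=> cK; rewrite -openC openE => -[e|z] nK; last exact: nbhs_infinity_avoid.
have oK : open (~` K) by apply: closed_openC; exact: compact_closed (twist_hausdorff hE) cK.
have : nbhs (inlE e) (inlE @` (~` K)).
  apply: open_nbhs_nbhs; split; first exact: inl_open.
  by exists e => //= Ke; apply: nK; exists e.
by apply: filterS => _ [d nKd <-] [d' Kd' /inl_inj dd]; apply: nKd; rewrite -dd.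
Qed.

(** Removing from the support the open set of orbits over [N], which contains every point at
    infinity, leaves a compact set inside [E]. *)
Lemma Cc_support_alex (F : E' -> R[i]) (N : set opc) : Cc F -> open N -> N None ->
  exists2 K : set E, compact K & forall e, F (inl e) != 0 ->
    K e \/ exists v z, N (Some v) /\ e = iota (set_val v) z.
Proof.
move=> CF oN NN; have [K' [cK' clK' FK']] := Cc_elim CF.
set W := plus_iota @` (N `*` setT).
have oW : open W by apply: plus_iota_open; apply: open_setX => //; exact: openT.
exists (inlE @^-1` (K' `\` W)).
  apply: (open_embedding_compact inl_inj inl_open).
    by apply: compact_closedI => //; exact: open_closedC.
  move=> [e|z] [_ nW]; first by exists e.
  by exfalso; apply: nW; exists (None, z).
move=> e /FK' K'e; have [We|nWe] := pselect (W (inl e)); last by left.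
right; case: We => [[[v|] z] [Nv _]] //; rewrite /plus_iota /= => /inl_inj ez.
by exists v, z; split.
Qed.

End AlexandrovTopology.

Section AlexandrovFunctions.
Variables (R : realType) (G : groupoid) (E : twist_data R G).
Hypotheses (hG : lch_groupoid G) (etG : etale G) (hE : is_twist E).
Let T := is_twist_algebraic hG hE.
Let T' := alex_algebraic_twist T.
Local Notation iota := (twist_iota E).
Local Notation proj := (@twist_proj R G E).
Local Notation act := (@circle_act R G E).
Local Notation E' := (alex_twist E).
Local Notation act' := (@circle_act R (alex_groupoid G) E').
Local Notation opc := (unit_space_plus G).
Local Notation inlE := (inl : E -> E').
Local Notation plus_iota := (plus_iota E).

Lemma act_inl z (e : E) : act' z (inl e) = inl (act z e).
Proof. by []. Qed.

Lemma act_inr z w : act' z (inr w) = inr (circle_mul z w).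
Proof. by []. Qed.

Lemma act_plus_iota z p : act' z (plus_iota p) = plus_iota (p.1, circle_mul z p.2).
Proof.
case: p => -[v|] w //=; rewrite /plus_iota /= act_inl (act_iota T)//.
exact: set_valP.
Qed.

Lemma act_alex_continuous : continuous (fun p : circle R * E' => act' p.1 p.2).
Proof.
move=> [z [e|w]]; rewrite /= => A nA.
  have c2 : continuous (fun q : circle R * E => inlE (act q.1 q.2)).
    exact: (cont_comp (act_continuous hG hE) (inl_continuous hG etG hE)).
  have : nbhs (z, e) (fun q : circle R * E => A (inl (act q.1 q.2))) by exact: (c2 (z, e) A nA).
  move=> [[P Q] [nP nQ] sA]; exists (P, inlE @` Q°).
    split => //; apply: open_nbhs_nbhs; split.
      by apply: inl_open; exact: open_interior.
    by exists e => //; exact: nbhs_singleton (nbhs_interior nQ).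
  by move=> [z' _] [/= Pz [d /interior_subset Qd <-]]; exact: (sA (z', d)).
have c1 : continuous (fun q : circle R * (opc * circle R) => plus_iota (q.2.1, circle_mul q.1 q.2.2)).
  have c2 : continuous (fun q : circle R * (opc * circle R) => (q.1, q.2.2)).
    exact: (cont_pair (@cont_fst _ _) (cont_comp (@cont_snd _ _) (@cont_snd _ _))).
  have c3 : continuous (fun q : circle R * (opc * circle R) => (q.2.1, circle_mul q.1 q.2.2)).
    apply: cont_pair; first exact: (cont_comp (@cont_snd _ _) (@cont_fst _ _)).
    exact: (cont_comp c2 (@circle_mul_continuous R)).
  exact: (cont_comp c3 (plus_iota_continuous hG hE)).
have : nbhs (z, (None : opc, w)) (fun q => A (plus_iota (q.2.1, circle_mul q.1 q.2.2))) by exact: (c1 (z, (None : opc, w)) A nA).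
move=> [[P Q] [nP nQ] sA]; exists (P, plus_iota @` Q°).
  split => //; apply: open_nbhs_nbhs; split.
    by apply: plus_iota_open; exact: open_interior.
  by exists (None, w) => //; exact: nbhs_singleton (nbhs_interior nQ).
move=> [z' _] [/= Pz [q /interior_subset Qq <-]]; rewrite act_plus_iota.
exact: (sA (z', q)).
Qed.

Definition extend (f : E -> R[i]) (p : E') : R[i] := if p is inl e then f e else 0.

Lemma Cc_extend f : Cc f -> Cc (extend f).
Proof.
move=> Cf; have [K [cK _ fK]] := Cc_elim Cf; apply: (@Cc_intro _ _ E' _ (inlE @` K)).
- move=> [e|z] A nA.
    have : nbhs (inl e : E') (inlE @` (f @^-1` A)°).
      apply: open_nbhs_nbhs; split; first by apply: inl_open; exact: open_interior.
      by exists e => //; apply: nbhs_singleton; apply: nbhs_interior; exact: (Cf.1 e).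
    by apply: filterS => _ [d /interior_subset Ad <-].
  apply: filterS (nbhs_infinity_avoid hG etG hE z cK) => p nKp.
  rewrite /preimage /=; have -> : extend f p = 0; last exact: nbhs_singleton nA.
  case: p nKp => //= e nKe; apply/eqP/negP => /negP /fK Ke; apply: nKe.
  by exists e.
- exact: (inl_image_compact hG etG hE).
- exact: (inl_image_closed hG etG hE).
- by move=> [e /fK Ke|z]; [exists e|rewrite /= eqxx].
Qed.

Lemma Cc_equivariant_extend f : Cc_equivariant f -> Cc_equivariant (extend f).
Proof.
move=> [Cf ef]; split; first exact: Cc_extend.
by move=> z [e|w] /=; rewrite ?mulr0// -ef.
Qed.

Lemma extend_lin (a : R[i]) f g : extend (fun e => a * f e + g e) = (fun p => a * extend f p + extend g p).
Proof. by apply/funext => -[e|z] //=; rewrite mulr0 addr0. Qed.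

Lemma extend_fstar f : extend (fstar f) = fstar (extend f).
Proof. by apply/funext => -[e|z] //; apply/esym; exact: conjc0. Qed.

Lemma unit_phase_inl e : unit_phase (inl e : E') = unit_phase e.
Proof.
have [/(iota_surj T)[u [w [uu ->]]]|ne] := pselect (units (proj e)).
  have ux : @units (alex_groupoid G) (Some u) by apply/alex_units.
  by rewrite (unit_phase_iota T)// -(unit_phase_iota T' w ux).
rewrite (unit_phase_supported ne) unit_phase_supported// => ux; apply: ne.
by have /alex_units := ux.
Qed.

Lemma unit_phase_inr z : unit_phase (inr z : E') = val z.
Proof.
have ux : @units (alex_groupoid G) None by apply/alex_units.
by rewrite -(unit_phase_iota T' z ux).
Qed.

Lemma unit_phase_plus_iota p : unit_phase (plus_iota p) = val p.2.
Proof.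
have ux : @units (alex_groupoid G) (alex_unit p.1).
  by apply/alex_units; case: p.1 => //= v; exact: set_valP.
exact: (unit_phase_iota T').
Qed.

(** The support is the range of [plus_iota], compact because the unit space has been compactified.
    This range is clopen, so continuity is checked on it and off it separately. *)
Lemma Cc_unit_phase : Cc_equivariant (unit_phase (E := E')).
Proof.
split; last exact: (equivariant_unit_phase T').
apply: (@Cc_intro _ _ E' _ (range plus_iota)).
- move=> p A nA; have [[[x w] _ xp]|np] := pselect (range plus_iota p).
    have nB : nbhs w ((val : circle R -> R[i]) @^-1` A).
      by apply: val_circle_continuous; move: nA; rewrite -xp unit_phase_plus_iota.
    have : nbhs p (plus_iota @` (setT `*` ((val : circle R -> R[i]) @^-1` A)°)).
      apply: open_nbhs_nbhs; split.
        by apply: plus_iota_open; apply: open_setX; [exact: openT|exact: open_interior].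
      by exists (x, w) => //; split => //; exact: nbhs_singleton (nbhs_interior nB).
    apply: filterS => _ [[y z] [_ /interior_subset Az] <-].
    by rewrite /preimage /= unit_phase_plus_iota.
  have : nbhs p (~` range plus_iota).
    by apply: open_nbhs_nbhs; split => //; apply: closed_openC; exact: (plus_iota_range_closed hG hE).
  have z0 q : (~` range plus_iota) q -> unit_phase q = 0.
    rewrite plus_iota_rangeC// => -[e ne <-]; rewrite unit_phase_inl.
    exact: unit_phase_supported.
  apply: filterS => q nq; rewrite /preimage /= z0//; move: nA; rewrite z0//.
  exact: nbhs_singleton.
- exact: (plus_iota_compact hG hE).
- exact: (plus_iota_range_closed hG hE).
- move=> p; apply: contraNP => np; apply/eqP; have : (~` range plus_iota) p by [].
  rewrite plus_iota_rangeC// => -[e ne <-]; rewrite unit_phase_inl.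
  exact: unit_phase_supported.
Qed.

Definition finite_part (F : E' -> R[i]) (e : E) : R[i] :=
  F (inl e) - F (inr (circle_one R)) * unit_phase e.

Lemma finite_partE F e : F (inl e) = F (inr (circle_one R)) * unit_phase e + finite_part F e.
Proof. by rewrite /finite_part addrC subrK. Qed.

Lemma equivariant_inr F z : equivariant F -> F (inr z : E') = F (inr (circle_one R)) * val z.
Proof. by move=> eF; rewrite mulrC -eF act_inr circle_mulC circle_mul1. Qed.

(** Over units near infinity, [F] at [iota v 1] is within [e] of its value at infinity, and
    equivariance spreads this along the orbits. Away from these orbits, [F] and the phase function
    have support in compact parts of [E]. *)
Lemma C0_finite_part F : Cc_equivariant F -> C0_equivariant (finite_part F).
Proof.
move=> [CF eF]; set c := F (inr (circle_one R)).
have cu : continuous (unit_phase (E := E)).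
  have -> : unit_phase (E := E) = (fun e => unit_phase (inl e : E')).
    by apply/funext => e; rewrite unit_phase_inl.
  exact: (cont_comp (inl_continuous hG etG hE) Cc_unit_phase.1.1).
have cF : continuous (fun e => F (inl e)) by exact: (cont_comp (inl_continuous hG etG hE) CF.1).
apply: (C0_intro hG etG hE).
- exact: (@ccontB R E _ _ cF (@ccontZ R E c _ cu)).
- move=> z e; rewrite /finite_part (equivariant_unit_phase T) -act_inl eF mulrBr.
  by congr (_ - _); rewrite mulrCA.
move=> e e0; pose Q (x : opc) := F (plus_iota (x, circle_one R)).
have cQ : continuous Q.
  have c1 : continuous (fun x : opc => (x, circle_one R)).
    by apply: cont_pair; [move=> x; exact: cvg_id|exact: cont_cst].
  exact: (cont_comp (cont_comp c1 (plus_iota_continuous hG hE)) CF.1).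
pose N : set opc := (fun x => rnorm (Q x - c)) @^-1` [set r | r < e].
have oN : open N.
  apply: (cont_open_preimage (f := fun x => rnorm (Q x - c))); last exact: open_lt.
  exact: (cont_comp (@ccontB R _ _ _ cQ (@cont_cst opc R[i] c)) (@rnorm_continuous R R[i])).
have NN : N None by rewrite /N /preimage /= /Q /plus_iota /= /c subrr rnorm0.
have [K1 cK1 HK1] := Cc_support_alex CF oN NN.
have [K2 cK2 HK2] := Cc_support_alex Cc_unit_phase.1 oN NN.
exists (K1 `|` K2); first exact: compactU.
move=> d hd.
have small v z : N (Some v) -> d = iota (set_val v) z -> units (proj d) /\ rnorm (finite_part F d) < e.
  move=> Nv ->; have uv := set_valP v; rewrite (proj_iota T)//; split => //.
  have -> : finite_part F (iota (set_val v) z) = val z * (Q (Some v) - c).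
    rewrite /finite_part (unit_phase_iota T)// mulrBr (mulrC _ c); congr (_ - _).
    rewrite /Q -eF; congr F; rewrite /plus_iota /= act_inl (act_iota T)//.
    by rewrite circle_mulC circle_mul1.
  by rewrite rnormM rnorm_circle mul1r.
have [Fd|Fd] := eqVneq (F (inl d)) 0; last first.
  by have [Kd|[v [z [Nv dz]]]] := HK1 d Fd; [left; left|right; exact: small dz].
have ud : unit_phase (inl d : E') != 0.
  apply: contraNneq hd; rewrite unit_phase_inl => ud.
  by rewrite /finite_part Fd ud mulr0 subr0.
by have [Kd|[v [z [Nv dz]]]] := HK2 d ud; [left; right|right; exact: small dz].
Qed.

Lemma finite_part_lin (a : R[i]) F K :
  finite_part (fun p => a * F p + K p) = (fun e => a * finite_part F e + finite_part K e).
Proof. by apply/funext => e; rewrite /finite_part; ring. Qed.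

Lemma finite_part_extend f : finite_part (extend f) = f.
Proof. by apply/funext => e; rewrite /finite_part /= mul0r subr0. Qed.

Lemma finite_part_fstar F : equivariant F -> finite_part (fstar F) = fstar (finite_part F).
Proof.
move=> eF; apply/funext => e; rewrite /finite_part -{1}(fstar_unit_phase T) /fstar /=.
rewrite rmorphB rmorphM; congr (_ - conjc (F (inr _)) * _).
by apply: val_inj; rewrite /= invr1.
Qed.

End AlexandrovFunctions.

(** * Averaging over the circle *)

Section Mean.
Variables (R : realType) (G : groupoid) (E : twist_data R G).
Hypothesis T : algebraic_twist E.
Let LE := at_total T.
Local Notation proj := (@twist_proj R G E).
Local Notation act := (@circle_act R G E).
Hypothesis act_orbit : forall e, continuous (fun z => act z e).
Variable sec : G -> E.
Hypothesis hsec : cancel sec proj.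
Local Notation conv := (convolution sec).
Implicit Types (f g : E -> R[i]).

(* The isotypic projection of [Cc E] onto [Cc_equivariant E]. *)
Definition mean f e := circle_int (fun z => conjc (val z) * f (circle_act z e)).

(** Unlike [fiber_finite], this tests whole circle orbits, because a function that is not
    equivariant may vanish at the section without vanishing on the orbit. *)
Definition support_finite f :=
  forall x : G, finite_set [set y | rng y = x /\ exists2 e, proj e = y & f e != 0].

Let conj_val_continuous : continuous (fun z : circle R => conjc (val z)).
Proof. exact: (cont_comp (@val_circle_continuous R) (@conjc_continuous R)). Qed.

Let mean_arg f e : continuous f -> continuous (fun z : circle R => conjc (val z) * f (act z e)).
Proof. move=> cf; have c1 : continuous (fun z : circle R => f (act z e)) by exact: (cont_comp (@act_orbit e) cf).
exact: (@ccontM R (circle R) _ _ conj_val_continuous c1). Qed.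

Let conj_valK (z : circle R) : conjc (val z) * val z = 1.
Proof. by rewrite conj_circle mulVf// circle_neq0. Qed.

Lemma mean_equivariant f : equivariant f -> mean f = f.
Proof.
move=> ef; apply/funext => e; rewrite /mean -[RHS](circle_int_cst (f e)).
by apply: eq_circle_int => z; rewrite ef mulrA conj_valK mul1r.
Qed.

Lemma equivariant_mean f : continuous f -> equivariant (mean f).
Proof.
move=> cf w e; rewrite /mean -[in RHS](circle_int_rot w (@mean_arg f e cf)) -circle_intZ; last first.
  exact: (cont_comp (circle_mull_continuous (w := w)) (@mean_arg f e cf)).
apply: eq_circle_int => z; rewrite /= rmorphM /= !mulrA (mulrC (val w)) conj_valK mul1r.
by rewrite circle_mulC (actM T).
Qed.

Lemma mean_lin (a : R[i]) f g : continuous f -> continuous g ->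
  mean (fun e => a * f e + g e) = (fun e => a * mean f e + mean g e).
Proof.
move=> cf cg; apply/funext => e; rewrite /mean -circle_intZ; last exact: mean_arg.
rewrite -circle_intD; [|exact: (@ccontZ R (circle R) a _ (@mean_arg f e cf))|exact: mean_arg].
by apply: eq_circle_int => z; rewrite mulrDr mulrCA.
Qed.

Lemma mean_fstar f : continuous f -> mean (fstar f) = fstar (mean f).
Proof.
move=> cf; apply/funext => e; rewrite /fstar /mean -circle_int_conj; last exact: mean_arg.
rewrite -[RHS]circle_int_inv; last first.
  exact: (cont_comp (@mean_arg f (ginv e) cf) (@conjc_continuous R)).
apply: eq_circle_int => z; rewrite rmorphM /= conjcK (ginv_act T).
by rewrite conj_circle.
Qed.

Lemma mean_neq0 f e : mean f e != 0 -> exists z, f (act z e) != 0.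
Proof.
move=> /eqP H; apply: contrapT => /forallNP H'; apply: H.
rewrite /mean -[RHS](circle_int_cst 0); apply: eq_circle_int => z.
by have /negP := H' z; rewrite negbK => /eqP ->; rewrite mulr0.
Qed.

(** Along each orbit [mean] extracts the Fourier coefficient of the identity character. Over a fixed
    arrow the integral for [conv f g] is a circle convolution, whose coefficient is the product of
    the two coefficients by [circle_int_conv]. *)
Lemma mean_conv f g : continuous f -> continuous g -> support_finite f ->
  mean (conv f g) = conv (mean f) (mean g).
Proof.
move=> cf cg sf; apply/funext => e.
pose x := proj (rng e).
have /finite_seqP[s ss] := sf x.
have us : uniq (undup s) by exact: undup_uniq.
have sP y : y \in undup s -> rng y = x.
  move=> ys; have : [set` s] y by rewrite /= -mem_undup.
  by rewrite -ss => -[].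
have sN y z : rng y = x -> y \notin undup s -> f (act z (sec y)) = 0.
  move=> yx; rewrite mem_undup => ys; apply/eqP; apply: contraNT ys => fz.
  suff : [set` s] y by [].
  by rewrite -ss; split => //; exists (act z (sec y)) => //; rewrite (proj_act T) hsec.
rewrite (@conv_sum _ _ _ T sec hsec (mean f) (mean g) e (undup s)) //; first last.
- move=> y yx ys; apply/eqP; apply: contraNT ys => /mean_neq0 [z].
  by apply: contraNT => ys; rewrite (sN y z yx ys).
- exact: equivariant_mean.
- exact: equivariant_mean.
pose term y w := circle_int (fun z => f (act z (sec y)) *
  g (act (circle_mul (circle_inv z) w) (gmul (ginv (sec y)) e))).
have cconv : continuous (fun q : circle R * circle R => circle_mul (circle_inv q.2) q.1).
  have c1 : continuous (fun q : circle R * circle R => (circle_inv q.2, q.1)).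
    exact: (cont_pair (cont_comp (@cont_snd _ _) (@circle_inv_continuous R)) (@cont_fst _ _)).
  exact: (cont_comp c1 (@circle_mul_continuous R)).
have c2 y : continuous (fun q : circle R * circle R => f (act q.2 (sec y)) *
    g (act (circle_mul (circle_inv q.2) q.1) (gmul (ginv (sec y)) e))).
  have d1 := cont_comp (cont_comp (@cont_snd (circle R) (circle R)) (@act_orbit (sec y))) cf.
  have d2 := cont_comp (cont_comp cconv (@act_orbit (gmul (ginv (sec y)) e))) cg.
  exact: (@ccontM R _ _ _ d1 d2).
have ct y : continuous (term y) by exact: (circle_int_continuous (c2 y)).
have convw w : conv f g (act w e) = \sum_(y <- undup s) term y w.
  rewrite /convolution /haar_int (rng_act T) -/x -(@fsbig_widen _ _ _ _ [set` undup s]).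
  - rewrite -(fsbig_seq _ _ us); apply: eq_big_seq => y ys; apply: eq_circle_int => z.
    have rd : rng (sec y) = rng e by apply/(rng_sec T hsec); rewrite sP.
    have cd := composable_Vl LE rd.
    have cd' : composable (ginv (sec y), act w e) by apply/(composable_act2 T).
    by congr (_ * g _); rewrite (ginv_act T) (gmul_actl T _ cd') (gmul_actr T w cd) [RHS](actM T).
  - by move=> y /= /sP.
  - move=> y [/= yx /negP ys]; rewrite -[RHS](circle_int_cst 0); apply: eq_circle_int => z.
    by rewrite (sN y z yx ys) mul0r.
transitivity (circle_int (fun w => \sum_(y <- undup s) conjc (val w) * term y w)).
  by apply: eq_circle_int => w; rewrite convw mulr_sumr.
rewrite circle_int_sum; last by move=> y; exact: (@ccontM R (circle R) _ _ conj_val_continuous (ct y)).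
apply: eq_bigr => y _; rewrite /mean.
rewrite -circle_int_conv; [|exact: mean_arg|exact: mean_arg].
apply: eq_circle_int => w; rewrite /term -circle_intZ; last first.
  exact: (cont_comp (@cont_pairr _ _ w) (c2 y)).
apply: eq_circle_int => z /=; rewrite rmorphM /= (conj_circle (circle_inv z)) /= invrK.
rewrite !mulrA; congr (_ * _); rewrite [RHS]mulrC !mulrA -(mulrC (conjc (val z))).
by rewrite -!mulrA !(mulrCA (conjc (val z))) conj_valK mulr1.
Qed.

End Mean.

Section SectionIndependence.
Variables (R : realType) (G : groupoid) (E : twist_data R G).
Hypothesis T : algebraic_twist E.
Local Notation proj := (@twist_proj R G E).
Local Notation act := (@circle_act R G E).
Implicit Types (f g : E -> R[i]) (sec : G -> E).

Lemma fiber_sum_section sec sec' f x : cancel sec proj -> cancel sec' proj ->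
  equivariant f -> fiber_sum sec x f = fiber_sum sec' x f.
Proof.
move=> h h' ef; apply: eq_esum => y _; congr (_%:E).
have [z ->] : exists z, sec y = act z (sec' y) by apply: (same_proj T); rewrite h h'.
exact: rnorm_equivariant.
Qed.

Lemma I_bounded_section sec sec' f (M : R) : cancel sec proj -> cancel sec' proj ->
  equivariant f -> I_bounded sec f M -> I_bounded sec' f M.
Proof.
move=> h h' ef fM x; rewrite -!(fiber_sum_section x h h')//.
exact: (equivariant_fstar T).
Qed.

End SectionIndependence.

(* What the passage from representations of [Cc E] to representations of
   [Cc_equivariant E] uses of a twist. *)
Record regular_twist (R : realType) (G : groupoid) (E : twist_data R G) : Prop := {
  rt_algebraic : algebraic_twist E;
  rt_act : continuous (fun p : circle R * E => circle_act p.1 p.2);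
  rt_support : forall f : E -> R[i], Cc f -> exists K : set E,
    [/\ compact K, closed K & forall z e, f (circle_act z e) != 0 -> K e];
  rt_finite : forall f : E -> R[i], Cc f -> support_finite f;
  rt_bounded : forall (sec : G -> E) (f : E -> R[i]), cancel sec (@twist_proj R G E) ->
    Cc_equivariant f -> exists2 M : R, 0 <= M & I_bounded sec f M;
  rt_fstar : forall f : E -> R[i], continuous f -> continuous (fstar f);
  rt_unit : exists x : G, units x }.

(** * Representations of the equivariant functions and the full norm *)

Section EquivariantReps.
Variables (R : realType) (G : groupoid) (E : twist_data R G).
Hypothesis RT : regular_twist E.
Let T := rt_algebraic RT.
Local Notation proj := (@twist_proj R G E).
Local Notation act := (@circle_act R G E).
Local Notation S := (@Cc_equivariant R G E).
Implicit Types (f g : E -> R[i]) (sec : G -> E).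

Let act_orbit e : continuous (fun z => act z e).
Proof.
have c1 : continuous (fun z : circle R => (z, e)).
  by apply: cont_pair; [move=> z; exact: cvg_id|exact: cont_cst].
exact: (cont_comp c1 (@rt_act _ _ _ RT)).
Qed.

Lemma Cc_mean f : Cc f -> S (mean f).
Proof.
move=> Cf; split; last by apply: (equivariant_mean T act_orbit); exact: Cf.1.
have [K [cK clK fK]] := rt_support RT Cf.
apply: (Cc_intro _ cK clK); last by move=> e /mean_neq0 [z]; exact: fK.
have c1 : continuous (fun q : E * circle R => (q.2, q.1)).
  exact: (cont_pair (@cont_snd _ _) (@cont_fst _ _)).
have c2 := cont_comp (cont_comp c1 (@rt_act _ _ _ RT)) Cf.1.
have c3 : continuous (fun q : E * circle R => conjc (val q.2)).
  exact: (cont_comp (cont_comp (@cont_snd E (circle R)) (@val_circle_continuous R)) (@conjc_continuous R)).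
exact: (circle_int_continuous (@ccontM R (E * circle R)%type _ _ c3 c2)).
Qed.

Lemma fiber_sum_mean sec x f (M : R) : continuous f ->
  (haar_eint sec x (fun e => (rnorm (f e))%:E) <= M%:E)%E ->
  (fiber_sum sec x (mean f) <= (2 * M)%:E)%E.
Proof.
move=> cf fM; apply: ge_ereal_sup => _ [A [finA Ax] <-].
pose p y := circle_rint (fun z => rnorm (f (act z (sec y)))).
have cp y : continuous (fun z => rnorm (f (act z (sec y)))).
  exact: (cont_comp (cont_comp (@act_orbit (sec y)) cf) (@rnorm_continuous R R[i])).
have pE y : circle_eint (fun z => (rnorm (f (act z (sec y))))%:E) = (p y)%:E.
  by rewrite circle_eintE.
have p0 y : (0 <= (p y)%:E)%E.
  rewrite lee_fin -[X in X <= _](circle_rint_cst 0); apply: le_circle_rint => //; first exact: cont_cst.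
  by move=> z; exact: rnorm_ge0.
apply: (@le_trans _ _ (\sum_(y \in A) (2%:E * (p y)%:E))%E).
  apply: lee_fsum => // y Ay; rewrite -EFinM lee_fin.
  have c1 : continuous (fun z : circle R => conjc (val z) * f (act z (sec y))).
    have c1 := cont_comp (@val_circle_continuous R) (@conjc_continuous R).
    exact: (@ccontM R (circle R) _ _ c1 (cont_comp (@act_orbit (sec y)) cf)).
  apply: (le_trans (rnorm_circle_int c1)).
  have -> : (fun z : circle R => rnorm (conjc (val z) * f (act z (sec y)))) = (fun z => rnorm (f (act z (sec y)))).
    by apply/funext => z; rewrite rnormM rnormJ rnorm_circle mul1r.
  by [].
rewrite -ge0_mule_fsumr// EFinM; apply: lee_wpmul2l => //.
apply: le_trans fM; apply: ereal_sup_ubound; exists A => //.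
by apply: eq_fsbigr => y _; rewrite pE.
Qed.

(** A unit is called for here: a supremum over no units would be minus infinity. *)
Lemma I_norm_ge0 sec f : (0 <= I_norm sec f)%E.
Proof.
have [x ux] := rt_unit RT; rewrite /I_norm le_max; apply/orP; left.
apply: (@le_trans _ _ (haar_eint sec x (fun e => (rnorm (f e))%:E))); last first.
  by apply: ereal_sup_ubound; exists x.
apply: esum_ge0 => y _; apply: integral_ge0 => t _; rewrite lee_fin; exact: rnorm_ge0.
Qed.

Lemma I_bounded_mean sec f (M : R) : 0 <= M -> continuous f -> continuous (fstar f) ->
  (I_norm sec f <= M%:E)%E -> I_bounded sec (mean f) (2 * M).
Proof.
move=> M0 cf cf'; rewrite /I_norm ge_max => /andP[h1 h2] x.
have [ux|ux] := pselect (units x); last by rewrite !fiber_sum_nonunit// lee_fin mulr_ge0.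
split; first by apply: fiber_sum_mean => //; apply: le_trans h1; apply: ereal_sup_ubound; exists x.
rewrite -(mean_fstar T act_orbit)//; apply: fiber_sum_mean => //; apply: le_trans h2.
apply: ereal_sup_ubound; exists x => //; rewrite /haar_eint_src; congr (haar_eint _ _ _).
by apply/funext => e; rewrite rnorm_fstar.
Qed.

(** The bound is stated for each real [N] dominating the fibre sums, a form that moves between [E]
    and the Alexandrov twist through [I_bounded_alex]. *)
Definition equivariant_rep sec (H : hilbert R) (L : (E -> R[i]) -> H -> H) : Prop :=
  [/\ forall f, S f -> linear (L f),
      forall (a : R[i]) f g v, S f -> S g ->
        L (fun e => a * f e + g e) v = a *: L f v + L g v,
      forall f g v, S f -> S g -> L (convolution sec f g) v = L f (L g v),
      forall f v w, S f -> hil_dot H (L f v) w = hil_dot H v (L (fstar f) w) &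
      exists2 M : R, 0 <= M & forall f (N : R), S f -> 0 <= N -> I_bounded sec f N ->
        forall v, rnorm (L f v) <= M * N * rnorm v].

Lemma equivariant_rep_section sec sec' (H : hilbert R) (L : (E -> R[i]) -> H -> H) :
  cancel sec proj -> cancel sec' proj -> equivariant_rep sec L -> equivariant_rep sec' L.
Proof.
move=> h h' [L1 L2 L3 L4 [M M0 LM]]; split => //.
- move=> f g v Sf Sg; rewrite -L3//; congr (L _ v); apply/funext => e.
  by apply: (@conv_section _ _ _ sec' sec f g e T) => //; [exact: Sf.2|move=> z e' _; exact: Sg.2].
- exists M => // f N Sf N0 fN; apply: LM => //.
  exact: (I_bounded_section T h' h Sf.2).
Qed.

Variable sec : G -> E.
Hypothesis hsec : cancel sec proj.

Lemma bounded_rep_equivariant (H : hilbert R) (L : (E -> R[i]) -> H -> H) :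
  bounded_rep sec L -> equivariant_rep sec L.
Proof.
move=> [L1 L2 L3 L4 [M LM]]; split.
- by move=> f Sf; exact: (L1 f Sf.1).1.
- by move=> a f g v Sf Sg; apply: L2; [exact: Sf.1|exact: Sg.1].
- by move=> f g v Sf Sg; apply: L3; [exact: Sf.1|exact: Sg.1].
- by move=> f v w Sf; apply: L4; exact: Sf.1.
(* The constant of a bounded representation has no prescribed sign. *)
exists (Num.max M 0); first by rewrite le_max lexx orbT.
move=> f N Sf N0 fN v; apply: op_norm_bound; first exact: (L1 f Sf.1).1.
apply: (le_trans (LM f Sf.1)); rewrite EFinM.
apply: (@le_trans _ _ ((Num.max M 0)%:E * I_norm sec f)%E).
  by apply: lee_wpmul2r; [exact: I_norm_ge0|rewrite lee_fin le_max lexx].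
apply: lee_wpmul2l; first by rewrite lee_fin le_max lexx orbT.
by apply: (I_norm_le T) => //; exact: Sf.2.
Qed.

Lemma equivariant_rep_bounded (H : hilbert R) (L : (E -> R[i]) -> H -> H) :
  equivariant_rep sec L -> bounded_rep sec (fun f => L (mean f)).
Proof.
move=> [L1 L2 L3 L4 [M M0 LM]].
have fin f : Cc f -> (op_norm (L (mean f)) < +oo)%E.
  move=> /Cc_mean Sf; have [N N0 fN] := rt_bounded RT hsec Sf.
  apply: (@le_lt_trans _ _ (M * N)%:E); last exact: ltry.
  by apply: op_norm_le => [|v]; [rewrite mulr_ge0|apply: LM].
split.
- by move=> f Cf; split; [apply: L1; exact: Cc_mean|exact: fin].
- move=> a f g v Cf Cg; rewrite (mean_lin act_orbit _ Cf.1 Cg.1).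
  by apply: L2; exact: Cc_mean.
- move=> f g v Cf Cg; rewrite (mean_conv T act_orbit hsec Cf.1 Cg.1 (rt_finite RT Cf)).
  by apply: L3; exact: Cc_mean.
- move=> f v w Cf; rewrite (mean_fstar T act_orbit Cf.1).
  by apply: L4; exact: Cc_mean.
(* The factor 2 is lost in averaging. Adding 1 keeps the constant positive, so that its product with
   an infinite I-norm is infinite. *)
exists (2 * (M + 1)) => f Cf.
have M1 : 0 < 2 * (M + 1) by rewrite mulr_gt0// ltr_wpDl.
have := I_norm_ge0 sec f; case E1 : (I_norm sec f) => [N| |] // N0.
  rewrite -EFinM; apply: op_norm_le; first by rewrite mulr_ge0// ltW.
  move=> v; have fN : I_bounded sec (mean f) (2 * N).
    by apply: I_bounded_mean => //; [exact: Cf.1|exact: (rt_fstar RT Cf.1)|rewrite E1].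
  apply: (le_trans (LM _ _ (Cc_mean Cf) _ fN v)); first by rewrite mulr_ge0.
  rewrite ler_wpM2r ?rnorm_ge0//; move: N0; rewrite lee_fin; nra.
by rewrite gt0_muley// leey.
Qed.

(** Averaging fixes equivariant functions. Together with [full_norm_le], this shows that on them the
    full norm is the supremum over representations of the equivariant functions alone. *)
Lemma full_norm_ge f (H : hilbert R) (L : (E -> R[i]) -> H -> H) : S f ->
  equivariant_rep sec L -> (op_norm (L f) <= full_norm sec f)%E.
Proof.
move=> Sf /equivariant_rep_bounded BL; apply: ereal_sup_ubound.
exists H, (fun f => L (mean f)); split => //.
by rewrite mean_equivariant//; exact: Sf.2.
Qed.

Lemma full_norm_le f (a : \bar R) :
  (forall (H : hilbert R) (L : (E -> R[i]) -> H -> H), equivariant_rep sec L -> (op_norm (L f) <= a)%E) ->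
  (full_norm sec f <= a)%E.
Proof.
move=> fa; apply: ge_ereal_sup => _ [H [L [BL ->]]]; apply: fa.
exact: bounded_rep_equivariant.
Qed.

End EquivariantReps.

(** * Regularity of the twist and of its Alexandrov extension *)

Section RegularTwists.
Variables (R : realType) (G : groupoid) (E : twist_data R G).
Hypotheses (hG : lch_groupoid G) (etG : etale G) (hE : is_twist E).
Hypothesis unit_exists : exists x : G, units x.
Let T := is_twist_algebraic hG hE.
Let T' := alex_algebraic_twist T.
Let LG := at_base T.
Local Notation proj := (@twist_proj R G E).
Local Notation act := (@circle_act R G E).
Local Notation G' := (alex_groupoid G).
Local Notation E' := (alex_twist E).
Local Notation proj' := (@twist_proj R G' E').
Local Notation opc := (unit_space_plus G).
Local Notation inlE := (inl : E -> E').
Implicit Types (F : E' -> R[i]).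

Lemma orbit_compact (K : set E) : compact K -> exists2 K' : set E, compact K' &
  forall z e, K (act z e) -> K' e.
Proof.
move=> cK; exists ((fun p : circle R * E => act p.1 p.2) @` (setT `*` K)).
  apply: continuous_compact; first exact: continuous_subspaceT (act_continuous hG hE).
  by apply: compact_setX => //; exact: circle_compact.
by move=> z e Kze; exists (circle_inv z, act z e) => //=; rewrite (actKV T).
Qed.

Lemma regular_twist_total : regular_twist E.
Proof.
split.
- exact: T.
- exact: (act_continuous hG hE).
- move=> f Cf; have [K [cK _ fK]] := Cc_elim Cf.
  have [K' cK' HK'] := orbit_compact cK; exists K'; split => [//||z e /fK].
    exact: compact_closed (twist_hausdorff hE) cK'.
  exact: HK'.
- move=> f Cf x; have [K [cK _ fK]] := Cc_elim Cf.
  apply: (@sub_finite_set _ _ [set g | (proj @` K) g /\ rng g = x]).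
    by move=> y [yx [e ey /fK Ke]]; split => //; exists e.
  by apply: (compact_fiber_finite (base_topological hG) etG); exact: (proj_compact hE).
- by move=> sec f hsec Sf; exact: (Cc_I_bounded hG etG hE hsec Sf).
- by move=> f; exact: (fstar_continuous hE).
- exact: unit_exists.
Qed.

(** [E] and the chart [plus_iota] embed as open sets and cover the Alexandrov twist. *)
Lemma continuous_from_alex (X : topologicalType) (f : E' -> X) :
  continuous (fun e => f (inl e)) -> continuous (fun p => f (plus_iota E p)) -> continuous f.
Proof.
move=> c1 c2 [e|z] A nA.
  have : nbhs (inl e : E') (inlE @` ((fun e => f (inl e)) @^-1` A)°).
    apply: open_nbhs_nbhs; split; first by apply: inl_open; exact: open_interior.
    by exists e => //; apply: nbhs_singleton; apply: nbhs_interior; exact: (c1 e A nA).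
  by apply: filterS => _ [d /interior_subset Ad <-].
have : nbhs (inr z : E') (plus_iota E @` ((fun p => f (plus_iota E p)) @^-1` A)°).
  apply: open_nbhs_nbhs; split; first by apply: plus_iota_open; exact: open_interior.
  exists (None : opc, z) => //.
  exact: nbhs_singleton (nbhs_interior (c2 (None : opc, z) A nA)).
by apply: filterS => _ [d /interior_subset Ad <-].
Qed.

Lemma ginv_plus_iota p : ginv (plus_iota E p : E') = plus_iota E (p.1, circle_inv p.2).
Proof.
case: p => -[v|] z; rewrite /plus_iota //=; congr inl.
have uv := set_valP v; rewrite (iota_act T _ uv) (ginv_act T) (inv_unit (at_total T)).
  by rewrite -(iota_act T).
exact: (iota1_unit T).
Qed.

Lemma ginv_alex_continuous : continuous (@ginv E').
Proof.
apply: continuous_from_alex.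
  exact: (cont_comp (ginv_continuousE hE) (inl_continuous hG etG hE)).
have -> : (fun p => ginv (plus_iota E p : E')) = (fun p => plus_iota E (p.1, circle_inv p.2)).
  by apply/funext => p; rewrite ginv_plus_iota.
apply: (cont_comp (f := fun p : opc * circle R => (p.1, circle_inv p.2))).
  exact: (cont_pair (@cont_fst _ _) (cont_comp (@cont_snd _ _) (@circle_inv_continuous R))).
exact: (plus_iota_continuous hG hE).
Qed.

Lemma rng_alex_none (y : G') : (rng y = None) <-> (y = None).
Proof. by case: y => [y|]. Qed.

Lemma rng_alex_some (y : G') x : (rng y = Some x) <-> (exists2 g, y = Some g & rng g = x).
Proof.
split; first by case: y => [g|] // [gx]; exists g.
by move=> [g -> <-].
Qed.

Lemma alex_fiber x : [set y : G' | rng y = Some x] = Some @` [set g | rng g = x].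
Proof. by apply/seteqP; split => [y /rng_alex_some[g -> gx]|_ [g gx <-]]; [exists g|rewrite /= -gx]. Qed.

Lemma alex_fiber_none : [set y : G' | rng y = None] = [set None].
Proof. by apply/seteqP; split => y /rng_alex_none. Qed.

(** With this section, fibre sums and convolutions on the Alexandrov twist restrict literally to
    those on [E]. Independence of the section transfers the results to an arbitrary one. *)
Definition alex_sec (sec : G -> E) (x : G') : E' :=
  if x is Some g then inl (sec g) else inr (circle_one R).

Lemma alex_secK sec : cancel sec proj -> cancel (alex_sec sec) proj'.
Proof. by move=> h [g|] //=; rewrite h. Qed.

Lemma fiber_sum_some sec F x : fiber_sum (alex_sec sec) (Some x) F = fiber_sum sec x (fun e => F (inl e)).
Proof.
by rewrite /fiber_sum alex_fiber esum_image//; exact: Some_inj.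
Qed.

Lemma fiber_sum_none sec F : fiber_sum (alex_sec sec) None F = (rnorm (F (inr (circle_one R))))%:E.
Proof. by rewrite /fiber_sum alex_fiber_none esum_set1// lee_fin rnorm_ge0. Qed.

(** The fibre over infinity is a single point, and the other fibres are those of [G]. *)
Lemma I_bounded_alex sec F (M : R) : I_bounded (alex_sec sec) F M <->
  I_bounded sec (fun e => F (inl e)) M /\ rnorm (F (inr (circle_one R))) <= M.
Proof.
have inv1 : circle_inv (circle_one R) = circle_one R by apply: val_inj; rewrite /= invr1.
split => [FM|[FM F1] [x|]].
  split; last by have [] := FM None; rewrite fiber_sum_none lee_fin.
  by move=> x; have := FM (Some x); rewrite !fiber_sum_some.
- by rewrite !fiber_sum_some; exact: FM.
- by rewrite !fiber_sum_none !lee_fin rnorm_fstar /= inv1.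
Qed.

Lemma Cc_inl_finite F x : Cc F -> finite_set [set y | rng y = x /\ exists2 e, proj e = y & F (inl e) != 0].
Proof.
move=> CF; have [K cK HK] := Cc_support_alex CF (openT : open (setT : set opc)) I.
apply: (@sub_finite_set _ _ ([set g | (proj @` K) g /\ rng g = x] `|` [set x])).
  move=> y [yx [e ey /HK [Ke|[v [z [_ ez]]]]]]; first by left; split => //; exists e.
  right; rewrite /= -yx -ey ez (proj_iota T) ?(rng_unit LG)//; exact: set_valP.
rewrite finite_setU; split; last exact: finite_set1.
by apply: (compact_fiber_finite (base_topological hG) etG); exact: (proj_compact hE).
Qed.

Lemma regular_twist_alex : regular_twist E'.
Proof.
split.
- exact: T'.
- exact: (act_alex_continuous hG etG hE).
- move=> F CF; have [K cK HK] := Cc_support_alex CF (openT : open (setT : set opc)) I.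
  have [K' cK' HK'] := orbit_compact cK.
  exists ((inlE @` K') `|` range (plus_iota E)); split.
  + apply: compactU; first exact: (inl_image_compact hG etG hE).
    exact: (plus_iota_compact hG hE).
  + apply: closedU; first exact: (inl_image_closed hG etG hE).
    exact: (plus_iota_range_closed hG hE).
  + move=> z [e|w] Fz; last by right; exists (None, w).
    have [Ke|[v [w [_ ew]]]] := HK _ Fz; first by left; exists e => //; exact: HK' Ke.
    right; exists (Some v, circle_mul (circle_inv z) w) => //.
    have -> : e = act (circle_inv z) (act z e) by rewrite (actKV T).
    by rewrite (ew : act z e = _) (act_iota T)//; exact: set_valP.
- move=> F CF [x|].
    apply: (@sub_finite_set _ _ (Some @` [set y | rng y = x /\ exists2 e, proj e = y & F (inl e) != 0])).
      move=> y [/rng_alex_some[g -> gx] [[e|//] eg Fe]]; exists g => //; split => //.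
      by exists e => //; case: eg.
    by apply: finite_image; exact: Cc_inl_finite.
  apply: (@sub_finite_set _ _ [set None]); last exact: finite_set1.
  by move=> y [/rng_alex_none].
- move=> sec F hsec SF.
  (* The given section of the Alexandrov twist is unrelated to [E]. One of [E] is chosen, its
     extension serves to compute the bound, and the bound is then moved to the given section. *)
  have [s hs] : exists s : G -> E, cancel s proj.
    have H g : exists e, proj e = g.
      have : range proj g by rewrite (proj_surj hE).
      by move=> [e _ <-]; exists e.
    by have [s hs] := choice H; exists s.
  have [M M0 hM] := C0_I_bounded hG etG hE hs (C0_finite_part hG etG hE SF).
  set c := F (inr (circle_one R)).
  exists (M + rnorm c); first by rewrite addr_ge0// rnorm_ge0.
  suff FM : I_bounded (alex_sec s) F (M + rnorm c).
    exact: (I_bounded_section T' (alex_secK hs) hsec SF.2 FM).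
  apply/I_bounded_alex; split; last by rewrite lerDr.
  (* On [E] the function is its finite part plus [c] times the phase function, and the latter is
     supported over the units. *)
  have uc : I_bounded s (fun e => c * unit_phase e) (rnorm c).
    apply: (I_bounded_unit T hs); first exact: rnorm_ge0.
      by move=> e ne; rewrite (unit_phase_supported ne) mulr0.
    by move=> e; rewrite rnormM ler_piMr ?rnorm_ge0// rnorm_unit_phase.
  apply: (I_boundedD _ hM uc) => e; rewrite finite_partE addrC; exact: rnormD.
- by move=> F cF; exact: (cont_comp (cont_comp ginv_alex_continuous cF) (@conjc_continuous R)).
- by exists None; apply/alex_units.
Qed.

End RegularTwists.

(** * Extension of representations *)

Section HilbertCauchySchwarz.
Variables (R : realType) (H : hilbert R).
Local Notation "''[' u , v ]" := (hil_dot H u v).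
Implicit Types u v : H.

(** Cauchy-Schwarz, from positivity of the squared norm of [u] minus its projection onto [v]. *)
Lemma rnorm_hil_dot u v : rnorm '[u, v] <= rnorm u * rnorm v.
Proof.
have [->|v0] := eqVneq v 0.
  have -> : '[u, 0] = 0 by have := hil_dotZr 0 0 u; rewrite scale0r rmorph0 mul0r.
  by rewrite !rnorm0 mulr0.
have r0 : 0 < rnorm v.
  by rewrite lt_def rnorm_ge0 andbT; apply: contraNneq v0 => /rnorm0_eq0 ->.
set t := '[u, v]; pose r := rnorm v ^+ 2; have rp : 0 < r by rewrite exprn_gt0.
have rC : r%:C != 0 :> R[i] by rewrite fmorph_eq0 gt_eqF.
pose a := t / r%:C.
have vv : '[v, v] = r%:C by rewrite -hil_rnorm.
have ca : conjc a = conjc t / r%:C.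
  by rewrite /a rmorphM fmorphV /= oppr0.
have e1 : '[u - a *: v, u - a *: v] = '[u, u] - t * conjc t / r%:C.
  rewrite hil_dotBl !hil_dotBr hil_dotZl !hil_dotZr hil_dotZl vv (hil_dotC v u) -/t ca /a.
  by field.
rewrite -(@ler_pXn2r _ 2)// ?nnegrE ?mulr_ge0 ?rnorm_ge0// exprMn -ler_pdivrMr// -/r -subr_ge0.
have : ((rnorm (u - a *: v) ^+ 2)%:C = (rnorm u ^+ 2 - rnorm t ^+ 2 / r)%:C :> R[i]).
  by rewrite hil_rnorm e1 -hil_rnorm mulcJ rmorphB (rmorphM _ (rnorm t ^+ 2)) (fmorphV _ r).
by move=> [<-]; rewrite exprn_ge0// rnorm_ge0.
Qed.

End HilbertCauchySchwarz.

(** Restricting to [e <= 1] lets products of errors be bounded by a multiple of [e]. *)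
Lemma rnorm_eq_small (R : realType) (V : normedModType R[i]) (v w : V) (C : R) :
  (forall e : R, 0 < e -> e <= 1 -> rnorm (v - w) <= C * e) -> v = w.
Proof.
move=> h; apply/eqP; rewrite -subr_eq0; apply/eqP; apply: rnorm_le0 => e e0.
pose C' := Num.max C 1; have C'0 : 0 < C' by rewrite lt_max ltr01 orbT.
pose d := Num.min (e / C') 1.
have d0 : 0 < d by rewrite lt_min ltr01 andbT divr_gt0.
have d1 : d <= 1 by rewrite ge_min lexx orbT.
apply: (le_trans (h d d0 d1)); apply: (@le_trans _ _ (C' * d)).
  by apply: ler_wpM2r; [exact: ltW|rewrite le_max lexx].
by rewrite mulrC -ler_pdivlMr// ge_min lexx.
Qed.

Section AlexandrovConvolution.
Variables (R : realType) (G : groupoid) (E : twist_data R G).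
Hypotheses (hG : lch_groupoid G) (etG : etale G) (hE : is_twist E).
Let T := is_twist_algebraic hG hE.
Let T' := alex_algebraic_twist T.
Local Notation proj := (@twist_proj R G E).
Local Notation G' := (alex_groupoid G).
Local Notation E' := (alex_twist E).
Variable sec : G -> E.
Hypothesis hsec : cancel sec proj.
Local Notation conv := (convolution sec).
Local Notation conv' := (convolution (alex_sec sec)).
Local Notation S := (@Cc_equivariant R G E).
Local Notation S' := (@Cc_equivariant R G' E').
Implicit Types (F K : E' -> R[i]).

Lemma equivariant_inl F : equivariant F -> equivariant (fun e : E => F (inl e)).
Proof. by move=> eF z e; rewrite -eF act_inl. Qed.

Lemma conv_inl F K e : equivariant F -> equivariant K -> fiber_finite sec (fun e => F (inl e)) ->
  conv' F K (inl e) = conv (fun e => F (inl e)) (fun e => K (inl e)) e.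
Proof.
move=> eF eK fF.
have [s [us sr s0]] := fiber_finite_seq (proj (rng e)) fF fF.
rewrite (@conv_sum _ _ _ T sec hsec _ _ e s) => [|//|//|//|//|y yx ys]; first last.
- by have [] := s0 y yx ys.
- exact: equivariant_inl.
- exact: equivariant_inl.
rewrite (@conv_sum _ _ _ T' _ (alex_secK hsec) _ _ _ [seq Some y | y <- s]) //.
- by rewrite big_map.
- by rewrite map_inj_uniq//; exact: Some_inj.
- by move=> _ /mapP[y ys ->] /=; rewrite -[RHS]/(Some (proj (rng e))) -(sr y ys).
- move=> y /(rng_alex_some _)[g -> gx]; rewrite mem_map; last exact: Some_inj.
  by move=> gs; have [] := s0 g gx gs.
Qed.

Lemma conv_inr F K z : equivariant F -> equivariant K ->
  conv' F K (inr z) = F (inr (circle_one R)) * K (inr z).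
Proof.
move=> eF eK; rewrite (@conv_sum _ _ _ T' _ (alex_secK hsec) _ _ _ [:: None]) //.
- rewrite big_seq1; congr (_ * K _); rewrite -[LHS]/(inr (circle_mul (circle_inv (circle_one R)) z)).
  by congr inr; apply: val_inj; rewrite /= invr1 mul1r.
- by move=> y; rewrite inE => /eqP ->.
- by move=> y /rng_alex_none ->; rewrite inE eqxx.
Qed.

Lemma extend_conv f g : S f -> S g -> extend (conv f g) = conv' (extend f) (extend g).
Proof.
move=> Sf Sg; have eF := (Cc_equivariant_extend hG etG hE Sf).2.
have eK := (Cc_equivariant_extend hG etG hE Sg).2.
apply/funext => -[e|z]; last by rewrite conv_inr//= mul0r.
rewrite (conv_inl _ eF eK)//; apply: (Cc_fiber_finite hG etG hE hsec).
exact: Sf.1.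
Qed.

(** The product rule of a unitization, [(h + c) (k + d) = (h k + c k + d h) + c d]. The factor 1
    matches the form [a f + g] of the linearity lemmas. *)
Lemma finite_part_conv F K : S' F -> S' K -> finite_part (conv' F K) =
  (fun e => 1 * conv (finite_part F) (finite_part K) e +
    (F (inr (circle_one R)) * finite_part K e + K (inr (circle_one R)) * finite_part F e)).
Proof.
move=> SF SK; set c := F (inr _); set d := K (inr _).
have hF := C0_finite_part hG etG hE SF; have hK := C0_finite_part hG etG hE SK.
have [_ eF _] := hF; have [_ eK _] := hK.
have fF := C0_fiber_finite hG etG hE hsec hF.
have eu := equivariant_unit_phase T.
have fu : fiber_finite sec (unit_phase (E := E)).
  exact: (fiber_finite_unit T hsec (@unit_phase_supported _ _ E)).
have EF : (fun e => F (inl e)) = (fun e => c * unit_phase e + finite_part F e).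
  by apply/funext => e; exact: finite_partE.
have EK : (fun e => K (inl e)) = (fun e => d * unit_phase e + finite_part K e).
  by apply/funext => e; exact: finite_partE.
apply/funext => e; rewrite /finite_part (conv_inr _ SF.2 SK.2) -/c -/d.
rewrite (conv_inl _ SF.2 SK.2); last by rewrite EF; exact: (fiber_finite_lin c fu fF).
rewrite EF EK (conv_linl T hsec) => [|//|//||//|//]; last exact: (equivariant_lin d eu eK).
rewrite (conv_phase_l T hsec); last exact: (equivariant_lin d eu eK).
rewrite (conv_linr T hsec)// (conv_phase_r T hsec)//.
rewrite -!/(finite_part _ _); ring.
Qed.

End AlexandrovConvolution.

Section RepExtension.
Variables (R : realType) (G : groupoid) (E : twist_data R G).
Hypotheses (hG : lch_groupoid G) (etG : etale G) (hE : is_twist E).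
Let T := is_twist_algebraic hG hE.
Variable sec : G -> E.
Hypothesis hsec : cancel sec (@twist_proj R G E).
Local Notation conv := (convolution sec).
Local Notation S := (@Cc_equivariant R G E).
Variables (H : hilbert R) (L : (E -> R[i]) -> H -> H) (M : R).
Hypothesis M0 : 0 <= M.
Hypothesis Llin : forall f, S f -> linear (L f).
Hypothesis LD : forall (a : R[i]) f g v, S f -> S g ->
  L (fun e => a * f e + g e) v = a *: L f v + L g v.
Hypothesis LM : forall f g v, S f -> S g -> L (conv f g) v = L f (L g v).
Hypothesis Lstar : forall f v w, S f -> hil_dot H (L f v) w = hil_dot H v (L (fstar f) w).
Hypothesis Lbd : forall f (N : R), S f -> 0 <= N -> I_bounded sec f N ->
  forall v, rnorm (L f v) <= M * N * rnorm v.
Implicit Types (f g h k : E -> R[i]) (v w : H).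

(* [L f v] converges as the [near_Cc] approximants [f] of [h] get finer, because
   the I-norm of a function supported over the units is its supremum norm. *)
Definition rep_limit h v : H := xget 0 [set w | forall (e : R) f, 0 < e ->
  near_Cc h e f -> rnorm (w - L f v) <= M * e * rnorm v].

Let S0 : subspace_on S := @Cc_equivariant_subspace R G E.

Let LB f g v : S f -> S g -> L f v - L g v = L (fun e => f e - g e) v.
Proof.
by move=> Sf Sg; rewrite -(@linear_onB R E S H (L^~ v))// => a ? ? ? ?; exact: LD.
Qed.

Let Lv f v w : S f -> L f v - L f w = L f (v - w).
Proof.
move=> Sf; have -> : v - w = -1 *: w + v by rewrite scaleN1r addrC.
by rewrite Llin// scaleN1r addrC.
Qed.

Lemma rep_limitP h (e : R) f v : C0_equivariant h -> 0 < e -> near_Cc h e f ->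
  rnorm (rep_limit h v - L f v) <= M * e * rnorm v.
Proof.
move=> hh e0 nf; rewrite /rep_limit.
set Q := [set w | _]; suff : Q (xget 0 Q) by apply.
apply: xgetPex; pose P (d : R) : set H := [set w | exists2 g, near_Cc h d g & w = L g v].
have [d d0|d d' x y d0 d'0 [g [Sg ug gd] ->] [k [Sk uk kd] ->]|w Hw] := @approx_limit R H P (M * rnorm v).
- by have [_ _ /(_ d d0)[g ng]] := hh; exists (L g v), g.
(* Both approximants agree with [h] off the units, so their difference lives over the units and
   [d + d'] bounds its I-norm. *)
- rewrite LB//; apply: (le_trans (Lbd (subspace_onB S0 Sg Sk) (N := d + d') _ _ v)).
  + by rewrite addr_ge0// ltW.
  + apply: (I_bounded_unit T hsec); first by rewrite addr_ge0// ltW.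
      move=> z nz; have /eqP := ug z nz; rewrite subr_eq0 => /eqP hg.
      by have /eqP := uk z nz; rewrite subr_eq0 => /eqP hk; rewrite -hg hk subrr.
    by move=> z; apply: (le_trans (rnormBD (h z) _ _)); rewrite (rnormB (g z)) lerD.
  + by rewrite mulrAC.
by exists w => d g d0 ng; rewrite mulrAC; apply: Hw => //; exists g.
Qed.

(** The tool for identities between limits: it suffices to find approximants whose error, and whose
    image's distance to the candidate [w], are both of order [e]. [C] may depend on everything
    except [e]. *)
Lemma rep_limit_eq h v w (C : R) : C0_equivariant h ->
  (forall e : R, 0 < e -> e <= 1 -> exists (d : R) f,
    [/\ 0 < d, d <= C * e, near_Cc h d f & rnorm (w - L f v) <= C * e]) ->
  rep_limit h v = w.
Proof.
move=> hh Hw; apply: (@rnorm_eq_small R H _ _ (M * C * rnorm v + C)) => e e0 e1.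
have [d [f [d0 dC nf wf]]] := Hw e e0 e1.
apply: (le_trans (rnormBD (L f v) _ _)); rewrite mulrDl (rnormB _ w); apply: lerD => //.
apply: (le_trans (rep_limitP v hh d0 nf)); have -> : M * C * rnorm v * e = M * (C * e) * rnorm v by ring.
by apply: ler_wpM2r; [exact: rnorm_ge0|exact: ler_wpM2l].
Qed.

Lemma rep_limit_Cc f v : S f -> rep_limit f v = L f v.
Proof.
move=> Sf; apply: (@rep_limit_eq f v (L f v) 1); first exact: (C0_Cc Sf).
move=> e e0 e1; exists e, f; split => //; first by rewrite mul1r.
  split => //; first by move=> x _; rewrite subrr.
  by move=> x; rewrite subrr rnorm0 ltW.
by rewrite subrr rnorm0 mul1r ltW.
Qed.

Lemma rep_limit_lin (a : R[i]) h k v : C0_equivariant h -> C0_equivariant k ->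
  rep_limit (fun e => a * h e + k e) v = a *: rep_limit h v + rep_limit k v.
Proof.
move=> hh hk; set al := complex.Re `|a|.
have al0 : 0 <= al by exact: (rnorm_ge0 (a : R[i])).
apply: (@rep_limit_eq _ _ _ ((al + 1) * (1 + M * rnorm v))); first exact: C0_lin.
have Mv : 0 <= M * rnorm v by rewrite mulr_ge0// rnorm_ge0.
move=> e e0 e1; have [_ _ /(_ e e0)[f nf]] := hh; have [_ _ /(_ e e0)[g ng]] := hk.
exists (al * e + e), (fun x => a * f x + g x); split.
- by rewrite ltr_wpDl// mulr_ge0// ltW.
- rewrite -{2}(mul1r e) -mulrDl ler_wpM2r ?(ltW e0)// ler_peMr ?addr_ge0//.
  by rewrite lerDl.
- exact: near_Cc_lin.
rewrite LD; [|by case: nf|by case: ng].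
have -> : a *: rep_limit h v + rep_limit k v - (a *: L f v + L g v) =
    a *: (rep_limit h v - L f v) + (rep_limit k v - L g v).
  by rewrite scalerBr opprD addrACA.
apply: (le_trans (rnormD _ _)); rewrite rnormZ -/al.
have b1 := rep_limitP v hh e0 nf; have b2 := rep_limitP v hk e0 ng.
have b3 := ler_wpM2l al0 b1.
apply: (le_trans (lerD b3 b2)); rewrite [leRHS]mulrAC.
have ee : 0 <= e * (al + 1) by apply: mulr_ge0; [exact: ltW|exact: addr_ge0].
have -> : al * (M * e * rnorm v) + M * e * rnorm v = (al + 1) * e * (M * rnorm v) by ring.
by rewrite ler_wpM2l ?lerDr// mulrC.
Qed.

Lemma linear_rep_limit h : C0_equivariant h -> linear (rep_limit h).
Proof.
move=> hh a v w.
apply: (@rep_limit_eq _ _ _ (1 + complex.Re `|a| * (M * rnorm v) + M * rnorm w)) => // e e0 e1.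
have [_ _ /(_ e e0)[f nf]] := hh; exists e, f.
have al0 : 0 <= complex.Re `|a| by exact: (rnorm_ge0 (a : R[i])).
have b1 := ler_wpM2l al0 (rep_limitP v hh e0 nf); have b2 := rep_limitP w hh e0 nf.
have n1 : 0 <= complex.Re `|a| * (M * rnorm v) by rewrite !mulr_ge0// rnorm_ge0.
have n2 : 0 <= M * rnorm w by rewrite !mulr_ge0// rnorm_ge0.
split => //; first by rewrite ler_peMl ?(ltW e0)// -addrA lerDl addr_ge0.
have Sf : S f by case: nf.
have -> : a *: rep_limit h v + rep_limit h w - L f (a *: v + w) =
    a *: (rep_limit h v - L f v) + (rep_limit h w - L f w).
  by rewrite Llin// scalerBr opprD addrACA.
apply: (le_trans (rnormD _ _)); rewrite rnormZ; apply: (le_trans (lerD b1 b2)).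
have -> : complex.Re `|a| * (M * e * rnorm v) + M * e * rnorm w =
  (complex.Re `|a| * (M * rnorm v) + M * rnorm w) * e by ring.
by rewrite ler_wpM2r ?(ltW e0)// -addrA lerDr.
Qed.

Lemma rep_limit_bound h (N : R) v : C0_equivariant h -> 0 <= N -> I_bounded sec h N ->
  rnorm (rep_limit h v) <= M * N * rnorm v.
Proof.
move=> hh N0 hN; apply/ler_addgt0Pr => e e0.
(* The error [d] is paid twice, as the distance from [L f v] to the limit and in the bound [N + d]
   for [f]. The 1 keeps the denominator positive. *)
pose d := e / (2 * (M * rnorm v) + 1).
have Mv : 0 <= M * rnorm v by rewrite mulr_ge0// rnorm_ge0.
have D0 : 0 < 2 * (M * rnorm v) + 1 by rewrite ltr_wpDl// mulr_ge0.
have d0 : 0 < d by rewrite divr_gt0.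
have [_ _ /(_ d d0)[f nf]] := hh.
have Sf : S f by case: nf.
have Nd : 0 <= N + d by rewrite addr_ge0// ltW.
have b1 := Lbd Sf Nd (near_Cc_bounded hG hE hsec (ltW d0) nf hN) v.
have b2 := rep_limitP v hh d0 nf.
rewrite -(subrK (L f v) (rep_limit h v)).
apply: (le_trans (rnormD _ _)); apply: (le_trans (lerD b2 b1)).
have -> : M * d * rnorm v + M * (N + d) * rnorm v = M * N * rnorm v + d * (2 * (M * rnorm v)) by ring.
rewrite lerD2l; apply: (@le_trans _ _ (d * (2 * (M * rnorm v) + 1))).
  by rewrite ler_wpM2l ?(ltW d0)// lerDl.
by rewrite /d divfK ?gt_eqF.
Qed.

Lemma rep_limitM h k v : C0_equivariant h -> C0_equivariant k ->
  rep_limit (conv h k) v = rep_limit h (rep_limit k v).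
Proof.
move=> hh hk.
have [N N0 hN] := C0_I_bounded hG etG hE hsec hh.
have [K K0 kK] := C0_I_bounded hG etG hE hsec hk.
have hc := C0_conv hG etG hE hsec hh hk.
set w := rep_limit k v.
(* One summand for each comparison: [L f w] with its limit, [L g v] with its limit under [L f], and
   [q] with [conv f g]. Since [e <= 1], [N + e] is replaced by [N + 1]; the leading 1 gives
   [e <= C * e]. *)
pose C := 1 + M * rnorm w + M * (N + 1) * (M * rnorm v) + M * (1 + (N + 1) + K) * rnorm v.
have r1 := rnorm_ge0 w; have r2 := rnorm_ge0 v.
have n1 : 0 <= M * rnorm w by rewrite mulr_ge0.
have n2 : 0 <= M * (N + 1) * (M * rnorm v) by rewrite !mulr_ge0// addr_ge0.
have n3 : 0 <= M * (1 + (N + 1) + K) * rnorm v by rewrite !mulr_ge0// !addr_ge0.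
apply: (@rep_limit_eq _ _ _ C) => // e e0 e1.
have [_ _ /(_ e e0)[f nf]] := hh; have [_ _ /(_ e e0)[g ng]] := hk.
(* [conv f g] need not be an approximant of [conv h k] in the sense of [near_Cc], as their
   difference can reach beyond the units. A genuine approximant [q] is taken and compared with
   [conv f g] in I-norm by [conv_near_bound]. *)
have [_ _ /(_ e e0)[q nq]] := hc.
have Sf : S f by case: nf.
have Sg : S g by case: ng.
have Sq : S q by case: nq.
have e00 := ltW e0.
exists e, q; split => //.
  by rewrite ler_peMl// /C; lra.
have b1 := rep_limitP w hh e0 nf.
have b2 := rep_limitP v hk e0 ng.
have b3 : rnorm (L f w - L f (L g v)) <= M * (N + e) * (M * e * rnorm v).
  rewrite Lv//; have Ne : 0 <= N + e by rewrite addr_ge0.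
  apply: (le_trans (Lbd Sf Ne (near_Cc_bounded hG hE hsec e00 nf hN) _)).
  by apply: ler_wpM2l => //; rewrite mulr_ge0.
have b4 : rnorm (L q v - L f (L g v)) <= M * (e * (1 + (N + e) + K)) * rnorm v.
  rewrite -LM// LB//; last exact: (Cc_equivariant_conv hG etG hE hsec Sf Sg).
  apply: Lbd.
  - by apply: subspace_onB => //; exact: (Cc_equivariant_conv hG etG hE hsec Sf Sg).
  - by rewrite !mulr_ge0// !addr_ge0.
  - exact: (conv_near_bound hG etG hE hsec e0 hh hk nf ng nq hN kK).
have -> : rep_limit h w - L q v =
    (rep_limit h w - L f w) + (L f w - L f (L g v)) - (L q v - L f (L g v)).
  by rewrite (addrA _ (L f w)) subrK opprB addrA subrK.
apply: (le_trans (rnormD _ _)); rewrite rnormN.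
apply: (le_trans (lerD (le_trans (rnormD _ _) (lerD b1 b3)) b4)).
have q1 : M * (N + e) * (M * e * rnorm v) <= M * (N + 1) * (M * rnorm v) * e.
  have -> : M * (N + e) * (M * e * rnorm v) = (M * (M * rnorm v) * e) * (N + e) by ring.
  have -> : M * (N + 1) * (M * rnorm v) * e = (M * (M * rnorm v) * e) * (N + 1) by ring.
  by apply: ler_wpM2l; rewrite ?lerD2l// !mulr_ge0.
have q2 : M * (e * (1 + (N + e) + K)) * rnorm v <= M * (1 + (N + 1) + K) * rnorm v * e.
  have -> : M * (e * (1 + (N + e) + K)) * rnorm v = (M * rnorm v * e) * (1 + (N + e) + K) by ring.
  have -> : M * (1 + (N + 1) + K) * rnorm v * e = (M * rnorm v * e) * (1 + (N + 1) + K) by ring.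
  apply: ler_wpM2l; first by rewrite !mulr_ge0.
  by rewrite lerD2r lerD2l lerD2l.
apply: (le_trans (lerD (lerD (lexx _) q1) q2)).
have -> : M * e * rnorm w = M * rnorm w * e by ring.
by rewrite -!mulrDl ler_wpM2r// /C; lra.
Qed.

Lemma rep_limit_star h v w : C0_equivariant h ->
  hil_dot H (rep_limit h v) w = hil_dot H v (rep_limit (fstar h) w).
Proof.
move=> hh; have hs := C0_fstar hG hE hh.
apply: (@rnorm_eq_small R R[i] _ _ (2 * (M * rnorm v * rnorm w))) => e e0 e1.
have [_ _ /(_ e e0)[f nf]] := hh.
have Sf : S f by case: nf.
have b1 := rep_limitP v hh e0 nf.
have b2 := rep_limitP w hs e0 (near_Cc_fstar hG hE nf).
have -> : hil_dot H (rep_limit h v) w - hil_dot H v (rep_limit (fstar h) w) =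
   hil_dot H (rep_limit h v - L f v) w - hil_dot H v (rep_limit (fstar h) w - L (fstar f) w).
  by rewrite hil_dotBl hil_dotBr Lstar// opprB addrA subrK.
apply: (le_trans (rnormD _ _)); rewrite rnormN.
have c1 := le_trans (rnorm_hil_dot _ _) (ler_wpM2r (rnorm_ge0 w) b1).
have c2 := le_trans (rnorm_hil_dot _ _) (ler_wpM2l (rnorm_ge0 v) b2).
apply: (le_trans (lerD c1 c2)).
by rewrite le_eqVlt; apply/orP; left; apply/eqP; ring.
Qed.

End RepExtension.

(** * The contractive bound over the units and the full norm *)

Section UnitSupportedNorm.
Variables (R : realType) (G : groupoid) (E : twist_data R G).
Hypothesis T : algebraic_twist E.
Let LE := at_total T.
Local Notation proj := (@twist_proj R G E).
Local Notation S := (@Cc_equivariant R G E).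
Local Notation u := (unit_phase (E := E)).
Variable sec : G -> E.
Hypothesis hsec : cancel sec proj.
Local Notation conv := (convolution sec).

Lemma unit_phase_idem : conv u u = u.
Proof. by rewrite (conv_phase_l T hsec)//; exact: equivariant_unit_phase. Qed.

Lemma conv_fstar_unit f : equivariant f -> unit_supported f ->
  conv (fstar f) f = (fun e => u e * (rnorm (f e) ^+ 2)%:C).
Proof.
move=> ef uf; apply/funext => e; rewrite (conv_unitl T hsec)//; first last.
- exact: (unit_supported_fstar T).
- exact: (equivariant_fstar T).
have [/(iota_surj T)[x [z [ux ->]]]|ne] := pselect (units (proj e)); last first.
  by rewrite uf// rnorm0 expr0n /= !mulr0.
rewrite (unit_phase_iota T z ux) (rng_iota T z ux) /fstar (inv_unit LE (iota1_unit T ux)).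
rewrite (iota_act T z ux) ef rnormM rnorm_circle mul1r mulrCA -mulcJ.
by rewrite (mulrC (conjc _)).
Qed.

(* If [h] lives over the units and [|h| <= e], then [h^* h + g^* g = e^2 u] for
   [g = u (e^2 - |h|^2)^(1/2)], and a representation sends [u] to a projection. *)
Lemma equivariant_rep_unit_le (K : hilbert R) (L : (E -> R[i]) -> K -> K) h (e : R) v :
  S u -> (forall f, S f -> S (fstar f)) -> fstar u = u -> equivariant_rep sec L -> S h -> unit_supported h ->
  0 <= e -> (forall d, rnorm (h d) <= e) -> rnorm (L h v) <= e * rnorm v.
Proof.
move=> Su SS us [L1 L2 L3 L4 _] Sh uh e0 he.
pose r d := Num.sqrt (e ^+ 2 - rnorm (h d) ^+ 2).
have cr : continuous r.
  have cn : continuous (fun d => rnorm (h d)) by exact: (cont_comp Sh.1.1 (@rnorm_continuous R R[i])).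
  have c1 : continuous (fun d => e ^+ 2 - rnorm (h d) ^+ 2).
    exact: (contB (@cont_cst E R (e ^+ 2)) (contM cn cn)).
  exact: (cont_comp c1 (@sqrt_continuous R)).
have SM (p : E -> R) : continuous p -> (forall z d, p (circle_act z d) = p d) ->
    S (fun d => u d * (p d)%:C).
  move=> cp ip; split; last by move=> z d; rewrite Su.2 ip mulrA.
  have cpC : continuous (fun d => (p d)%:C).
    move=> d; apply: (@cvg_complex R E (nbhs d) (nbhs_filter d)); first exact: cp.
    exact: (@cont_cst E R 0 d).
  exact: (Cc_mul cpC Su.1).
have Snorm f : S f -> S (fun d => u d * (rnorm (f d) ^+ 2)%:C).
  move=> Sf; apply: SM; last by move=> z d; rewrite (rnorm_equivariant _ _ Sf.2).
  have cn : continuous (fun d => rnorm (f d)) by exact: (cont_comp Sf.1.1 (@rnorm_continuous R R[i])).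
  exact: (contM cn cn).
pose g d := u d * (r d)%:C.
have r2 d : r d ^+ 2 = e ^+ 2 - rnorm (h d) ^+ 2.
  by rewrite /r sqr_sqrtr// subr_ge0 lerXn2r// nnegrE ?rnorm_ge0.
have r0 d : 0 <= r d by exact: sqrtr_ge0.
have ug : unit_supported g by move=> d nd; rewrite /g unit_phase_supported// mul0r.
have Sg : S g by apply: SM => // z d; rewrite /r (rnorm_equivariant _ _ Sh.2).
have Sh2 : S (conv (fstar h) h) by rewrite (conv_fstar_unit Sh.2 uh); exact: Snorm.
have Sg2 : S (conv (fstar g) g) by rewrite (conv_fstar_unit Sg.2 ug); exact: Snorm.
(* Both sides are written in the form [a f + g] so that linearity of [L] applies to each. *)
have sum : (fun d => 1 * conv (fstar h) h d + conv (fstar g) g d) = (fun d => (e ^+ 2)%:C * u d + 0).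
  rewrite (conv_fstar_unit Sh.2 uh) (conv_fstar_unit Sg.2 ug); apply/funext => d.
  rewrite mul1r addr0 -mulrDr mulrC.
  have [ud|nd] := pselect (units (proj d)); last by rewrite unit_phase_supported// !mulr0.
  congr (_ * _); rewrite -rmorphD /=; congr (_%:C).
  have -> : rnorm (g d) = r d.
    rewrite /g rnormM rnormR ger0_norm//.
    move: ud => /(iota_surj T)[x [z [ux ->]]].
    by rewrite (unit_phase_iota T z ux) rnorm_circle mul1r.
  by rewrite r2 addrC subrK.
have Sf0 : S (fun=> 0) by exact: (Cc_equivariant_subspace E).1.
have q f : S f -> hil_dot K (L (conv (fstar f) f) v) v = (rnorm (L f v) ^+ 2)%:C.
  move=> Sf; rewrite (L3 _ _ _ (SS f Sf) Sf) (L4 _ _ _ (SS f Sf)) hil_rnorm.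
  by congr (hil_dot _ _ (L _ v)); apply/funext => d; rewrite /fstar (ginvK LE) conjcK.
have L0 w : L (fun=> 0) w = 0.
  have := L2 0 _ _ w Sf0 Sf0; rewrite scale0r add0r.
  have := L2 1 _ _ w Sf0 Sf0; rewrite scale1r mulr0 addr0.
  by move=> /esym/eqP; rewrite -subr_eq0 addrK => /eqP.
have Luv : hil_dot K (L u v) v = (rnorm (L u v) ^+ 2)%:C.
  by rewrite -q// us unit_phase_idem.
have key : (rnorm (L h v) ^+ 2)%:C + (rnorm (L g v) ^+ 2)%:C = (e ^+ 2)%:C * (rnorm (L u v) ^+ 2)%:C :> R[i].
  rewrite -!q// us unit_phase_idem.
  have := congr1 (fun f => hil_dot K (L f v) v) sum.
  rewrite /= (L2 1 _ _ v Sh2 Sg2) (L2 _ _ _ v Su Sf0).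
  by rewrite scale1r L0 addr0 hil_dotDl hil_dotZl.
move: key; rewrite -rmorphD -rmorphM => -[key].
have Pu : rnorm (L u v) <= rnorm v.
  apply: (@hil_projection_le R K (L u)); first by move=> x y; rewrite (L4 _ _ _ Su) us.
  by move=> x; rewrite -(L3 _ _ _ Su Su) unit_phase_idem.
rewrite -(@ler_pXn2r _ 2)// ?nnegrE ?mulr_ge0 ?rnorm_ge0// exprMn.
apply: (@le_trans _ _ (e ^+ 2 * rnorm (L u v) ^+ 2)).
  by rewrite -key lerDl exprn_ge0// rnorm_ge0.
by apply: ler_wpM2l; [exact: exprn_ge0|rewrite lerXn2r// nnegrE rnorm_ge0].
Qed.

End UnitSupportedNorm.

Section FullNorm.
Variables (R : realType) (G : groupoid) (E : twist_data R G).
Hypotheses (hG : lch_groupoid G) (etG : etale G) (hE : is_twist E).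
Hypothesis unit_exists : exists x : G, units x.
Let T := is_twist_algebraic hG hE.
Let T' := alex_algebraic_twist T.
Let RT := regular_twist_total hG etG hE unit_exists.
Let RT' := regular_twist_alex hG etG hE.
Local Notation proj := (@twist_proj R G E).
Local Notation G' := (alex_groupoid G).
Local Notation E' := (alex_twist E).
Local Notation proj' := (@twist_proj R G' E').
Local Notation S := (@Cc_equivariant R G E).
Local Notation S' := (@Cc_equivariant R G' E').
Local Notation inr1 := (inr (circle_one R) : E').
Variables (sec : G -> E) (sec' : G' -> E').
Hypotheses (hsec : cancel sec proj) (hsec' : cancel sec' proj').
Implicit Types (F K : E' -> R[i]).

Lemma Cc_equivariant_fstar_alex F : S' F -> S' (fstar F).
Proof.
move=> [CF eF]; split; last exact: (equivariant_fstar T').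
have [K [cK clK FK]] := Cc_elim CF.
have cg := ginv_alex_continuous hG etG hE.
apply: (@Cc_intro _ _ E' _ (@ginv E' @^-1` K)).
- exact: (rt_fstar RT' CF.1).
- have -> : @ginv E' @^-1` K = @ginv E' @` K.
    apply/seteqP; split => [e Ke|_ [e Ke <-]]; last first.
      by change (K (ginv (ginv e))); rewrite (ginvK (at_total T')).
    by exists (ginv e) => //; rewrite (ginvK (at_total T')).
  by apply: continuous_compact cK; exact: continuous_subspaceT cg.
- exact: cont_closed_preimage cg clK.
- by move=> e; rewrite /fstar conjc_eq0 => /FK.
Qed.

Lemma equivariant_rep_restrict (H : hilbert R) (L : (E' -> R[i]) -> H -> H) :
  equivariant_rep (alex_sec sec) L -> equivariant_rep sec (fun f => L (extend f)).
Proof.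
move=> [L1 L2 L3 L4 [M M0 LM]]; have SE := Cc_equivariant_extend hG etG hE.
split.
- by move=> f Sf; apply: L1; exact: SE.
- by move=> a f g v Sf Sg; rewrite extend_lin; apply: L2; exact: SE.
- by move=> f g v Sf Sg; rewrite (extend_conv hG etG hE hsec Sf Sg); apply: L3; exact: SE.
- by move=> f v w Sf; rewrite extend_fstar; apply: L4; exact: SE.
- exists M => // f N Sf N0 fN; apply: LM => //; first exact: SE.
  by apply/I_bounded_alex; split => //=; rewrite rnorm0.
Qed.

Lemma equivariant_rep_infinity (H : hilbert R) :
  equivariant_rep (alex_sec sec) (fun F (v : H) => F inr1 *: v).
Proof.
split.
- by move=> F _ a v w; rewrite scalerDr !scalerA mulrC.
- by move=> a F K v _ _; rewrite scalerDl scalerA.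
- by move=> F K v SF SK; rewrite (conv_inr hG hE hsec _ SF.2 SK.2) scalerA.
- move=> F v w SF; rewrite hil_dotZl hil_dotZr /fstar conjcK; congr (F (inr _) * _).
  by apply: val_inj; rewrite /= invr1.
- exists 1 => // F N SF N0 /I_bounded_alex[_ FN] v; rewrite mul1r rnormZ.
  by apply: ler_wpM2r => //; exact: rnorm_ge0.
Qed.

Lemma equivariant_rep_extend (H : hilbert R) (L : (E -> R[i]) -> H -> H) :
  equivariant_rep sec L -> exists2 L' : (E' -> R[i]) -> H -> H,
    equivariant_rep (alex_sec sec) L' & forall f v, S f -> L' (extend f) v = L f v.
Proof.
move=> [L1 L2 L3 L4 [M M0 LM]].
have lP := rep_limit_lin hG hE hsec M0 L2 LM.
have C0 := C0_finite_part hG etG hE.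
exists (fun F v => rep_limit L M (finite_part F) v + F inr1 *: v); last first.
  move=> f v Sf; rewrite finite_part_extend /= scale0r addr0.
  exact: (rep_limit_Cc hG hE hsec M0 L2 LM).
split.
- move=> F SF a v w; rewrite (linear_rep_limit hG hE hsec M0 L1 L2 LM (C0 _ SF)).
  by rewrite scalerDr [in RHS]scalerDr !scalerA (mulrC a) addrACA.
- move=> a F K v SF SK; rewrite finite_part_lin (lP _ _ _ _ (C0 _ SF) (C0 _ SK)).
  by rewrite scalerDl scalerDr scalerA addrACA.
- move=> F K v SF SK; rewrite (finite_part_conv hG etG hE hsec SF SK).
  have cF := C0 _ SF; have cK := C0 _ SK.
  rewrite (conv_inr hG hE hsec _ SF.2 SK.2).
  set c := F inr1; set d := K inr1.
  have cFK := C0_conv hG etG hE hsec cF cK.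
  (* Scalar multiples are obtained from linearity of the limit by writing [a h = (a - 1) h + h]. *)
  have Z (a : R[i]) h : C0_equivariant h ->
      C0_equivariant (fun e => a * h e) /\ rep_limit L M (fun e => a * h e) v = a *: rep_limit L M h v.
    move=> hh; have -> : (fun e => a * h e) = (fun e => (a - 1) * h e + h e).
      by apply/funext => e; ring.
    split; first exact: C0_lin.
    by rewrite lP// scalerBl scale1r subrK.
  have [cd ed] := Z d _ cF.
  rewrite (lP _ _ _ _ cFK (C0_lin c cK cd)) (lP _ _ _ _ cK cd) ed.
  rewrite (rep_limitM hG etG hE hsec M0 L1 L2 L3 LM _ cF cK) scale1r.
  have -> : rep_limit L M (finite_part K) v + d *: v = d *: v + rep_limit L M (finite_part K) v by rewrite addrC.
  rewrite (linear_rep_limit hG hE hsec M0 L1 L2 LM cF) scalerDr scalerA.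
  rewrite (addrC (d *: _) (rep_limit _ _ _ _)) -!addrA; congr (_ + _).
  by rewrite addrCA; congr (_ + _); rewrite addrC.
- move=> F v w SF; rewrite hil_dotDl hil_dotDr (finite_part_fstar hG hE SF.2).
  rewrite (rep_limit_star hG hE hsec L2 L4 LM _ _ (C0 _ SF)); congr (_ + _).
  rewrite hil_dotZl hil_dotZr /fstar conjcK; congr (F (inr _) * _).
  by apply: val_inj; rewrite /= invr1.
(* The finite part has I-bound [2 N]: [N] from [F] and [N] from the multiple of the phase function
   removed from it. The scalar at infinity adds another [N]. *)
- exists (2 * M + 1) => [|F N SF N0 /I_bounded_alex[FN cN] v].
    by rewrite addr_ge0// mulr_ge0.
  have hN : I_bounded sec (finite_part F) (N + N).
    apply: (I_boundedD _ FN (I_bounded_unit T hsec N0 _ _) (g := fun e => F inr1 * unit_phase e)).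
    + by move=> e; rewrite /finite_part (le_trans (rnormD _ _))// rnormN.
    + by move=> e ne; rewrite unit_phase_supported// mulr0.
    + move=> e; rewrite rnormM; apply: le_trans cN; rewrite ler_piMr ?rnorm_ge0//.
      exact: rnorm_unit_phase.
  apply: (le_trans (rnormD _ _)); rewrite rnormZ.
  have NN : 0 <= N + N by rewrite addr_ge0.
  have b1 := rep_limit_bound hG hE hsec M0 L2 LM v (C0 _ SF) NN hN.
  have b2 := ler_wpM2r (rnorm_ge0 v) cN.
  apply: (le_trans (lerD b1 b2)).
  by rewrite le_eqVlt; apply/orP; left; apply/eqP; ring.
Qed.

(** Restricting representations to [E] gives one inequality, extending them to the Alexandrov twist
    the other. *)
Lemma full_norm_extend f : S f -> full_norm sec' (extend f) = full_norm sec f.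
Proof.
move=> Sf; have SE := Cc_equivariant_extend hG etG hE Sf.
have hA := alex_secK hsec; apply/eqP; rewrite eq_le; apply/andP; split.
  apply: (full_norm_le RT') => H L eL.
  have eL' := equivariant_rep_restrict (equivariant_rep_section RT' hsec' hA eL).
  exact: (full_norm_ge RT hsec Sf eL').
apply: (full_norm_le RT) => H L eL.
have [L' eL' LE] := equivariant_rep_extend eL.
have -> : L f = L' (extend f) by apply/funext => v; rewrite LE.
exact: (full_norm_ge RT' hsec' SE (equivariant_rep_section RT' hA hsec' eL')).
Qed.

Lemma full_norm_inr F : S' F -> ((rnorm (F inr1))%:E <= full_norm sec' F)%E.
Proof.
move=> SF; have hA := alex_secK hsec.
have eL := equivariant_rep_section RT' hA hsec' (equivariant_rep_infinity (scalar_hilbert R)).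
apply: le_trans (full_norm_ge RT' hsec' SF eL).
apply: ereal_sup_ubound; exists (1 : R[i]).
  by rewrite /= /rnorm normr1.
by rewrite /= rnormZ /rnorm normr1 /= mulr1.
Qed.

Lemma full_norm_unit F (e : R) : S' F -> unit_supported F -> 0 <= e ->
  (forall p, rnorm (F p) <= e) -> (full_norm sec' F <= e%:E)%E.
Proof.
move=> SF uF e0 Fe; apply: (full_norm_le RT') => H L eL.
apply: op_norm_le => // v.
apply: (equivariant_rep_unit_le T' hsec' v _ Cc_equivariant_fstar_alex _ eL SF uF e0 Fe).
  exact: (Cc_unit_phase hG hE).
exact: (fstar_unit_phase T').
Qed.

End FullNorm.

(** * The reduced norm *)

(** The full algebra is defined as a closure inside a larger completion. As [k] is isometric with
    range that closure, [j] factors through [k] on equivariant functions, which puts the full case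
    in the same form as the reduced one. *)
Lemma full_cstar_completion (R : realType) (G : groupoid) (E : twist_data R G)
    (sec : G -> E) (A : cstar_algebra R) : is_full_cstar sec A ->
  exists j : (E -> R[i]) -> A,
    is_completion (@Cc_equivariant R G E) (convolution sec) (@fstar R G E) (full_norm sec) j.
Proof.
move=> [B [j [k [[jD jM js jn _] [kM ks] ki kr]]]].
have kinj : injective k.
  move=> a b kab; apply/eqP; rewrite -subr_eq0 -normr_eq0 -ki raddfB /=.
  by rewrite kab subrr normr0.
pose j' f := xget 0 [set a | k a = j f].
have j'E f : Cc_equivariant f -> k (j' f) = j f.
  move=> Sf; have : range k (j f) by rewrite kr; apply: subset_closure; exists f.
  by move=> [a _ ka]; rewrite /j'; apply: (@xgetPex _ 0 [set a | k a = j f]); exists a.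
have j'_uniq f a : k a = j f -> j' f = a.
  move=> ka; apply: kinj; rewrite ka.
  by rewrite /j'; apply: (@xgetPex _ 0 [set a | k a = j f]); exists a.
exists j'; split.
- move=> a f g Sf Sg; apply: j'_uniq; rewrite linearP /= !j'E//.
  by rewrite jD//; [exact: Sf.1|exact: Sg.1].
- move=> f g Sf Sg; apply: j'_uniq; rewrite kM !j'E//.
  by rewrite jM//; [exact: Sf.1|exact: Sg.1].
- move=> f Sf; apply: j'_uniq; rewrite ks j'E//.
  by rewrite js//; exact: Sf.1.
- move=> f Sf; rewrite -jn; last exact: Sf.1.
  by rewrite -j'E// /rnorm ki.
- rewrite -subTset => a _ V /nbhs_ballP[e /= e0 eV].
  have e0' : 0 < complex.Re e by move: e0; rewrite ltcE /= => /andP[].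
  have eE : e = (complex.Re e)%:C by move: e0; case: (e) => x y; rewrite ltcE /= => /andP[/eqP ->].
  have : closure (j @` (@Cc_equivariant R G E)) (k a) by rewrite -kr; exists a.
  move=> /(_ _ (nbhsx_ballx (k a) e e0))[_ [[f Sf <-] fa]].
  exists (j' f); split; first by exists f.
  by apply: eV; move: fa; rewrite -!ball_normE /= -j'E// -raddfB /= ki.
Qed.

(** * Square-summable equivariant vectors on source fibres *)

Section L2.
Variables (R : realType) (G : groupoid) (E : twist_data R G).
Hypothesis T : algebraic_twist E.
Let LE := at_total T.
Local Notation proj := (@twist_proj R G E).
Variable sec : G -> E.
Hypothesis hsec : cancel sec proj.
Local Notation conv := (convolution sec).
Implicit Types (f xi : E -> R[i]) (x : G).

Definition src_equivariant x xi :=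
  forall z e, proj (src e) = x -> xi (circle_act z e) = val z * xi e.

(** Inverses of the section over the range fibre of [x] represent the orbits of the source fibre, in
    accordance with the source measure being the image of the range measure under inversion. *)
Definition l2_sum x xi : \bar R :=
  \esum_(y in [set y | rng y = x]) (rnorm (xi (ginv (sec y))) ^+ 2)%:E.

Lemma l2_sum_ge0 x xi : (0 <= l2_sum x xi)%E.
Proof. by apply: esum_ge0 => y _; rewrite lee_fin exprn_ge0// rnorm_ge0. Qed.

Lemma L2_normE x xi : src_equivariant x xi -> L2_norm sec x xi = ((l2_sum x xi) `^ 2^-1)%E.
Proof.
move=> exi; congr poweR; apply: eq_esum => y /= yx.
transitivity (circle_eint (fun _ : circle R => (rnorm (xi (ginv (sec y))) ^+ 2)%:E)).
  congr circle_eint; apply/funext => z; congr (_ ^+ 2)%:E.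
  rewrite (ginv_act T) exi ?rnormM ?rnorm_circle ?mul1r//.
  by rewrite (src_inv LE) (proj_rng T) hsec.
by rewrite circle_eintE ?circle_rint_cst//; exact: cont_cst.
Qed.

Lemma src_equivariant_conv x f xi : equivariant f -> src_equivariant x xi ->
  src_equivariant x (conv f xi).
Proof.
move=> ef exi z e ex.
have H e0 : proj (src e0) = x -> conv f xi e0 =
    \sum_(y \in [set y | rng y = proj (rng e0)]) f (sec y) * xi (gmul (ginv (sec y)) e0).
  move=> e0x; apply: (conv_gen T hsec ef) => z' e' ee'; apply: exi.
  by rewrite ee'.
rewrite !H ?(src_act T)// (rng_act T) -[RHS]/(GRing.mul (val z) _) mulr_fsumr.
apply: eq_fsbigr => y; rewrite inE /= => yx.
have rd : rng (sec y) = rng e by apply/(rng_sec T hsec); rewrite yx.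
have cd := composable_Vl LE rd.
rewrite (gmul_actr T z cd) exi; first by rewrite mulrCA.
by rewrite (src_mul LE cd).
Qed.

(** By [conv_unitl_gen], convolution by [f] multiplies [xi] pointwise by values of [f] at units,
    each of modulus at most [e]. *)
Lemma l2_sum_unit x f xi (e : R) : 0 <= e -> equivariant f -> unit_supported f ->
  (forall d, rnorm (f d) <= e) -> src_equivariant x xi ->
  (l2_sum x (conv f xi) <= (e ^+ 2)%:E * l2_sum x xi)%E.
Proof.
move=> e0 ef uf fe exi; apply: ge_ereal_sup => _ [A [finA Ax] <-].
apply: (@le_trans _ _ (\sum_(y \in A) ((e ^+ 2)%:E * (rnorm (xi (ginv (sec y))) ^+ 2)%:E))%E).
  apply: lee_fsum => // y Ay; rewrite -EFinM lee_fin.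
  rewrite (conv_unitl_gen T hsec)//; last first.
    move=> z' e' ee'; apply: exi; rewrite ee' (src_inv LE) (proj_rng T) hsec.
    exact: Ax.
  rewrite rnormM exprMn ler_wpM2r ?exprn_ge0 ?rnorm_ge0//.
  by rewrite lerXn2r// nnegrE rnorm_ge0.
rewrite -ge0_mule_fsumr; last by move=> y; rewrite lee_fin exprn_ge0// rnorm_ge0.
apply: lee_wpmul2l; first by rewrite lee_fin exprn_ge0.
by apply: ereal_sup_ubound; exists A.
Qed.

Lemma le_poweR_half (a b : \bar R) : (0 <= a)%E -> (a <= b)%E -> (a `^ 2^-1 <= b `^ 2^-1)%E.
Proof.
move=> a0 ab; apply: gt0_ler_poweR => //; rewrite in_itv /= leey andbT//.
exact: le_trans ab.
Qed.

Lemma reduced_norm_unit f (e : R) : 0 <= e -> equivariant f -> unit_supported f ->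
  (forall d, rnorm (f d) <= e) -> (reduced_norm sec f <= e%:E)%E.
Proof.
move=> e0 ef uf fe; apply: ge_ereal_sup => _ [x ux <-].
apply: ge_ereal_sup => _ [xi [[exi _] xi1] <-].
rewrite (L2_normE (src_equivariant_conv ef exi)).
apply: le_trans (le_poweR_half (l2_sum_ge0 _ _) (l2_sum_unit e0 ef uf fe exi)) _.
rewrite poweRM ?l2_sum_ge0 ?lee_fin ?exprn_ge0// -(L2_normE exi).
rewrite poweR_EFin powR12_sqrt ?exprn_ge0// sqrtr_sqr ger0_norm//.
by rewrite -[leRHS]mule1 lee_wpmul2l// lee_fin.
Qed.

End L2.

Section L2Section.
Variables (R : realType) (G : groupoid) (E : twist_data R G).
Hypothesis T : algebraic_twist E.
Local Notation proj := (@twist_proj R G E).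
Variables (sec sec' : G -> E).
Hypotheses (hsec : cancel sec proj) (hsec' : cancel sec' proj).

Lemma l2_sum_section x xi : src_equivariant x xi -> l2_sum sec x xi = l2_sum sec' x xi.
Proof.
move=> exi; apply: eq_esum => y /= yx; congr (_ ^+ 2)%:E.
have [z ->] : exists z, sec y = circle_act z (sec' y) by apply: (same_proj T); rewrite hsec hsec'.
rewrite (ginv_act T) exi ?rnormM ?rnorm_circle ?mul1r//.
by rewrite (src_inv (at_total T)) (proj_rng T) hsec'.
Qed.

Lemma L2_norm_section x xi : src_equivariant x xi -> L2_norm sec x xi = L2_norm sec' x xi.
Proof. by move=> exi; rewrite (L2_normE T hsec)// (L2_normE T hsec')// l2_sum_section. Qed.

End L2Section.

Lemma reduced_norm_section (R : realType) (G : groupoid) (E : twist_data R G)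
    (sec sec' : G -> E) f : algebraic_twist E ->
  cancel sec (@twist_proj R G E) -> cancel sec' (@twist_proj R G E) ->
  equivariant f -> reduced_norm sec f = reduced_norm sec' f.
Proof.
move=> T h h' ef.
have E1 x xi : src_equivariant x xi -> L2_norm sec x (convolution sec f xi) = L2_norm sec' x (convolution sec' f xi).
  move=> exi; have ec := src_equivariant_conv T h' ef exi.
  have ec' := src_equivariant_conv T h ef exi.
  rewrite (L2_norm_section T h h' ec') (L2_normE T h' ec) (L2_normE T h' ec'); apply: (congr1 (fun a => (a `^ 2^-1)%E)).
  apply: eq_esum => y /= yx; apply: (congr1 (fun a => (rnorm a ^+ 2)%:E)).
  apply: (conv_section T h h' ef) => z e' ee'; apply: exi.
  by rewrite ee' (src_inv (at_total T)) (proj_rng T) h'.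
have E2 x : regular_rep_norm sec x f = regular_rep_norm sec' x f.
  rewrite /regular_rep_norm; apply: (congr1 (@ereal_sup R)); apply/seteqP; split => _ [xi [[exi xin] xi1] <-].
    have e1 := L2_norm_section T h h' exi.
    by exists xi; [split; [split|]; rewrite ?e1 -?e1|rewrite E1].
  have e1 := L2_norm_section T h h' exi.
  by exists xi; [split; [split|]; rewrite ?e1|rewrite E1].
by rewrite /reduced_norm; apply: (congr1 (@ereal_sup R)); apply: eq_imagel => x _; exact: E2.
Qed.

Section ReducedNorm.
Variables (R : realType) (G : groupoid) (E : twist_data R G).
Hypotheses (hG : lch_groupoid G) (etG : etale G) (hE : is_twist E).
Hypothesis unit_exists : exists x : G, units x.
Let T := is_twist_algebraic hG hE.
Let T' := alex_algebraic_twist T.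
Local Notation proj := (@twist_proj R G E).
Local Notation G' := (alex_groupoid G).
Local Notation E' := (alex_twist E).
Local Notation proj' := (@twist_proj R G' E').
Local Notation S := (@Cc_equivariant R G E).
Local Notation S' := (@Cc_equivariant R G' E').
Local Notation inr1 := (inr (circle_one R) : E').
Variables (sec : G -> E) (sec' : G' -> E').
Hypotheses (hsec : cancel sec proj) (hsec' : cancel sec' proj').
Implicit Types (F xi : E' -> R[i]).
Let hA := alex_secK hsec.

Lemma src_inl_equivariant x xi : src_equivariant (Some x : G') xi ->
  src_equivariant x (fun e : E => xi (inl e)).
Proof. by move=> exi z e ex; rewrite -act_inl exi//= -ex. Qed.

Lemma l2_sum_some x xi : l2_sum (alex_sec sec) (Some x) xi = l2_sum sec x (fun e => xi (inl e)).
Proof.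
by rewrite /l2_sum alex_fiber esum_image//; exact: Some_inj.
Qed.

Lemma l2_sum_none xi : l2_sum (alex_sec sec) None xi = (rnorm (xi inr1) ^+ 2)%:E.
Proof.
rewrite /l2_sum alex_fiber_none esum_set1; last by rewrite lee_fin exprn_ge0// rnorm_ge0.
by congr ((rnorm (xi (inr _)) ^+ 2)%:E); apply: val_inj; rewrite /= invr1.
Qed.

Lemma conv_src_inl F xi e : equivariant F -> src_equivariant (Some (proj (src e)) : G') xi ->
  convolution (alex_sec sec) F xi (inl e) =
  convolution sec (fun e => F (inl e)) (fun e => xi (inl e)) e.
Proof.
move=> eF exi.
rewrite (conv_gen T' hA eF) => [|z e' ee']; last first.
  by apply: exi; rewrite ee'.
rewrite (conv_gen T hsec (equivariant_inl eF)) => [|z e' ee']; last first.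
  by apply: (src_inl_equivariant exi); rewrite ee'.
have -> : [set y : G' | rng y = proj' (rng (inl e : E'))] = Some @` [set y | rng y = proj (rng e)].
  exact: alex_fiber.
by rewrite fsbig_image//; move=> a b _ _ [].
Qed.

Lemma reduced_norm_extend f : S f -> reduced_norm sec' (extend f) = reduced_norm sec f.
Proof.
move=> Sf; have SE := Cc_equivariant_extend hG etG hE Sf.
have p0 : ((0%:E : \bar R) `^ 2^-1 = 0)%E by rewrite poweR_EFin powR0// invr_eq0 pnatr_eq0.
rewrite (reduced_norm_section T' hsec' hA SE.2); apply/eqP; rewrite eq_le; apply/andP; split.
  apply: ge_ereal_sup => _ [[x|] ux <-].
    apply: ge_ereal_sup => _ [xi [[exi xin] xi1] <-].
    have ei := src_inl_equivariant exi.
    have e1 : L2_norm (alex_sec sec) (Some x) xi = L2_norm sec x (fun e => xi (inl e)).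
      by rewrite (L2_normE T' hA exi) (L2_normE T hsec ei) l2_sum_some.
    apply: (@le_trans _ _ (regular_rep_norm sec x f)); last first.
      by apply: ereal_sup_ubound; exists x => //; have /alex_units := ux.
    apply: ereal_sup_ubound; exists (fun e => xi (inl e)).
      by split; [split => //|]; rewrite -e1.
    rewrite (L2_normE T' hA (src_equivariant_conv T' hA SE.2 exi)).
    rewrite (L2_normE T hsec (src_equivariant_conv T hsec Sf.2 ei)) l2_sum_some.
    apply: (congr1 (fun a => (a `^ 2^-1)%E)); apply: eq_esum => y /= yx.
    apply: (congr1 (fun a => (rnorm a ^+ 2)%:E)); symmetry.
    rewrite (conv_src_inl SE.2)//.
    by rewrite (src_inv (at_total T)) (proj_rng T) hsec yx.
  (* In the fibre at infinity [extend f] acts as 0. The reduced norm of [f] is at least 0, as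
     testing the zero vector at an existing unit shows. *)
  apply: (@le_trans _ _ 0%E); last first.
    have [x ux'] := unit_exists.
    apply: (@le_trans _ _ (regular_rep_norm sec x f)); last by apply: ereal_sup_ubound; exists x.
    have e0 : src_equivariant x (fun _ : E => 0 : R[i]) by move=> z e _; rewrite mulr0.
    have n0 : L2_norm sec x (fun _ : E => 0) = 0%E.
      rewrite (L2_normE T hsec e0) /l2_sum esum1; first exact: p0.
      by move=> y _; rewrite rnorm0 expr0n.
    apply: (@le_trans _ _ (L2_norm sec x (convolution sec f (fun=> 0)))); first exact: poweR_ge0.
    by apply: ereal_sup_ubound; exists (fun=> 0) => //; split; [split => //|]; rewrite n0.
  apply: ge_ereal_sup => _ [xi [[exi _] _] <-].
  rewrite (L2_normE T' hA (src_equivariant_conv T' hA SE.2 exi)) l2_sum_none.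
  rewrite (conv_gen T' hA SE.2) => [|z e' ee']; last by apply: exi; rewrite ee'.
  rewrite [X in rnorm X](_ : _ = 0) ?rnorm0 ?expr0n ?p0//.
  by rewrite alex_fiber_none fsbig_set1 /= mul0r.
apply: ge_ereal_sup => _ [x ux <-].
apply: (@le_trans _ _ (regular_rep_norm (alex_sec sec) (Some x) (extend f))); last first.
  by apply: ereal_sup_ubound; exists (Some x) => //; apply/alex_units.
apply: ge_ereal_sup => _ [xi [[exi xin] xi1] <-].
have ei : src_equivariant (Some x : G') (extend xi).
  by move=> z [e|w] //= [ex]; rewrite -exi.
have e1 : L2_norm (alex_sec sec) (Some x) (extend xi) = L2_norm sec x xi.
  by rewrite (L2_normE T' hA ei) (L2_normE T hsec exi) l2_sum_some.
apply: ereal_sup_ubound; exists (extend xi); first by split; [split => //|]; rewrite e1.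
rewrite (L2_normE T' hA (src_equivariant_conv T' hA SE.2 ei)).
rewrite (L2_normE T hsec (src_equivariant_conv T hsec Sf.2 exi)) l2_sum_some.
apply: (congr1 (fun a => (a `^ 2^-1)%E)); apply: eq_esum => y /= yx.
apply: (congr1 (fun a => (rnorm a ^+ 2)%:E)).
rewrite (conv_src_inl SE.2)//.
by rewrite (src_inv (at_total T)) (proj_rng T) hsec yx.
Qed.

(** The phase function is a unit vector of the fibre at infinity and a right unit for convolution,
    so the image to measure is [F] itself. *)
Lemma reduced_norm_inr F : S' F -> ((rnorm (F inr1))%:E <= reduced_norm sec' F)%E.
Proof.
move=> SF; rewrite (reduced_norm_section T' hsec' hA SF.2).
apply: (@le_trans _ _ (regular_rep_norm (alex_sec sec) None F)); last first.
  by apply: ereal_sup_ubound; exists None => //; apply/alex_units.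
have n1 (a : R) : 0 <= a -> ((a ^+ 2)%:E `^ 2^-1)%E = a%:E.
  by move=> a0; rewrite poweR_EFin powR12_sqrt ?exprn_ge0// sqrtr_sqr ger0_norm.
have eu : src_equivariant (None : G') (unit_phase (E := E')) by move=> z e _; exact: equivariant_unit_phase.
have nu : L2_norm (alex_sec sec) None (unit_phase (E := E')) = 1%E.
  by rewrite (L2_normE T' hA eu) l2_sum_none n1 ?rnorm_ge0// (unit_phase_inr hG hE) rnorm_circle.
apply: ereal_sup_ubound; exists (unit_phase (E := E')).
  by split; [split => //|]; rewrite nu// ltry.
rewrite (conv_phase_r T' hA SF.2) (L2_normE T' hA) => [|z e _]; last exact: SF.2.
by rewrite l2_sum_none n1// rnorm_ge0.
Qed.

End ReducedNorm.

(** The algebra and topology are common to both norms. What is specific to each is condensed into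
    three conditions: extension by zero is isometric, evaluation at infinity is contractive, and
    over the units the norm is at most the supremum norm. *)
Lemma alexandrov_unitization (R : realType) (G : groupoid) (E : twist_data R G)
    (sec : G -> E) (sec' : alex_groupoid G -> alex_twist E)
    (nu : (E -> R[i]) -> \bar R) (nu' : (alex_twist E -> R[i]) -> \bar R)
    (A A' : cstar_algebra R) j j' :
  lch_groupoid G -> etale G -> is_twist E ->
  cancel sec (@twist_proj R G E) -> cancel sec' (@twist_proj R _ (alex_twist E)) ->
  (forall f, Cc_equivariant f -> nu' (extend f) = nu f) ->
  (forall F : alex_twist E -> R[i], Cc_equivariant F -> ((rnorm (F (inr (circle_one R))))%:E <= nu' F)%E) ->
  (forall (F : alex_twist E -> R[i]) (e : R), Cc_equivariant F -> unit_supported F -> 0 <= e ->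
    (forall p, rnorm (F p) <= e) -> (nu' F <= e%:E)%E) ->
  is_completion (@Cc_equivariant R G E) (convolution sec) (@fstar R G E) nu (j : _ -> A) ->
  is_completion (@Cc_equivariant R _ (alex_twist E)) (convolution sec') (@fstar R _ (alex_twist E)) nu'
    (j' : _ -> A') ->
  minimal_unitization A A'.
Proof.
move=> hG etG hE hsec hsec' nu_ext nu_inr nu_unit hj hj'.
have T := is_twist_algebraic hG hE; have T' := alex_algebraic_twist T.
have SE f := Cc_equivariant_extend hG etG hE (f := f).
apply: (@minimal_unitization_completion _ _ _ _ _ _ _ _ _ _ _ _ _ _ _
  (@extend R G E) (unit_phase (E := alex_twist E)) (fun F => F (inr (circle_one R))) hj hj').
- exact: Cc_equivariant_subspace.
- by move=> f g; exact: (Cc_equivariant_conv hG etG hE hsec).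
- by move=> f; exact: (Cc_equivariant_fstar hG hE).
- exact: Cc_equivariant_subspace.
- exact: (Cc_unit_phase hG hE).
- by move=> f; exact: SE.
- by move=> a f g; exact: extend_lin.
- move=> f g Sf Sg; rewrite (extend_conv hG etG hE hsec Sf Sg); apply/funext => p.
  apply: (conv_section T' (alex_secK hsec) hsec'); first exact: (SE _ Sf).2.
  by move=> z e _; exact: (SE _ Sg).2.
- by move=> f _; exact: extend_fstar.
- exact: nu_ext.
- move=> F SF; split; first exact: (conv_phase_l T' hsec' SF.2).
  exact: (conv_phase_r T' hsec' SF.2).
- by [].
- by rewrite (unit_phase_inr hG hE).
- by [].
- exact: nu_inr.
(* When [F] vanishes at infinity its finite part is its restriction to [E]. An approximant of it
   leaves an error supported over the units and at most [e], which the third condition controls. *)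
move=> F e SF F0 e0.
have [_ _ /(_ e e0)[f [Sf uf fe]]] := C0_finite_part hG etG hE SF.
exists f => //; apply: nu_unit; last 1 first.
- move=> [d|z] /=.
    by have := fe d; rewrite /finite_part F0 mul0r subr0.
  by rewrite (equivariant_inr _ SF.2) F0 mul0r subr0 rnorm0 ltW.
- exact: (subspace_onB (Cc_equivariant_subspace _) SF (SE _ Sf)).
- move=> [d|z] np /=.
    have := uf d; rewrite /finite_part F0 mul0r subr0; apply => ud; apply: np.
    exact/alex_units.
  by rewrite (equivariant_inr _ SF.2) F0 mul0r subr0.
- exact: ltW.
Qed.

Lemma star_isomorphic_refl (R : realType) (A : cstar_algebra R) : star_isomorphic A A.
Proof. by exists idfun => //; exists id. Qed.

Theorem lemma3p8 (R : realType) (G : groupoid) (E : twist_data R G)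
    (s : G -> E) (s' : alex_groupoid G -> alex_twist E)
    (hG : lch_groupoid G) (hetale : etale G) (hnc : ~ compact (@units G))
    (hE : is_twist E)
    (hs : cancel s (twist_proj (t := E)))
    (hs' : cancel s' (twist_proj (t := alex_twist E))) :
  (forall A A' : cstar_algebra R,
     is_full_cstar s A -> is_full_cstar s' A' ->
     exists2 U, minimal_unitization A U & star_isomorphic A' U) /\
  (forall A A' : cstar_algebra R,
     is_reduced_cstar s A -> is_reduced_cstar s' A' ->
     exists2 U, minimal_unitization A U & star_isomorphic A' U).
Proof.
(* An empty unit space would be compact. *)
have unit_exists : exists x : G, units x.
  apply: contrapT => /forallNP nu; apply: hnc.
  by have -> : @units G = set0; [rewrite -subset0 => x /nu|exact: compact0].
split => A A'.
  move=> /full_cstar_completion [j hj] /full_cstar_completion [j' hj'].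
  (* The algebra of the Alexandrov twist is itself shown to be a minimal unitization, so the
     isomorphism is the identity. *)
  exists A'; last exact: star_isomorphic_refl.
  apply: (alexandrov_unitization hG hetale hE hs hs' _ _ _ hj hj').
  - exact: (full_norm_extend hG hetale hE unit_exists hs hs').
  - exact: (full_norm_inr hG hetale hE hs hs').
  - exact: (full_norm_unit hG hetale hE hs').
move=> [j hj] [j' hj']; exists A'; last exact: star_isomorphic_refl.
apply: (alexandrov_unitization hG hetale hE hs hs' _ _ _ hj hj').
- exact: (reduced_norm_extend hG hetale hE unit_exists hs hs').
- exact: (reduced_norm_inr hG hE hs hs').
- move=> F e SF uF e0 Fe.
  exact: (reduced_norm_unit (alex_algebraic_twist (is_twist_algebraic hG hE)) hs' e0 SF.2 uF Fe).
Qed.
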